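(* Let $p\geq1$. Assume $f:\mathbb{R}^d\to\mathbb{R}^d$ and $g:\mathbb{R}^d\to\mathbb{M}^d$ satisfy: (H1) $f$ is continuous with $|f(x)|\leq L(1+|x|)$ for some $L>0$ and all $x$, and $\|g(x)-g(y)\|\leq C_\alpha|x-y|^\alpha$ for some $\alpha\in(p-1,1]$, $C_\alpha>0$ and all $x,y$; (H2) for every $k\in\mathbb{N}$ there is $L_k>0$ with $|f(x)-f(y)|\leq L_k|x-y|$ for $|x|,|y|\leq k$; each component $g_{i,j}$ is differentiable and there is $\gamma\in(p-1,1]$ such that for every $k\in\mathbb{N}$ there is $C_{k,\gamma}>0$ with $|\nabla g_{i,j}(x)-\nabla g_{i,j}(y)|\leq C_{k,\gamma}|x-y|^\gamma$ for $|x|,|y|\leq k$, $i,j=1,\dots,d$. Let $a\in D(\mathbb{R}^+,\mathbb{R})$, $z,l\in D(\mathbb{R}^+,\mathbb{R}^d)$ with $V_1(a)_T<\infty$, $V_p(z)_T<\infty$ for all $T$, and $x_0\in\mathbb{R}^d$ with $x_0\geq l_0$. Then there exists a unique solution $(x,k)$ of \[ x_t=x_0+\int_0^tf(x_{s-})\,da_s+\int_0^tg(x_{s-})\,dz_s+k_t,\quad t\in\mathbb{R}^+. \]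
   Context: $\mathbb{R}^+=[0,\infty)$; $\mathbb{M}^d$ = real $d\times d$ matrices with operator norm. $D(\mathbb{R}^+,\mathbb{R}^m)$ is the space of càdlàg functions. For càdlàg $x$, $v_p(x)_{[a,b]}=\sup\sum_i|x_{t_i}-x_{t_{i-1}}|^p$ over subdivisions of $[a,b]$, $V_p=v_p^{1/p}$, subscript $T$ meaning $[0,T]$. Integrals are Riemann–Stieltjes. Inequalities between vectors are componentwise. Skorokhod problem: for $y,l\in D(\mathbb{R}^+,\mathbb{R}^d)$ with $l_0\leq y_0$, $(x,k)=SP_l(y)$ means (i) $x_t=y_t+k_t\geq l_t$ for all $t$; (ii) $k_0=0$, each $k^i$ nondecreasing with $\int_0^t(x^i_s-l^i_s)dk^i_s=0$ for all $t,i$. A solution of the equation is a pair $(x,k)\in D(\mathbb{R}^+,\mathbb{R}^d)^2$ with $V_p(x)_T<\infty$ for all $T$ and $(x,k)=SP_l(y)$, $y_t=x_0+\int_0^tf(x_{s-})da_s+\int_0^tg(x_{s-})dz_s$. *)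

(* Defs.v *)
From HB Require Import structures.
From mathcomp Require Import all_boot all_order all_algebra.
From mathcomp Require Import all_classical all_reals all_analysis.
Set Implicit Arguments. Unset Strict Implicit. Unset Printing Implicit Defensive.
Import Order.TTheory GRing.Theory Num.Theory.
Import numFieldNormedType.Exports.
Local Open Scope classical_set_scope.
Local Open Scope ring_scope.

Section Defs.
Variable R : realType.

Definition enorm (d : nat) (v : 'cV[R]_d) : R :=
  Num.sqrt (\sum_(i < d) (v i 0) ^+ 2).

Definition opnorm (d : nat) (A : 'M[R]_d) : R :=
  sup [set enorm (A *m v) | v in [set v : 'cV[R]_d | enorm v <= 1]].

Definition grad (d : nat) (h : 'cV[R]_d -> R) (x : 'cV[R]_d) : 'cV[R]_d :=
  \col_(k < d) ('d h x (delta_mx k 0 : 'cV[R]_d)).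

(* x : R -> V is cadlag on R^+ = [0, oo). Values at negative times are
   irrelevant. *)
Definition cadlag (V : normedModType R) (x : R -> V) : Prop :=
  (forall t, 0 <= t -> x @ t^'+ --> x t) /\
  (forall t, 0 < t -> exists lv : V, x @ t^'- --> lv).

Definition lleft (V : normedModType R) (x : R -> V) (t : R) : V :=
  if t <= 0 then x 0 else lim (x @ t^'-).

Definition pvar_fin (V : zmodType) (N : V -> R) (p : R) (x : R -> V) (T : R)
  : Prop :=
  exists M : R, forall (n : nat) (t : nat -> R),
    t 0%N = 0 -> t n = T -> (forall i, (i < n)%N -> t i <= t i.+1) ->
    \sum_(i < n) (N (x (t i.+1) - x (t i))) `^ p <= M.

Definition is_RS (U : Type) (W : zmodType) (V : normedModType R)
  (tag : R -> R -> R) (m : U -> W -> V) (h : R -> U) (y : R -> W)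
  (T : R) (I : V) : Prop :=
  forall e : R, 0 < e -> exists2 del : R, 0 < del &
    forall (n : nat) (t : nat -> R),
      t 0%N = 0 -> t n = T ->
      (forall i, (i < n)%N -> t i <= t i.+1 /\ t i.+1 - t i < del) ->
      `| \sum_(i < n) m (h (tag (t i) (t i.+1))) (y (t i.+1) - y (t i)) - I |
        < e.

Definition left_tag (u v : R) : R := u.
Definition right_tag (u v : R) : R := v.

(* Skorokhod problem (x,k) = SP_l(y), on t in R^+.  The integral
   \int_0^t (x^i_s - l^i_s) dk^i_s (k^i nondecreasing, integrand cadlag) is
   the Riemann-Stieltjes integral with right-endpoint tags, i.e. the
   Lebesgue-Stieltjes integral over (0,t]. *)
Definition SP (d : nat) (l y x k : R -> 'cV[R]_d) : Prop :=
  (forall t, 0 <= t -> x t = y t + k t /\ forall i, l t i 0 <= x t i 0) /\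
  k 0 = 0 /\
  (forall i s t, 0 <= s -> s <= t -> k s i 0 <= k t i 0) /\
  (forall i t, 0 <= t ->
     is_RS right_tag (fun u v : R => u * v)
       (fun s => x s i 0 - l s i 0) (fun s => k s i 0) t 0).

Definition solution (d : nat) (p : R) (f : 'cV[R]_d -> 'cV[R]_d)
  (g : 'cV[R]_d -> 'M[R]_d) (a : R -> R) (z l : R -> 'cV[R]_d)
  (x0 : 'cV[R]_d) (x k : R -> 'cV[R]_d) : Prop :=
  cadlag x /\ cadlag k /\
  (forall T, 0 <= T -> pvar_fin (@enorm d) p x T) /\
  exists y : R -> 'cV[R]_d,
    cadlag y /\
    (forall t, 0 <= t -> exists I1 I2 : 'cV[R]_d,
       is_RS left_tag (fun (u : 'cV[R]_d) (r : R) => r *: u)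
         (fun s => f (lleft x s)) a t I1 /\
       is_RS left_tag (fun (A : 'M[R]_d) (v : 'cV[R]_d) => A *m v)
         (fun s => g (lleft x s)) z t I2 /\
       y t = x0 + I1 + I2) /\
    SP l y x k.

End Defs.

(* Main.v *)
Require Import Defs.
From HB Require Import structures.
From mathcomp Require Import all_boot all_order all_algebra.
From mathcomp Require Import all_classical all_reals all_analysis.
From mathcomp Require Import ring lra.
Import Order.TTheory GRing.Theory Num.Theory.
Import numFieldNormedType.Exports.
Local Open Scope classical_set_scope.
Local Open Scope ring_scope.

(** The Young integral of a left-continuous integrand against a càdlàg integrator
    exists as a limit of left-point sums along the mesh: the discrete Young
    inequality controls the sums on any interval whose interior carries little
    p-variation, and one-sided continuity takes care of the two endpoints. The
    reflection term is the running maximum [sup_{s <= t} (l_s - y_s)^+], and the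
    running maximum is 1-Lipschitz for the p-variation, since the difference of
    two running maxima can only move, alternately up and down, where the
    difference of the functions moves at least as far. Hence the equation is a
    fixed point problem whose right-hand side is, in p-variation, a contraction
    on short time intervals: this gives uniqueness and local existence. By (H1)
    the p-variation of a solution cannot blow up at a finite time, so that the
    solution is global. *)

(* The obstacle is the jumps. A control given by p-variation is superadditive but not continuous: it
   is small on short intervals just after s, by right continuity, and on short intervals that stop
   before t, but not on intervals that reach a jump at t. So the local arguments treat the two sides
   of a point separately. A jump at t does no harm in the equation, because the integrands are left
   limits with left tags: the right-hand side at t depends on x before t only, hence determines x at
   t.

   Variation is kept as a sum of p-th powers without the root, which makes it a control; the
   triangle inequality then carries a factor 2^p, and the Picard iterates are made to contract by
   1/(2 2^p) so that the series still converges. The contraction concerns increments of g(x) -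
   g(x'), which a Lipschitz bound on g does not control: the Hölder gradient in (H2) gives a
   four-point estimate, and gamma > p - 1 is exactly the Young condition gamma/p + 1/p > 1. *)
Tactic Notation "lraof" ne_hyp_list(hs) := (clear -hs; lra).

(** * Inequalities for real powers *)

Section Powers.
Context {R : realType}.
Implicit Types a b p q x : R.

Lemma powR_le p a b : 0 <= p -> 0 <= a -> a <= b -> a `^ p <= b `^ p.
Proof.
by move=> p0 a0 ab; apply: ge0_ler_powR => //; rewrite nnegrE // (le_trans a0).
Qed.

(** The sum is at most twice the larger term; this crude argument needs no convexity and covers
    every p >= 0. *)
Lemma powR_sum_le p a b : 0 <= p -> 0 <= a -> 0 <= b ->
  (a + b) `^ p <= 2 `^ p * (a `^ p + b `^ p).
Proof.
move=> p0 a0 b0.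
have H c d : 0 <= c -> c <= d -> (c + d) `^ p <= 2 `^ p * (c `^ p + d `^ p).
  move=> c0 cd; have d0 := le_trans c0 cd.
  apply: (@le_trans _ _ ((2 * d) `^ p)); first by apply: powR_le => //; lra.
  rewrite powRM //; apply: ler_wpM2l; first exact: powR_ge0.
  by have := powR_ge0 c p; lra.
have [ab|/ltW ba] := leP a b; first exact: H.
by rewrite addrC [X in _ * X]addrC; exact: H.
Qed.

(** Write c^p as c times c^(p-1): since p >= 1, the second factor only grows when c is replaced by a
    + b. *)
Lemma powR_superadd p a b : 1 <= p -> 0 <= a -> 0 <= b ->
  a `^ p + b `^ p <= (a + b) `^ p.
Proof.
move=> p1 a0 b0.
have p0 : 0 < p by lra.
have H c : 0 <= c -> c `^ p = c * c `^ (p - 1) by move=> c0; rewrite mulr_powRB1.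
rewrite !H ?addr_ge0 // mulrDl.
by apply: lerD; apply: ler_wpM2l => //; apply: powR_le; lra.
Qed.

Lemma powRK p a : 0 < p -> 0 <= a -> (a `^ p^-1) `^ p = a.
Proof. by move=> p0 a0; rewrite -powRrM mulVf ?gt_eqF // powRr1. Qed.

Lemma powRKV p a : 0 < p -> 0 <= a -> (a `^ p) `^ p^-1 = a.
Proof. by move=> p0 a0; rewrite -powRrM mulfV ?gt_eqF // powRr1. Qed.

Lemma powR_inv_le p a b : 0 < p -> 0 <= a -> 0 <= b ->
  (a <= b `^ p^-1) = (a `^ p <= b).
Proof.
move=> p0 a0 b0; apply/idP/idP => H.
  by rewrite -(powRK _ _ p0 b0); apply: powR_le => //; exact: ltW.
by rewrite -(powRKV _ _ p0 a0); apply: powR_le; rewrite ?powR_ge0 // invr_ge0 ltW.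
Qed.

Lemma powR_le1D a b : 0 <= a -> 0 <= b -> b <= 1 -> a `^ b <= 1 + a.
Proof.
move=> a0 b0 b1; have [a1|/ltW a1] := leP a 1.
  apply: (@le_trans _ _ (1 `^ b)); first exact: powR_le.
  by rewrite powR1; lra.
apply: (@le_trans _ _ (a `^ 1)); first by rewrite ler_powR.
by rewrite powRr1 //; lra.
Qed.

Lemma powR_small p e : 0 < p -> 0 < e ->
  exists2 d, 0 < d & forall x, 0 <= x -> x < d -> x `^ p < e.
Proof.
move=> p0 e0; exists (e `^ p^-1); first exact: powR_gt0.
move=> x x0 xd; rewrite -[ltRHS](powRK p) // ?ltW //.
by apply: gt0_ltr_powR => //; rewrite nnegrE ?powR_ge0.
Qed.

End Powers.

Lemma lt_add_min {R : realType} (s u d e : R) : u < s + Num.min d e ->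
  u < s + d /\ u < s + e.
Proof. by rewrite -!ltrBlDl lt_min => /andP[]. Qed.

(** * The discrete Young inequality *)

Section DiscreteYoung.
Context {R : realType}.

(** The solution C of C = C 2^(1-th) + 2, the balance of the recursion in [discrete_young]: two
    halves together cost C 2^(1-th), two cross terms cost 1 each. *)
Definition young_const (th : R) : R := 2 / (1 - 2 `^ (1 - th)).

Lemma young_const_gt0 th : 1 < th -> 0 < young_const th.
Proof.
move=> th1; apply: divr_gt0 => //; rewrite subr_gt0.
by rewrite -[ltRHS](powRr0 2) -subr_lt0 /powR pnatr_eq0 /= subr_lt0 ltr_expR;
  rewrite ltr_pM2r ?ln_gt0 ?ltr1n //; lra.
Qed.

Lemma young_constE th : 1 < th ->
  young_const th * 2 `^ (1 - th) + 2 = young_const th.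
Proof.
move=> th1; have := young_const_gt0 _ th1; rewrite /young_const => /gt_eqF.
set d := 1 - _; have -> : 2 `^ (1 - th) = 1 - d by rewrite /d; ring.
by have [->|d0 _] := eqVneq d 0; [rewrite invr0 mulr0 eqxx|field].
Qed.

Definition dcontrol (w : nat -> nat -> R) (N : nat) :=
  (forall i j, (i <= j <= N)%N -> 0 <= w i j) /\
  (forall i j k, (i <= j)%N -> (j <= k <= N)%N -> w i j + w j k <= w i k).

(** Take the last i whose left part carries at most half of the mass. The next index fails, so
    superadditivity leaves at most half to its right. The single step from i to i+1 may carry almost
    everything, a jump, and belongs to neither half. *)
Lemma dcontrol_half (w : nat -> nat -> R) N m n : dcontrol w N ->
  (m < n)%N -> (n <= N)%N ->
  exists i, [/\ (m <= i)%N, (i < n)%N, w m i <= w m n / 2 & w i.+1 n <= w m n / 2].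
Proof.
move=> [w0 wD] mn nN.
have wii i : (i <= N)%N -> w i i = 0.
  move=> iN; apply/eqP; rewrite eq_le w0 ?leqnn // andbT.
  by have := wD i i i (leqnn i); rewrite leqnn iN => /(_ isT); lra.
pose P i := [&& (m <= i)%N, (i < n)%N & w m i <= w m n / 2].
have wmn0 : 0 <= w m n by apply: w0; rewrite (ltnW mn).
have exP : exists i, P i.
  exists m; rewrite /P leqnn mn /= wii ?divr_ge0 //.
  by rewrite (leq_trans _ nN) // ltnW.
have ubP i : P i -> (i <= n)%N by case/and3P => _ /ltnW.
case: (ex_maxnP exP ubP) => i /and3P[mi i_n wi] imax.
exists i; split => //.
have [in1|in1] := leqP n i.+1.
  have -> : i.+1 = n by apply/eqP; rewrite eqn_leq i_n in1.
  by rewrite wii // divr_ge0.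
have : ~~ P i.+1 by apply/negP => /imax; rewrite ltnn.
rewrite /P (leq_trans mi) //= in1 /= -ltNge => H.
have := wD m i.+1 n; rewrite (leq_trans mi) // (ltnW in1) nN => /(_ isT isT).
lra.
Qed.

(** Strong induction on the length: split around the step given by [dcontrol_half]. Since b1 + b2 >
    1, halving the mass gains the factor 2^(1-th) < 1, which pays for the cross terms. *)
Lemma discrete_young (w : nat -> nat -> R) N (h y : nat -> R) (A B b1 b2 : R) :
  dcontrol w N -> 0 <= A -> 0 <= B -> 0 <= b1 -> 0 <= b2 -> 1 < b1 + b2 ->
  (forall i j, (i <= j <= N)%N -> `|h j - h i| <= A * w i j `^ b1) ->
  (forall i j, (i <= j <= N)%N -> `|y j - y i| <= B * w i j `^ b2) ->
  forall m n, (m <= n <= N)%N ->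
  `|\sum_(m <= i < n) h i * (y i.+1 - y i) - h m * (y n - y m)| <=
    young_const (b1 + b2) * A * B * w m n `^ (b1 + b2).
Proof.
move=> cw A0 B0 b10 b20 b12 hw yw m n mnN.
have [k] := ubnP (n - m); elim: k m n mnN => // k IH m n mnN; rewrite ltnS => nmk.
set th := b1 + b2; set C := young_const th.
have C0 : 0 < C by exact: young_const_gt0.
have CAB0 : 0 <= C * A * B by apply: mulr_ge0 => //; apply: mulr_ge0 => //; exact: ltW.
have /andP[mn nN] := mnN.
have [mn'|nm] := ltnP m n; last first.
  have -> : m = n by apply/eqP; rewrite eqn_leq mn nm.
  rewrite big_geq // subrr mulr0 subr0 normr0.
  by apply: mulr_ge0; [exact: CAB0|exact: powR_ge0].
have [i [mi i_n w1 w2]] := dcontrol_half w N m n cw mn' nN.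
have iN : (i <= N)%N by rewrite (leq_trans _ nN) // ltnW.
have [w0 wD] := cw.
have W0 := w0 m n mnN.
rewrite (big_cat_nat mi (ltnW i_n)) /= (big_ltn i_n) /=.
have E1 : `|\sum_(m <= i0 < i) h i0 * (y i0.+1 - y i0) - h m * (y i - y m)| <=
   C * A * B * (w m n / 2) `^ th.
  apply: (le_trans (IH m i _ _)).
  - by rewrite mi iN.
  - by apply: leq_trans nmk; rewrite ltn_sub2r.
  apply: ler_wpM2l; first exact: CAB0.
  by apply: powR_le => //; [rewrite /th; lra|apply: w0; rewrite mi].
have E2 : `|\sum_(i.+1 <= i0 < n) h i0 * (y i0.+1 - y i0)
              - h i.+1 * (y n - y i.+1)| <= C * A * B * (w m n / 2) `^ th.
  apply: (le_trans (IH i.+1 n _ _)).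
  - by rewrite i_n nN.
  - by apply: leq_trans nmk; rewrite ltn_sub2l // ltnS.
  apply: ler_wpM2l; first exact: CAB0.
  by apply: powR_le => //; [rewrite /th; lra|apply: w0; rewrite i_n].
have mono a b c d : (a <= b)%N -> (b <= c)%N -> (c <= d)%N -> (d <= N)%N -> w b c <= w a d.
  move=> ab bc cd dN.
  have := wD a b d ab; rewrite (leq_trans bc cd) dN => /(_ isT).
  have := wD b c d bc; rewrite cd dN => /(_ isT).
  have := w0 a b; rewrite ab (leq_trans bc (leq_trans cd dN)) => /(_ isT).
  by have := w0 c d; rewrite cd dN => /(_ isT); lra.
have cross a b c d : (m <= a)%N -> (a <= b)%N -> (b <= n)%N ->
   (m <= c)%N -> (c <= d)%N -> (d <= n)%N ->
   `|(h b - h a) * (y d - y c)| <= A * B * w m n `^ th.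
  move=> ma ab bn mc cd dn; rewrite normrM.
  have -> : A * B * w m n `^ th = (A * w m n `^ b1) * (B * w m n `^ b2).
    rewrite /th powRD; first by ring.
    by rewrite (gt_eqF (_ : 0 < b1 + b2)) //; lra.
  apply: ler_pM => //.
    apply: (le_trans (hw a b _)); first by rewrite ab (leq_trans bn nN).
    apply: ler_wpM2l => //; apply: powR_le => //.
      by apply: w0; rewrite ab (leq_trans bn nN).
    exact: mono.
  apply: (le_trans (yw c d _)); first by rewrite cd (leq_trans dn nN).
  apply: ler_wpM2l => //; apply: powR_le => //.
    by apply: w0; rewrite cd (leq_trans dn nN).
  exact: mono.
have E3 := cross m i i i.+1 (leqnn m) mi (ltnW i_n) mi (leqnSn i) i_n.
have E4 := cross m i.+1 i.+1 n (leqnn m) (leqW mi) i_n (leqW mi) i_n (leqnn n).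
move: E1 E2.
have -> : (w m n / 2) `^ th = 2 `^ (1 - th) * w m n `^ th / 2.
  have e2 : (2^-1 : R) `^ th = 2 `^ (1 - th) / 2.
    rewrite -[X in X `^ _]powR_inv1 // -powRrM mulN1r.
    by rewrite [in RHS]powRD ?pnatr_eq0 ?implybT // powRr1 // mulrAC mulfV ?mul1r ?pnatr_eq0.
  by rewrite powRM ?invr_ge0 // e2 mulrA [_ * 2 `^ _]mulrC.
move=> E1 E2.
set S1 := \sum_(m <= _ < i) _ in E1 *; set S2 := \sum_(i.+1 <= _ < n) _ in E2 *.
(* The defect is additive over the two halves up to two products of increments, one for the isolated
   step and one for the right half. *)
have -> : S1 + (h i * (y i.+1 - y i) + S2) - h m * (y n - y m) =
   (S1 - h m * (y i - y m)) + (S2 - h i.+1 * (y n - y i.+1)) +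
   ((h i - h m) * (y i.+1 - y i) + (h i.+1 - h m) * (y n - y i.+1)) by ring.
apply: (le_trans (ler_normD _ _)).
apply: (le_trans (lerD (ler_normD _ _) (ler_normD _ _))).
apply: (le_trans (lerD (lerD E1 E2) (lerD E3 E4))).
rewrite le_eqVlt; apply/orP; left; apply/eqP.
have Ce : C * 2 `^ (1 - th) + 2 = C := young_constE _ b12.
by rewrite -[in RHS]Ce; field.
Qed.

End DiscreteYoung.

(** * Superadditive controls and induction along an interval *)

Section Controls.
Context {R : realType}.
Implicit Types w : R -> R -> R.

Definition control w :=
  (forall s t, 0 <= s -> s <= t -> 0 <= w s t) /\
  (forall r s t, 0 <= r -> r <= s -> s <= t -> w r s + w s t <= w r t).

Lemma control_mono w r s t u : control w -> 0 <= r -> r <= s -> s <= t ->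
  t <= u -> w s t <= w r u.
Proof.
move=> [w0 wD] r0 rs st tu.
have := wD r s u r0 rs (le_trans st tu).
have := wD s t u (le_trans r0 rs) st tu.
have := w0 r s r0 rs; have := w0 t u (le_trans r0 (le_trans rs st)) tu.
lra.
Qed.

Lemma control_diag w s : control w -> 0 <= s -> w s s = 0.
Proof.
move=> [w0 wD] s0; have := w0 s s s0 (lexx _).
by have := wD s s s s0 (lexx _) (lexx _); lra.
Qed.

Lemma controlD w1 w2 : control w1 -> control w2 ->
  control (fun s t => w1 s t + w2 s t).
Proof.
move=> [p1 D1] [p2 D2]; split=> [s t s0 st|r s t r0 rs st].
  by rewrite addr_ge0 ?p1 ?p2.
by have := D1 r s t r0 rs st; have := D2 r s t r0 rs st; lra.
Qed.

Lemma controlZ c w : 0 <= c -> control w -> control (fun s t => c * w s t).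
Proof.
move=> c0 [p1 D1]; split=> [s t s0 st|r s t r0 rs st].
  by rewrite mulr_ge0 ?p1.
by rewrite -mulrDr ler_wpM2l // D1.
Qed.

Lemma control_powR p w : 1 <= p -> control w -> control (fun s t => w s t `^ p).
Proof.
move=> p1 [w0 D]; split=> [s t s0 st|r s t r0 rs st]; first exact: powR_ge0.
have wrs := w0 r s r0 rs; have wst := w0 s t (le_trans r0 rs) st.
apply: (le_trans (powR_superadd _ _ _ p1 wrs wst)).
by apply: powR_le; rewrite ?addr_ge0 // ?D //; lra.
Qed.

Lemma control_sum (I : finType) (w : I -> R -> R -> R) :
  (forall i, control (w i)) -> control (fun s t => \sum_i w i s t).
Proof.
move=> cw; split=> [s t s0 st|r s t r0 rs st].
  by apply: sumr_ge0 => i _; apply: (cw i).1.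
by rewrite -big_split /=; apply: ler_sum => i _; apply: (cw i).2.
Qed.

(* Superadditivity alone makes a control small on intervals next to, but not
   touching, a given point. *)
Lemma control_right_small w s e : control w -> 0 <= s -> 0 < e ->
  exists2 d, 0 < d & forall u v, s < u -> u <= v -> v < s + d -> w u v < e.
Proof.
move=> cw s0 e0; pose T := s + 1.
pose A := [set w u T | u in [set u | s < u <= T]].
have ubA : ubound A (w s T).
  move=> _ [u /andP[su uT] <-].
  exact: (control_mono w s u T T cw s0 (ltW su) uT (lexx _)).
have hA : has_sup A.
  split; first by exists (w T T), T => //=; rewrite lexx andbT /T; lra.
  by exists (w s T).
(* [w u T] grows as u decreases to s. Once [w u0 T] is within e of the supremum, superadditivity
   leaves less than e for any interval between s and u0. *)
have [_ [u0 /andP[su0 u0T] <-] Hu0] := sup_adherent e0 hA.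
exists (u0 - s) => [|u v su uv vd]; first by lra.
have uT : u <= T by lra.
have := cw.2 u v T; move/(_ ltac:(lra) uv ltac:(lra)).
have := control_mono w v u0 T T cw ltac:(lra) ltac:(lra) u0T (lexx _).
have : w u T <= sup A by apply: sup_upper_bound => //; exists u => //=; rewrite su uT.
by lra.
Qed.

Lemma control_left_small w t e : control w -> 0 < t -> 0 < e ->
  exists2 d, 0 < d & forall u v, 0 <= u -> t - d < u -> u <= v -> v < t -> w u v < e.
Proof.
move=> cw t0 e0.
pose A := [set w 0 u | u in [set u | 0 <= u < t]].
have ubA : ubound A (w 0 t).
  move=> _ [u /andP[u0 ut] <-].
  exact: (control_mono w 0 0 u t cw (lexx _) (lexx _) u0 (ltW ut)).
have hA : has_sup A.
  by split; [exists (w 0 0), 0 => //=; rewrite lexx t0|exists (w 0 t)].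
have [_ [u0 /andP[u00 u0t] <-] Hu0] := sup_adherent e0 hA.
exists (t - u0) => [|u v u_0 tu uv vt]; first by lra.
have := cw.2 0 u v (lexx _) u_0 uv.
have := control_mono w 0 0 u0 u cw (lexx _) (lexx _) u00 ltac:(lra).
have : w 0 v <= sup A.
  by apply: sup_upper_bound => //; exists v => //=; rewrite vt andbT; lra.
by lra.
Qed.

(** The supremum of the points reached from 0 is itself reached by the left-hand hypothesis, and
    would be passed by the right-hand one if it were below T. Intervals on the two sides of a point
    are only ever concatenated, so a jump at that point is never crossed. *)
Lemma interval_induction (P : R -> R -> Prop) :
  (forall r s t, 0 <= r -> r < s -> s < t -> P r s -> P s t -> P r t) ->
  (forall s, 0 <= s -> exists2 d, 0 < d & forall t, s < t -> t < s + d -> P s t) ->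
  (forall t, 0 < t -> exists2 d, 0 < d &
     forall s, 0 <= s -> t - d < s -> s < t -> P s t) ->
  forall T, 0 < T -> P 0 T.
Proof.
move=> Pcat Pr Pl T T0.
pose E := [set t | 0 < t <= T /\ P 0 t].
have [d0 d00 Hd0] := Pr 0 (lexx _).
have [t1 [t10 t1T Pt1]] : exists t1, [/\ 0 < t1, t1 <= T & P 0 t1].
  exists (Num.min T (d0 / 2)); split.
  - by rewrite lt_min T0 divr_gt0.
  - by rewrite ge_min lexx.
  - apply: Hd0; first by rewrite lt_min T0 divr_gt0.
    by rewrite gt_min; apply/orP; right; lra.
have hE : has_sup E.
  split; first by exists t1; split => //; rewrite t10.
  by exists T => t [/andP[]].
pose tau := sup E.
have tau1 : t1 <= tau by apply: sup_upper_bound => //; split => //; rewrite t10.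
have tauT : tau <= T by apply: ge_sup => [|t [/andP[]]//]; exact: hE.1.
have tau0 : 0 < tau by lra.
have Ptau : P 0 tau.
  have [d d_0 Hd] := Pl tau tau0.
  have [s [/andP[s0 sT] Ps] Hs] := sup_adherent d_0 hE.
  have sle : s <= tau by apply: sup_upper_bound => //; split => //; rewrite s0.
  have [<- //|ne] := eqVneq s tau.
  have st : s < tau by rewrite lt_neqAle ne.
  by apply: (Pcat 0 s tau) => //; apply: Hd => //; exact: ltW.
have [<- //|ne] := eqVneq tau T.
have tT : tau < T by rewrite lt_neqAle ne.
have [d d_0 Hd] := Pr tau (ltW tau0).
pose t := Num.min T (tau + d / 2).
have t_tau : tau < t by rewrite /t lt_min tT; lra.
have : E t.
  split; first by rewrite (lt_trans tau0 t_tau) /t ge_min lexx.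
  apply: (Pcat 0 tau t) => //; apply: Hd => //.
  by rewrite /t gt_min; apply/orP; right; lra.
by move=> /(sup_upper_bound hE); rewrite -/tau; lra.
Qed.

End Controls.

(** * Hölder functions relative to a control *)

Section ControlledFunctions.
Context {R : realType} {V : normedModType R}.
Implicit Types (h : R -> V) (w : R -> R -> R).

(** Hölder continuity of exponent b with w in place of length; with b = 1/p this is the form taken
    by finite p-variation. *)
Definition controlled h (A : R) w (b T : R) :=
  forall s t, 0 <= s -> s <= t -> t <= T -> `|h t - h s| <= A * w s t `^ b.

Lemma controlled_small {h A w b T e} : control w -> 0 <= A -> 0 < b ->
  controlled h A w b T -> 0 < e ->
  exists2 d, 0 < d & forall u v, 0 <= u -> u <= v -> v <= T -> w u v < d ->
    `|h v - h u| < e.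
Proof.
move=> cw A0 b0 hw e0.
have A1 : 0 < A + 1 by lra.
have [d d0 Hd] := powR_small b (e / (A + 1)) b0 (divr_gt0 e0 A1).
exists d => // u v u0 uv vT wd.
apply: (le_lt_trans (hw u v u0 uv vT)).
have := Hd _ (cw.1 u v u0 uv) wd; rewrite ltr_pdivlMr //.
have := powR_ge0 (w u v) b; nra.
Qed.

(** The Cauchy criterion for the limit from the right: both points lie strictly beyond s, so a jump
    at s does not interfere. *)
Lemma controlled_right {h A w b T s e} : control w -> 0 <= A -> 0 < b ->
  controlled h A w b T -> 0 <= s -> s < T -> 0 < e ->
  exists2 d, 0 < d & forall u v, s < u -> u < s + d -> s < v -> v < s + d ->
    `|h v - h u| < e.
Proof.
move=> cw A0 b0 hw s0 sT e0.
have [d1 d10 H1] := controlled_small cw A0 b0 hw e0.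
have [d2 d20 H2] := control_right_small w s d1 cw s0 d10.
exists (Num.min d2 (T - s)) => [|u v su ud sv vd]; first by rewrite lt_min d20; lra.
have [ud2 uT] := lt_add_min _ _ _ _ ud; have [vd2 vT] := lt_add_min _ _ _ _ vd.
have [uv|/ltW vu] := leP u v; [|rewrite distrC]; apply: H1; try lra;
  by apply: H2; lra.
Qed.

Lemma controlled_left {h A w b T t e} : control w -> 0 <= A -> 0 < b ->
  controlled h A w b T -> 0 < t -> t <= T -> 0 < e ->
  exists2 d, 0 < d & forall u v, 0 <= u -> t - d < u -> u < t ->
    0 <= v -> t - d < v -> v < t -> `|h v - h u| < e.
Proof.
move=> cw A0 b0 hw t0 tT e0.
have [d1 d10 H1] := controlled_small cw A0 b0 hw e0.
have [d2 d20 H2] := control_left_small w t d1 cw t0 d10.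
exists d2 => // u v u0 du ut v0 dv vt.
have [uv|/ltW vu] := leP u v; [|rewrite distrC]; apply: H1; try lra;
  by apply: H2; lra.
Qed.

Lemma controlled_bound {h A w b T} : control w -> 0 <= A -> 0 <= b ->
  controlled h A w b T ->
  exists2 M, 0 < M & forall t, 0 <= t -> t <= T -> `|h t| <= M.
Proof.
move=> cw A0 b0 hw; exists (`|h 0| + A * w 0 T `^ b + 1).
  have := normr_ge0 (h 0); have := mulr_ge0 A0 (powR_ge0 (w 0 T) b); lra.
move=> t t0 tT.
have -> : h t = h 0 + (h t - h 0) by rewrite addrC subrK.
apply: (le_trans (ler_normD _ _)).
have := hw 0 t (lexx _) t0 tT.
have : A * w 0 t `^ b <= A * w 0 T `^ b.
  apply: ler_wpM2l => //; apply: powR_le => //; first exact: cw.1.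
  exact: (control_mono w 0 0 t T).
lra.
Qed.

End ControlledFunctions.

(** * Left-point sums along chains *)

Section Chains.
Context {R : realType}.

(** Chains are infinite nondecreasing sequences of which a window of indices is summed, so that
    monotonicity carries no side condition on indices. *)
Definition nd (u : nat -> R) := forall i j, (i <= j)%N -> u i <= u j.

Lemma ndS u : (forall i, u i <= u i.+1) -> nd u.
Proof.
move=> uS i j; apply: (@homo_leq _ u (fun a b => a <= b)) => //.
by move=> y x z; exact: le_trans.
Qed.

Definition rsum (h y : R -> R) (u : nat -> R) m n :=
  \sum_(m <= i < n) h (u i) * (y (u i.+1) - y (u i)).

Lemma first_index (P : nat -> bool) m n : (m <= n)%N -> P n ->
  exists j, [/\ (m <= j)%N, (j <= n)%N, P j & forall i, (m <= i)%N -> (i < j)%N -> ~~ P i].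
Proof.
move=> mn Pn.
have ex : exists j, (m <= j)%N && P j by exists n; rewrite mn.
case: (ex_minnP ex) => j /andP[mj Pj] jmin; exists j; split => //.
  by apply: jmin; rewrite mn.
move=> i mi ij; apply/negP => Pi.
by have := jmin i; rewrite mi Pi => /(_ isT); rewrite leqNgt ij.
Qed.

Lemma rsum_cat h y u m k n : (m <= k)%N -> (k <= n)%N ->
  rsum h y u m n = rsum h y u m k + rsum h y u k n.
Proof. by move=> mk kn; rewrite /rsum (big_cat_nat mk kn). Qed.

Lemma telescope_diff (y : R -> R) (u : nat -> R) m n : (m <= n)%N ->
  \sum_(m <= i < n) (y (u i.+1) - y (u i)) = y (u n) - y (u m).
Proof. by move=> mn; rewrite (telescope_sumr (fun i => y (u i))). Qed.

Lemma rsum_const h y u m n c : (m <= n)%N ->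
  (forall i, (m <= i)%N -> (i < n)%N -> h (u i) = c) ->
  rsum h y u m n = c * (y (u n) - y (u m)).
Proof.
move=> mn H; rewrite -(telescope_diff y u m n mn) big_distrr /=.
by apply: eq_big_nat => i /andP[mi i_n]; rewrite H.
Qed.

Lemma chain_young w (h y : R -> R) T A B b1 b2 u m n :
  control w -> 0 <= A -> 0 <= B -> 0 <= b1 -> 0 <= b2 -> 1 < b1 + b2 ->
  controlled h A w b1 T -> controlled y B w b2 T ->
  nd u -> 0 <= u m -> u n <= T -> (m <= n)%N ->
  `|rsum h y u m n - h (u m) * (y (u n) - y (u m))| <=
    young_const (b1 + b2) * A * B * w (u m) (u n) `^ (b1 + b2).
Proof.
move=> cw A0 B0 b10 b20 b12 hw yw ndu um unT mn.
(* Freezing the chain before index m makes all its nodes nonnegative, as the discrete statement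
   starts from index 0. *)
pose u' i := u (maxn m i).
have u'0 i : 0 <= u' i by rewrite /u' (le_trans um) // ndu // leq_maxl.
have u'm i j : (i <= j)%N -> u' i <= u' j.
  by move=> ij; apply: ndu; rewrite geq_max leq_maxl leq_max ij orbT.
have u'T i : (i <= n)%N -> u' i <= T.
  by move=> i_n; apply: le_trans unT; apply: ndu; rewrite geq_max mn.
have um' i : (m <= i)%N -> u i = u' i by move=> mi; rewrite /u' (maxn_idPr mi).
have -> : rsum h y u m n = \sum_(m <= i < n) h (u' i) * (y (u' i.+1) - y (u' i)).
  by apply: eq_big_nat => i /andP[mi _]; rewrite !um' // leqW.
rewrite !um' //.
apply: (discrete_young (fun i j => w (u' i) (u' j)) n (h \o u') (y \o u')) => //;
  last by rewrite mn leqnn.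
- split=> [i j /andP[ij jn]|i j k ij /andP[jk kn]]; first by apply: cw.1; [exact: u'0|exact: u'm].
  by apply: cw.2; [exact: u'0|exact: u'm|exact: u'm].
- by move=> i j /andP[ij jn]; apply: hw; [exact: u'0|exact: u'm|exact: u'T].
- by move=> i j /andP[ij jn]; apply: yw; [exact: u'0|exact: u'm|exact: u'T].
Qed.

(* Normalizing both controls to total mass 1 makes the estimate homogeneous in
   each of them. *)
Lemma chain_young2 w1 w2 (h y : R -> R) A b1 b2 u m n :
  control w1 -> control w2 -> 0 <= A -> 0 < b1 -> 0 < b2 -> 1 < b1 + b2 ->
  controlled h A w1 b1 (u n) -> controlled y 1 w2 b2 (u n) ->
  nd u -> 0 <= u m -> (m <= n)%N ->
  `|rsum h y u m n - h (u m) * (y (u n) - y (u m))| <=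
    young_const (b1 + b2) * 2 `^ (b1 + b2) * A *
      w1 (u m) (u n) `^ b1 * w2 (u m) (u n) `^ b2.
Proof.
move=> cw1 cw2 A0 b10 b20 b12 hw yw ndu um mn.
have smn := ndu _ _ mn.
set s := u m; set t := u n.
have C0 := young_const_gt0 _ b12.
set RHS := (X in _ <= X).
have RHS0 : 0 <= RHS.
  rewrite /RHS; apply: mulr_ge0; last exact: powR_ge0.
  apply: mulr_ge0; last exact: powR_ge0.
  apply: mulr_ge0 => //; apply: mulr_ge0; last exact: powR_ge0.
  exact: ltW.
have uin i : (m <= i <= n)%N -> s <= u i <= t.
  by move=> /andP[mi i_n]; rewrite !ndu.
have E : rsum h y u m n - h s * (y t - y s) =
   \sum_(m <= i < n) (h (u i) - h s) * (y (u i.+1) - y (u i)).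
  rewrite /s /t -(telescope_diff y u m n mn) big_distrr /= /rsum -sumrB.
  by apply: eq_bigr => i _; ring.
have flat (k : R -> R) B w b i : control w -> 0 < b -> controlled k B w b t -> w s t = 0 ->
    (m <= i <= n)%N -> k (u i) = k s.
  move=> cw b0 kw w0 /uin/andP[si it].
  apply/eqP; rewrite -subr_eq0 -normr_le0; apply: (le_trans (kw _ _ um si it)).
  have -> : w s (u i) = 0.
    apply/eqP; rewrite eq_le cw.1 // andbT -[leRHS]w0.
    exact: (control_mono w s s (u i) t).
  by rewrite powR0 ?mulr0 // gt_eqF.
(* A control of mass 0 cannot be normalized, but then the function is constant at the nodes and the
   defect, in the form [E], vanishes. *)
have [w10|w1n] := eqVneq (w1 s t) 0.
  rewrite E big_nat_cond big1 ?normr0 // => i; rewrite andbT => /andP[mi i_n].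
  by rewrite (flat h A w1 b1) ?subrr ?mul0r // mi ltnW.
have [w20|w2n] := eqVneq (w2 s t) 0.
  rewrite E big_nat_cond big1 ?normr0 // => i; rewrite andbT => /andP[mi i_n].
  by rewrite !(flat y 1 w2 b2) ?subrr ?mulr0 // ?mi ?leqW // ltnW.
have t0 : s <= t by exact: smn.
have w1p : 0 < w1 s t by rewrite lt_neqAle eq_sym w1n cw1.1.
have w2p : 0 < w2 s t by rewrite lt_neqAle eq_sym w2n cw2.1.
(* Both normalized parts have mass 1 on [s,t], so w has mass 2 there: this is the origin of the
   factor 2^(b1+b2). *)
pose w a b := (w1 s t)^-1 * w1 a b + (w2 s t)^-1 * w2 a b.
have cw : control w.
  by apply: controlD; apply: controlZ => //; rewrite invr_ge0 ltW.
have nw1 a b : 0 <= a -> a <= b -> w1 a b `^ b1 <= w1 s t `^ b1 * w a b `^ b1.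
  move=> a0 ab; rewrite -powRM ?(ltW w1p) ?cw.1 //; apply: powR_le; first exact: ltW.
    exact: cw1.1.
  rewrite /w mulrDr mulrA mulfV // mul1r lerDl.
  apply: mulr_ge0; first exact: ltW.
  by apply: mulr_ge0; [rewrite invr_ge0 ltW|exact: cw2.1].
have nw2 a b : 0 <= a -> a <= b -> w2 a b `^ b2 <= w2 s t `^ b2 * w a b `^ b2.
  move=> a0 ab; rewrite -powRM ?(ltW w2p) ?cw.1 //; apply: powR_le; first exact: ltW.
    exact: cw2.1.
  rewrite /w mulrDr [X in _ + X]mulrA mulfV // mul1r lerDr.
  apply: mulr_ge0; first exact: ltW.
  by apply: mulr_ge0; [rewrite invr_ge0 ltW|exact: cw1.1].
apply: (le_trans (chain_young w h y t (A * w1 s t `^ b1) (w2 s t `^ b2) b1 b2 u m n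
   cw _ _ _ _ b12 _ _ ndu um _ mn)).
- by rewrite mulr_ge0 ?powR_ge0.
- exact: powR_ge0.
- exact: ltW.
- exact: ltW.
- move=> a b a0 ab bt; apply: (le_trans (hw a b a0 ab bt)).
  by rewrite -mulrA ler_wpM2l // nw1.
- move=> a b a0 ab bt; apply: (le_trans (yw a b a0 ab bt)).
  by rewrite mul1r nw2.
- exact: lexx.
- have -> : w (u m) (u n) = 2 by rewrite /w -/s -/t !mulVf //; lra.
  by rewrite le_eqVlt; apply/orP; left; apply/eqP; rewrite /RHS -/s -/t; ring.
Qed.

End Chains.

(** * Riemann-Stieltjes integrals as limits along the mesh *)

Section RiemannStieltjes.
Context {R : realType}.

Lemma fine_chain (s t d : R) : s <= t -> 0 < d ->
  exists n (u : nat -> R), [/\ nd u, u 0%N = s, u n = t, (forall i, u i <= t) &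
    forall i, u i.+1 - u i < d].
Proof.
move=> st d0; have d20 : 0 < d / 2 by rewrite divr_gt0.
have ts : 0 <= (t - s) / (d / 2) by rewrite divr_ge0 ?subr_ge0 // ltW.
pose n := (Num.truncn ((t - s) / (d / 2))).+1.
have Hn : t <= s + n%:R * (d / 2).
  by rewrite -lerBlDl -ler_pdivrMr // ltW // truncnS_gt.
exists n, (fun i => Num.min (s + i%:R * (d / 2)) t); split.
- move=> i j ij; rewrite le_min !ge_min lexx orbT andbT; apply/orP; left.
  by rewrite lerD2l ler_pM2r // ler_nat.
- by rewrite mul0r addr0; apply/min_idPl.
- exact/min_idPr.
- by move=> i; rewrite ge_min lexx orbT.
- move=> i; rewrite -[i.+1]addn1 natrD mulrDl mul1r addrA.
  by case: (leP (s + i%:R * (d / 2)) t) => ?; case: (leP (_ + _ + _) t) => ?; lra.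
Qed.

Lemma RS_unique (U : Type) (W : zmodType) (V : normedModType R)
  (tag : R -> R -> R) (m : U -> W -> V) (h : R -> U) (y : R -> W) T I I' :
  0 <= T -> is_RS tag m h y T I -> is_RS tag m h y T I' -> I = I'.
Proof.
move=> T0 HI HI'; apply/eqP; rewrite -subr_eq0 -normr_le0; apply/ler_addgt0Pl => e e0.
have e20 : 0 < e / 2 by rewrite divr_gt0.
have [d1 d10 H1] := HI _ e20; have [d2 d20 H2] := HI' _ e20.
have d0 : 0 < Num.min d1 d2 by rewrite lt_min d10.
have [n [u [ndu u0 un _ um]]] := fine_chain 0 T _ T0 d0.
have := H1 n u u0 un; have := H2 n u u0 un.
set S := \sum_(i < n) _ => S2 S1.
have {}S1 : `|S - I| < e / 2.
  by apply: S1 => i _; split; [exact: ndu|apply: lt_le_trans (um i) _; rewrite ge_min lexx].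
have {}S2 : `|S - I'| < e / 2.
  by apply: S2 => i _; split; [exact: ndu|apply: lt_le_trans (um i) _; rewrite ge_min lexx orbT].
have -> : I - I' = (S - I') - (S - I) by rewrite opprB [RHS]addrC addrA subrK.
apply: (le_trans (ler_normB _ _)); lra.
Qed.

(** A partition constrains only the indices up to n. Freezing it after n turns it into a chain
    without changing the sum. *)
Lemma RS_of_chains (U : Type) (W : zmodType) (V : normedModType R)
  (tag : R -> R -> R) (m : U -> W -> V) (h : R -> U) (y : R -> W) T I :
  (forall e : R, 0 < e -> exists2 d : R, 0 < d & forall n u, nd u -> u 0%N = 0 -> u n = T ->
   (forall i, (n <= i)%N -> u i = T) -> (forall i, u i.+1 - u i < d) ->
   `| \sum_(i < n) m (h (tag (u i) (u i.+1))) (y (u i.+1) - y (u i)) - I | < e) ->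
  is_RS tag m h y T I.
Proof.
move=> H e e0; have [d d0 Hd] := H e e0; exists d => // n u u0 un um.
pose v i := u (minn i n).
have vS i : v i <= v i.+1 /\ v i.+1 - v i < d.
  rewrite /v; case: (leqP n i) => [ni|i_n].
    by rewrite (minn_idPr (leqW ni)) subrr lexx.
  by rewrite (minn_idPl i_n); exact: um.
have ndv : nd v by apply: ndS => i; exact: (vS i).1.
have := Hd n v ndv; rewrite {1 2}/v min0n minnn => /(_ u0 un).
under eq_bigr do rewrite /v (minn_idPl (ltnW (ltn_ord _))) (minn_idPl (ltn_ord _)).
apply; last by move=> i; exact: (vS i).2.
by move=> i ni; rewrite /v (minn_idPr ni).
Qed.

Definition lRS (h y : R -> R) (T I : R) :=
  is_RS (@left_tag R) (fun a b : R => a * b) h y T I.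

Lemma lRS_chain h y T I : lRS h y T I <->
  forall e, 0 < e -> exists2 d, 0 < d & forall n u, nd u -> u 0%N = 0 -> u n = T ->
   (forall i, (n <= i)%N -> u i = T) ->
   (forall i, u i.+1 - u i < d) -> `|rsum h y u 0 n - I| < e.
Proof.
split=> H; last first.
  apply: RS_of_chains => e e0; have [d d0 Hd] := H e e0; exists d => // n u ndu u0 un uT um.
  by have := Hd n u ndu u0 un uT um; rewrite /rsum big_mkord.
move=> e e0; have [d d0 Hd] := H e e0; exists d => // n u ndu u0 un _ um.
by rewrite /rsum big_mkord; apply: Hd => // i _; split; [exact: ndu|exact: um].
Qed.

(** The sums form a net indexed by chains, not a sequence; the Cauchy property is turned into a
    limit through the order of the reals. *)
Lemma lRS_cauchy h y T : 0 <= T ->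
  (forall e, 0 < e -> exists2 d, 0 < d & forall n u n' u', nd u -> u 0%N = 0 -> u n = T ->
   (forall i, (n <= i)%N -> u i = T) -> (forall i, u i.+1 - u i < d) ->
   nd u' -> u' 0%N = 0 -> u' n' = T ->
   (forall i, (n' <= i)%N -> u' i = T) -> (forall i, u' i.+1 - u' i < d) ->
    `|rsum h y u 0 n - rsum h y u' 0 n'| <= e) ->
  exists I, lRS h y T I.
Proof.
move=> T0 H.
pose fine d n u := [/\ nd u, u 0%N = 0, u n = T, (forall i, (n <= i)%N -> u i = T) &
  forall i, u i.+1 - u i < d].
have exfine d : 0 < d -> exists n u, fine d n u.
  move=> d0; have [n [u [ndu u0 un uT um]]] := fine_chain 0 T d T0 d0.
  exists n, u; split => // i ni; apply/eqP; rewrite eq_le uT -un; exact: ndu.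
have finele d d' n u : d <= d' -> fine d n u -> fine d' n u.
  by move=> dd [? ? ? ? um]; split => // i; apply: lt_le_trans (um i) _.
(* The numbers that are lower bounds of all sufficiently fine sums; the supremum is the limit
   inferior of the net. *)
pose A := [set r | exists2 d, 0 < d & forall n u, fine d n u -> r <= rsum h y u 0 n].
have key d n0 u0 e : 0 < d -> fine d n0 u0 ->
   (forall n u, fine d n u -> `|rsum h y u 0 n - rsum h y u0 0 n0| <= e) ->
   A (rsum h y u0 0 n0 - e) /\ ubound A (rsum h y u0 0 n0 + e).
  move=> d0 f0 Hd; split.
    by exists d => // n u /Hd; rewrite ler_distl => /andP[].
  move=> r [d' d'0 Hr].
  have dd : 0 < Num.min d d' by rewrite lt_min d0.
  have [n [u f]] := exfine _ dd.
  apply: (le_trans (Hr n u _)).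
    by apply: finele f; rewrite ge_min lexx orbT.
  have /Hd : fine d n u by apply: finele f; rewrite ge_min lexx.
  by rewrite ler_distl => /andP[].
have key2 e : 0 < e -> exists2 d, 0 < d & forall n0 u0, fine d n0 u0 ->
   A (rsum h y u0 0 n0 - e) /\ ubound A (rsum h y u0 0 n0 + e).
  move=> e0; have [d d0 Hd] := H e e0; exists d => // n0 u0 f0.
  apply: (key d) => // n u f; case: f0 => *; case: f => *; exact: Hd.
have hA : has_sup A.
  have [d d0 Hd] := key2 1 ltr01; have [n [u f]] := exfine d d0.
  have [a1 a2] := Hd n u f.
  by split; [exists (rsum h y u 0 n - 1)|exists (rsum h y u 0 n + 1)].
exists (sup A); apply/lRS_chain => e e0.
have e20 : 0 < e / 2 by rewrite divr_gt0.
have [d d0 Hd] := key2 _ e20; exists d => // n u ndu u0 un uT um.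
have fu : fine d n u by split.
have [a1 a2] := Hd n u fu.
have := sup_upper_bound hA a1; have := ge_sup hA.1 a2.
by rewrite ltr_distl; lra.
Qed.

(** With left tags the integrand at T carries no weight: a node already at T is followed by a zero
    increment. *)
Lemma lRS_ext h h' y T I : (forall s, 0 <= s -> s < T -> h s = h' s) ->
  lRS h y T I -> lRS h' y T I.
Proof.
move=> hh /lRS_chain H; apply/lRS_chain => e e0; have [d d0 Hd] := H e e0.
exists d => // n u ndu u0 un uT um.
have -> : rsum h' y u 0 n = rsum h y u 0 n; last exact: Hd.
apply: eq_big_nat => i /andP[_ i_n].
have ui0 : 0 <= u i by rewrite -u0 ndu.
have uiT : u i <= T by rewrite -un ndu // ltnW.
have [uT'|ne] := eqVneq (u i) T; last by rewrite hh // lt_neqAle ne.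
have -> : u i.+1 = u i; last by rewrite subrr !mulr0.
by apply/eqP; rewrite eq_le (ndu i i.+1) // andbT uT' -un ndu.
Qed.

Lemma lRSB h h' y T I I' : lRS h y T I -> lRS h' y T I' ->
  lRS (fun s => h s - h' s) y T (I - I').
Proof.
move=> /lRS_chain H /lRS_chain H'; apply/lRS_chain => e e0.
have e20 : 0 < e / 2 by rewrite divr_gt0.
have [d1 d10 H1] := H _ e20; have [d2 d20 H2] := H' _ e20.
exists (Num.min d1 d2) => [|n u ndu u0 un uT um]; first by rewrite lt_min d10.
have {}H1 : `|rsum h y u 0 n - I| < e / 2.
  by apply: H1 => // i; apply: lt_le_trans (um i) _; rewrite ge_min lexx.
have {}H2 : `|rsum h' y u 0 n - I'| < e / 2.
  by apply: H2 => // i; apply: lt_le_trans (um i) _; rewrite ge_min lexx orbT.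
have -> : rsum (fun s => h s - h' s) y u 0 n = rsum h y u 0 n - rsum h' y u 0 n.
  by rewrite /rsum -sumrB; apply: eq_bigr => i _; ring.
have -> : rsum h y u 0 n - rsum h' y u 0 n - (I - I') =
  (rsum h y u 0 n - I) - (rsum h' y u 0 n - I') by ring.
by apply: (le_lt_trans (ler_normB _ _)); lra.
Qed.

(** Additivity of the integral over intervals, in the form of a transfer of bounds: a fine chain of
    [0,s] followed by one of [s,t] approximates both integrals at once, and the difference of the
    two sums is a sum over [s,t]. *)
Lemma lRS_increment h y s t I I' c B : 0 <= s -> s <= t ->
  lRS h y s I -> lRS h y t I' ->
  (forall n u, nd u -> u 0%N = s -> u n = t -> `|rsum h y u 0 n - c| <= B) ->
  `|I' - I - c| <= B.
Proof.
move=> s0 st /lRS_chain H /lRS_chain H' HB.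
apply/ler_addgt0Pl => e e0.
have e20 : 0 < e / 2 by rewrite divr_gt0.
have [d1 d10 H1] := H _ e20; have [d2 d20 H2] := H' _ e20.
have d0 : 0 < Num.min d1 d2 by rewrite lt_min d10.
have d1le : Num.min d1 d2 <= d1 by rewrite ge_min lexx.
have d2le : Num.min d1 d2 <= d2 by rewrite ge_min lexx orbT.
have [n [u [ndu u0 un uT um]]] := fine_chain 0 s _ s0 d0.
have [n' [v [ndv v0 vn vT vm]]] := fine_chain s t _ st d0.
have u_n i : (n <= i)%N -> u i = s.
  by move=> ni; apply/eqP; rewrite eq_le uT -un ndu.
have v_n i : (n' <= i)%N -> v i = t.
  by move=> ni; apply/eqP; rewrite eq_le vT -vn ndv.
(* The chains are glued at index n, where the last node of u and the first node of v both equal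
   s. *)
pose w i := if (i <= n)%N then u i else v (i - n)%N.
have wu i : (i <= n)%N -> w i = u i by rewrite /w => ->.
have wv i : w (n + i)%N = v i.
  rewrite /w; case: i => [|i]; first by rewrite addn0 leqnn un v0.
  by rewrite -{2}(addn0 n) leq_add2l /= addKn.
have wS i : w i <= w i.+1 /\ w i.+1 - w i < Num.min d1 d2.
  have [i_n|ni] := ltnP i n; first by rewrite !wu // ?(ltnW i_n) //; split; [exact: ndu|exact: um].
  by rewrite -(subnKC ni) -addnS !wv; split; [exact: ndv|exact: vm].
have ndw : nd w by apply: ndS => i; exact: (wS i).1.
have E1 : `|rsum h y u 0 n - I| < e / 2.
  by apply: H1 => // i; apply: lt_le_trans (um i) _.
have E2 : `|rsum h y w 0 (n + n') - I'| < e / 2.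
  apply: H2 => //.
  - by rewrite wv.
  - move=> i ni; rewrite -(subnKC (leq_trans (leq_addr n' n) ni)) wv v_n //.
    by rewrite leq_subRL // (leq_trans (leq_addr n' n) ni).
  - by move=> i; apply: lt_le_trans (wS i).2 _.
have E3 := HB n' v ndv v0 vn.
have e3 : rsum h y w 0 (n + n') = rsum h y u 0 n + rsum h y v 0 n'.
  rewrite (rsum_cat _ _ _ _ n) ?leq_addr //; congr (_ + _).
    by apply: eq_big_nat => i /andP[_ i_n]; rewrite !wu // ltnW.
  rewrite /rsum -{1}[n]add0n big_addn addKn; apply: eq_big_nat => i _.
  by rewrite addnC -addnS !wv.
have -> : I' - I - c = (rsum h y v 0 n' - c) + ((rsum h y u 0 n - I) -
   (rsum h y w 0 (n + n') - I')) by rewrite e3; ring.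
apply: (le_trans (ler_normD _ _)); rewrite addrC; apply: lerD => //.
by apply: (le_trans (ler_normB _ _)); lra.
Qed.

Lemma lRS_0 h y : lRS h y 0 0.
Proof.
apply/lRS_chain => e e0; exists 1 => // n u ndu u0 un _ _.
have -> : rsum h y u 0 n = 0; last by rewrite subrr normr0.
rewrite /rsum big_nat_cond big1 // => i; rewrite andbT => /andP[_ i_n].
have E j : (j <= n)%N -> u j = 0.
  by move=> jn; apply/eqP; rewrite eq_le -{1}un -u0 !ndu.
by rewrite !E ?subrr ?mulr0 // ltnW.
Qed.

Lemma lRS0 h y I : lRS h y 0 I -> I = 0.
Proof. by move=> H; exact: (RS_unique _ _ _ _ _ _ _ _ _ _ (lexx 0) H (lRS_0 h y)). Qed.

End RiemannStieltjes.

(** * Existence of the Young integral *)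

Section YoungExistence.
Context {R : realType}.

Definition right_cont (y : R -> R) (T : R) := forall s : R, 0 <= s -> s <= T ->
  forall e : R, 0 < e ->
  exists2 d, 0 < d & forall u, s < u -> u < s + d -> `|y u - y s| < e.

(** The window may start late and end late, by less than d, and n is the first index at or past t.
    This slack lets a chain be cut at a time that is not one of its nodes. *)
Definition fine (d s t : R) u m n := [/\ nd u, (forall i, u i.+1 - u i < d), (m <= n)%N,
  s <= u m < s + d & t <= u n < t + d /\ forall i, (i < n)%N -> u i < t].

(** The error has a part e that vanishes with the mesh and a part proportional to [w s t]. By
    superadditivity the latter does not accumulate when intervals are concatenated. *)
Definition cauchy_on (w : R -> R -> R) (h y : R -> R) (T eta s t : R) := t <= T -> forall e : R, 0 < e -> exists2 d, 0 < d &
  forall u m n v m' n', fine d s t u m n -> fine d s t v m' n' ->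
  `|rsum h y u m n - rsum h y v m' n'| <= e + eta * w s t.

Lemma fine_le d d' s t u m n : d <= d' -> fine d s t u m n -> fine d' s t u m n.
Proof.
move=> dd [? um ? /andP[? ?] [/andP[? ?] ?]]; split => //.
- by move=> i; apply: lt_le_trans (um i) _.
- by apply/andP; split => //; lra.
- by split => //; apply/andP; split => //; lra.
Qed.

(* On an interval whose interior carries little of the control, a sum over a
   fine chain is determined up to a small error by its first node after s and
   its last node before t: this is where the jumps at s and t are dealt with. *)
Lemma cauchy_on_small w h y T A B b1 b2 eta s t :
  control w -> 0 <= A -> 0 <= B -> 0 < b1 -> 0 < b2 -> 1 < b1 + b2 -> 0 <= T ->
  controlled h A w b1 (T + 1) -> controlled y B w b2 (T + 1) -> right_cont y T ->
  0 <= s -> s < t -> 0 <= eta ->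
  (forall u v, s < u -> u <= v -> v < t -> young_const (b1 + b2) * A * B * w u v `^ (b1 + b2 - 1) <= eta) ->
  cauchy_on w h y T (2 * eta) s t.
Proof.
move=> cw A0 B0 b10 b20 b12 T0 hw yw yr s0 st eta0 small tT e e0.
have K0 : 0 <= young_const (b1 + b2) * A * B.
  by apply: mulr_ge0 => //; apply: mulr_ge0 => //; rewrite ltW // young_const_gt0.
have [Hb Hb0 HH] := controlled_bound cw A0 (ltW b10) hw.
have [Yb Yb0 HY] := controlled_bound cw B0 (ltW b20) yw.
(* Each of the two sums is approximated up to 3 Hb e', and the two approximations differ by at most
   (4 Hb + 4 Yb) e'. *)
pose e' := e / (10 * Hb + 4 * Yb).
have D0 : 0 < 10 * Hb + 4 * Yb by lra.
have e'0 : 0 < e' by rewrite divr_gt0.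
have e'E : e' * (10 * Hb + 4 * Yb) = e by rewrite /e' mulfVK // gt_eqF.
have s1 : s < T + 1 by lra.
have t0 : 0 < t by lra.
have t1 : t <= T + 1 by lra.
have [d1 d10 H1] := controlled_right cw A0 b10 hw s0 s1 e'0.
have [d2 d20 H2] := controlled_left cw A0 b10 hw t0 t1 e'0.
have [d4 d40 H4] := controlled_left cw B0 b20 yw t0 t1 e'0.
have sT : s <= T by exact: le_trans (ltW st) tT.
have [d5 d50 H5] := yr s s0 sT e' e'0.
have [d6 d60 H6] := yr t (ltW t0) tT e' e'0.
pose d := Num.min (Num.min (Num.min d1 d2) (Num.min 1 d4)) (Num.min (Num.min d5 d6) (t - s)).
have [d0 [[dd1 dd2 dd4] [dd5 dd6 dts d_1]]] : 0 < d /\ [/\ d <= d1, d <= d2 & d <= d4] /\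
   [/\ d <= d5, d <= d6, d <= t - s & d <= 1].
  by rewrite /d !ge_min !lt_min !lexx ?orbT d10 d20 d40 d50 d60 ltr01 subr_gt0 st.
exists d => //.
have approx u m n : fine d s t u m n -> exists a b, [/\ s < a, a < s + d, a <= b,
   t - d < b & b < t /\ `|rsum h y u m n - (h a * (y b - y a) + h b * (y t - y b))|
     <= 3 * Hb * e' + eta * w s t].
  move=> [ndu um mn /andP[sum_ umd] [/andP[tun und] uit]].
  have [m1 [mm1 m1n sm1 m1min]] := first_index (fun i => s < u i) m n mn (lt_le_trans st tun).
  have um1 : u m1 < s + d.
    have [<- //|ne] := eqVneq m m1.
    have mlt : (m < m1)%N by rewrite ltn_neqAle ne.
    have p1 : (m1.-1.+1 = m1)%N by rewrite prednK // (leq_ltn_trans _ mlt).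
    have := m1min m1.-1; rewrite -ltnS p1 => /(_ mlt (leqnn _)); rewrite -leNgt.
    by have := um m1.-1; rewrite p1 => H H'; lraof H H'.
  have m1n' : (m1 < n)%N.
    rewrite ltn_neqAle m1n andbT; apply/eqP => E; move: um1; rewrite E; lraof dts tun.
  have p1 : (n.-1.+1 = n)%N by rewrite prednK // (leq_ltn_trans _ m1n').
  have n1n : (n.-1 < n)%N by rewrite p1.
  have m1n1 : (m1 <= n.-1)%N by rewrite -ltnS p1.
  have bt := uit _ n1n.
  have ab : u m1 <= u n.-1 by exact: ndu.
  have dn := um n.-1; rewrite p1 in dn.
  exists (u m1), (u n.-1); split => //; first by lraof dn tun.
  split => //.
  (* Three blocks. Up to m1 the nodes equal s, so h is constant and the increment of y is small by
     right continuity at s; the inner block is left to the Young inequality; in the last step,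
     across t, the right node may be replaced by t by right continuity at t. *)
  rewrite (rsum_cat _ _ _ _ m1) // (rsum_cat _ _ _ m1 n.-1) // ?(ltnW n1n) //.
  have -> : rsum h y u n.-1 n = h (u n.-1) * (y (u n) - y (u n.-1)).
    by rewrite /rsum -{2}p1 big_nat1 p1.
  have E1 : rsum h y u m m1 = h s * (y (u m1) - y (u m)).
    apply: rsum_const => // i mi im1; congr h; apply/eqP; rewrite eq_le.
    by have := m1min i mi im1; rewrite -leNgt => -> /=; apply: le_trans (ndu _ _ mi).
  have ysa : `|y (u m1) - y s| < e' by apply: H5; [exact: sm1|lraof um1 dd5].
  have ysm : `|y (u m) - y s| < e'.
    have [->|ne] := eqVneq (u m) s; first by rewrite subrr normr0.
    by apply: H5; [rewrite lt_neqAle eq_sym ne|lraof umd dd5].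
  have ytn : `|y (u n) - y t| < e'.
    have [->|ne] := eqVneq (u n) t; first by rewrite subrr normr0.
    by apply: H6; [rewrite lt_neqAle eq_sym ne|lraof und dd6].
  have um10 : 0 <= u m1 by exact: le_trans s0 (ltW sm1).
  have un10 : 0 <= u n.-1 by exact: le_trans um10 ab.
  have un1T : u n.-1 <= T + 1 by exact: le_trans (ltW bt) t1.
  have E2 := chain_young w h y (T + 1) A B b1 b2 u m1 n.-1 cw A0 B0 (ltW b10) (ltW b20)
    b12 hw yw ndu um10 un1T m1n1.
  (* Since th > 1, w^th is w^(th-1) times w: the first factor is small inside the interval, the
     second keeps the error proportional to [w s t]. *)
  have E3 : young_const (b1 + b2) * A * B * w (u m1) (u n.-1) `^ (b1 + b2) <= eta * w s t.
    have w0 : 0 <= w (u m1) (u n.-1) by exact: cw.1.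
    rewrite -(mulr_powRB1 w0 (lt_trans ltr01 b12)).
    rewrite [w _ _ * _]mulrC mulrA; apply: ler_pM => //.
    + by apply: mulr_ge0; [exact: K0|exact: powR_ge0].
    + by apply: small.
    + by apply: (control_mono w) => //; exact: ltW.
  rewrite E1.
  set S := rsum h y u m1 n.-1 in E2 *.
  have hs := HH s s0 (ltW s1).
  have hb := HH (u n.-1) un10 un1T.
  have -> : h s * (y (u m1) - y (u m)) + (S + h (u n.-1) * (y (u n) - y (u n.-1))) -
     (h (u m1) * (y (u n.-1) - y (u m1)) + h (u n.-1) * (y t - y (u n.-1))) =
     h s * ((y (u m1) - y s) - (y (u m) - y s)) + h (u n.-1) * (y (u n) - y t) +
     (S - h (u m1) * (y (u n.-1) - y (u m1))) by ring.
  apply: (le_trans (ler_normD _ _)); apply: lerD; last exact: le_trans E2 E3.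
  apply: (le_trans (ler_normD _ _)); rewrite !normrM.
  have := ler_normB (y (u m1) - y s) (y (u m) - y s).
  set q := `|_ - _ - _| => q1; set r := `|y (u n) - _| in ytn *.
  have : `|h s| * q <= Hb * (2 * e').
    by apply: ler_pM; [exact: normr_ge0|exact: normr_ge0|exact: hs|lraof q1 ysa ysm].
  have : `|h (u n.-1)| * r <= Hb * e'.
    by apply: ler_pM; [exact: normr_ge0|exact: normr_ge0|exact: hb|exact: ltW].
  by move=> G1 G2; lraof G1 G2.
move=> u m n v m' n' fu fv.
have [a [b [sa ad ab tb [bt E]]]] := approx u m n fu.
have [a' [b' [sa' ad' ab' tb' [bt' E']]]] := approx v m' n' fv.
have a0 : 0 <= a by exact: le_trans s0 (ltW sa).
have a0' : 0 <= a' by exact: le_trans s0 (ltW sa').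
have b0 := le_trans a0 ab; have b0' := le_trans a0' ab'.
have b1T := le_trans (ltW bt) t1; have b1T' := le_trans (ltW bt') t1.
have ha : `|h a - h a'| <= e'.
  by apply/ltW/H1; rewrite ?sa ?sa' //; [lraof ad' dd1|lraof ad dd1].
have hb : `|h b - h b'| <= e'.
  by apply/ltW/H2 => //; [lraof tb' dd2|lraof tb dd2].
have yb : `|y b - y b'| <= e'.
  by apply/ltW/H4 => //; [lraof tb' dd4|lraof tb dd4].
have ya : `|y a - y a'| <= 2 * e'.
  have q1 : `|y a - y s| < e' by apply: H5 => //; lraof ad dd5.
  have q2 : `|y a' - y s| < e' by apply: H5 => //; lraof ad' dd5.
  have -> : y a - y a' = (y a - y s) - (y a' - y s) by ring.
  by apply: (le_trans (ler_normB _ _)); lraof q1 q2.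
set X := h a * _ + _ in E; set X' := h a' * _ + _ in E'.
have XX : `|X - X'| <= e' * (4 * Hb + 4 * Yb).
  have -> : X - X' = (h a - h a') * (y b - y a) + h a' * ((y b - y b') - (y a - y a')) +
     ((h b - h b') * (y t - y b) - h b' * (y b - y b')) by rewrite /X /X'; ring.
  have Yba := ler_normB (y b) (y a); have Ytb := ler_normB (y t) (y b).
  have q := ler_normB (y b - y b') (y a - y a').
  have Ya := HY a a0 (le_trans ab b1T).
  have Yb' := HY b b0 b1T.
  have Yt := HY t (ltW t0) t1.
  have Ha' := HH a' a0' (le_trans ab' b1T').
  have Hb'' := HH b' b0' b1T'.
  apply: (le_trans (ler_normD _ _)).
  have l1 : `|(h a - h a') * (y b - y a) + h a' * ((y b - y b') - (y a - y a'))| <=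
      e' * (2 * Yb) + Hb * (3 * e').
    apply: (le_trans (ler_normD _ _)); rewrite !normrM.
    by apply: lerD; apply: ler_pM => //; [lraof Yba Ya Yb'|lraof q ya yb].
  have l2 : `|(h b - h b') * (y t - y b) - h b' * (y b - y b')| <= e' * (2 * Yb) + Hb * e'.
    apply: (le_trans (ler_normB _ _)); rewrite !normrM.
    by apply: lerD; apply: ler_pM => //; lraof Ytb Yt Yb'.
  by apply: (le_trans (lerD l1 l2)); lraof e'0.
set Su := rsum _ _ _ _ _ in E *; set Sv := rsum _ _ _ _ _ in E' *.
have -> : Su - Sv = (Su - X) - (Sv - X') + (X - X') by ring.
apply: (le_trans (ler_normD _ _)).
apply: (le_trans (lerD (ler_normB _ _) XX)).
by rewrite -e'E; lraof E E'.
Qed.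

(** The cut is made at the first node j at or past s: it closes the window of [r,s] and opens that
    of [s,t], and the step straddling s is counted in the first. The bound on d keeps j beyond m. *)
Lemma fine_split d r s t u m n : r < s -> s < t -> d <= s - r -> fine d r t u m n ->
  exists j, [/\ (m <= j)%N, (j <= n)%N, fine d r s u m j & fine d s t u j n].
Proof.
move=> rs st dsr.
move=> [ndu um mn /andP[rum umd] [/andP[tun und] uit]].
have [j [mj jn sj jmin]] := first_index (fun i => s <= u i) m n mn (le_trans (ltW st) tun).
have mj' : (m < j)%N.
  by rewrite ltn_neqAle mj andbT; apply/eqP => E; move: sj; rewrite -E; lra.
have p1 : (j.-1.+1 = j)%N by rewrite prednK // (leq_ltn_trans _ mj').
have ujd : u j < s + d.
  have := jmin j.-1; rewrite -ltnS p1 => /(_ mj' (leqnn _)); rewrite -ltNge.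
  by have := um j.-1; rewrite p1; lra.
exists j; split => //; split => //; rewrite ?rum ?umd ?sj ?ujd ?tun ?und //; split => // i ij.
have [mi|im] := leqP m i; first by have := jmin i mi ij; rewrite -ltNge.
by apply: (le_lt_trans (ndu i m (ltnW im))); lra.
Qed.

Lemma cauchy_on_cat w h y T eta r s t : control w -> 0 <= eta -> 0 <= r -> r < s -> s < t ->
  cauchy_on w h y T eta r s -> cauchy_on w h y T eta s t -> cauchy_on w h y T eta r t.
Proof.
move=> cw eta0 r0 rs st Prs Pst tT e e0.
have e20 : 0 < e / 2 by rewrite divr_gt0.
have [d1 d10 H1] := Prs ltac:(lra) _ e20; have [d2 d20 H2] := Pst tT _ e20.
pose d := Num.min (Num.min d1 d2) (s - r).
have [d0 [dd1 dd2 dsr]] : 0 < d /\ [/\ d <= d1, d <= d2 & d <= s - r].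
  by rewrite /d !ge_min !lt_min !lexx ?orbT d10 d20 subr_gt0 rs.
exists d => // u m n v m' n' fu fv.
have [j [mj jn fu1 fu2]] := fine_split d r s t u m n rs st dsr fu.
have [k [mk kn fv1 fv2]] := fine_split d r s t v m' n' rs st dsr fv.
rewrite (rsum_cat _ _ u _ j) // (rsum_cat _ _ v _ k) //.
have E1 := H1 _ _ _ _ _ _ (fine_le _ _ _ _ _ _ _ dd1 fu1) (fine_le _ _ _ _ _ _ _ dd1 fv1).
have E2 := H2 _ _ _ _ _ _ (fine_le _ _ _ _ _ _ _ dd2 fu2) (fine_le _ _ _ _ _ _ _ dd2 fv2).
have W := cw.2 r s t r0 (ltW rs) (ltW st).
have -> x1 x2 x3 x4 : x1 + x2 - (x3 + x4) = (x1 - x3) + (x2 - x4) :> R by ring.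
apply: (le_trans (ler_normD _ _)); apply: (le_trans (lerD E1 E2)).
by have := ler_wpM2l eta0 W; lra.
Qed.

(** A chain may stay at T for several indices, whereas [fine] ends at the first of them; the
    remaining steps have zero increments. *)
Lemma fine_first d T n u : 0 < d -> nd u -> u 0%N = 0 -> u n = T ->
  (forall i, (n <= i)%N -> u i = T) -> (forall i, u i.+1 - u i < d) ->
  exists j, [/\ (j <= n)%N, fine d 0 T u 0 j & forall i, (j <= i)%N -> u i = T].
Proof.
move=> d0 ndu u0 un uT um.
have Tn : T <= u n by rewrite un.
have [j [_ jn Tj jmin]] := first_index (fun i => T <= u i) 0 n (leq0n _) Tn.
have ujT i : (j <= i)%N -> u i = T.
  move=> ji; apply/eqP; rewrite eq_le (le_trans Tj (ndu _ _ ji)) andbT.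
  by have [/uT ->//|/ltnW i_n] := leqP n i; rewrite -un ndu.
exists j; split => //; split => //; first by rewrite u0 lexx add0r.
split; first by rewrite ujT // lexx ltrDl.
by move=> i ij; have := jmin i (leq0n _) ij; rewrite -ltNge.
Qed.

Lemma young_exists w h y T A B b1 b2 :
  control w -> 0 <= A -> 0 <= B -> 0 < b1 -> 0 < b2 -> 1 < b1 + b2 -> 0 <= T ->
  controlled h A w b1 (T + 1) -> controlled y B w b2 (T + 1) -> right_cont y T ->
  exists I, lRS h y T I.
Proof.
move=> cw A0 B0 b10 b20 b12 T0 hw yw yr.
set th := b1 + b2; set K := young_const th * A * B.
have K0 : 0 <= K.
  by apply: mulr_ge0 => //; apply: mulr_ge0 => //; rewrite ltW // young_const_gt0.
have [->|Tn] := eqVneq T 0; first by exists 0; exact: lRS_0.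
have Tp : 0 < T by rewrite lt_neqAle eq_sym Tn.
have PT eta : 0 < eta -> cauchy_on w h y T (2 * eta) 0 T.
  move=> eta0; have K1 : 0 < K + 1 by lra.
  have th1 : 0 < th - 1 by rewrite /th; lra.
  have [d d0 Hd] := powR_small (th - 1) (eta / (K + 1)) th1 (divr_gt0 eta0 K1).
  (* On intervals of small mass the surplus power th - 1 absorbs the constant K. *)
  have Hd' x : 0 <= x -> x < d -> K * x `^ (th - 1) <= eta.
    move=> x0 xd; have := Hd x x0 xd; rewrite ltr_pdivlMr //.
    by have := powR_ge0 x (th - 1); nra.
  apply: interval_induction => //.
  - by move=> r s t r0 rs st; apply: cauchy_on_cat => //; lra.
  - move=> s s0; have [d1 d10 H1] := control_right_small w s d cw s0 d0.
    exists d1 => // t st td; apply: (cauchy_on_small w h y T A B b1 b2) => //; first exact: ltW.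
    by move=> u v su uv vt; apply: Hd'; [apply: cw.1; lra|apply: H1; lra].
  - move=> t t0; have [d1 d10 H1] := control_left_small w t d cw t0 d0.
    exists d1 => // s s0 td st; apply: (cauchy_on_small w h y T A B b1 b2) => //; first exact: ltW.
    by move=> u v su uv vt; apply: Hd'; [apply: cw.1; lra|apply: H1; lra].
apply: lRS_cauchy => // e e0.
have w0 : 0 <= w 0 T by exact: cw.1.
have W1 : 0 < 4 * (w 0 T + 1) by lra.
have e20 : 0 < e / 2 by rewrite divr_gt0.
(* Here eta is e / (4 (w(0,T) + 1)), so that the persistent error 2 eta w(0,T) is at most e/2. *)
have [d d0 Hd] := PT _ (divr_gt0 e0 W1) (lexx _) _ e20.
have fineT n u : nd u -> u 0%N = 0 -> u n = T -> (forall i, (n <= i)%N -> u i = T) ->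
   (forall i, u i.+1 - u i < d) -> exists2 j, fine d 0 T u 0 j & rsum h y u 0 n = rsum h y u 0 j.
  move=> ndu u0 un uT um.
  have [j [jn fj ujT]] := fine_first d T n u d0 ndu u0 un uT um; exists j => //.
  rewrite (rsum_cat _ _ _ _ j) // [X in _ + X](_ : _ = 0) ?addr0 //.
  rewrite /rsum big_nat_cond big1 // => i; rewrite andbT => /andP[ji i_n].
  by rewrite !ujT ?subrr ?mulr0 // leqW.
exists d => // n u n' u' ndu u0 un uT um ndu' u0' un' uT' um'.
have [j fj ->] := fineT n u ndu u0 un uT um.
have [k fk ->] := fineT n' u' ndu' u0' un' uT' um'.
apply: (le_trans (Hd _ _ _ _ _ _ fj fk)).
have : 2 * (e / (4 * (w 0 T + 1))) * w 0 T <= e / 2.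
  have -> : 2 * (e / (4 * (w 0 T + 1))) * w 0 T = (e / 2) * (w 0 T / (w 0 T + 1)).
    by field; apply/eqP; lra.
  rewrite ger_pMr // ler_pdivrMr; lra.
lra.
Qed.

End YoungExistence.

(** * The p-variation of real paths *)

Section PVariation.
Context {R : realType}.
Implicit Types (x y : R -> R) (p s t M : R) (u : nat -> R).

Definition pvsum p x u n := \sum_(i < n) `|x (u i.+1) - x (u i)| `^ p.

(** The chain need not reach s or t, which makes the restriction to subintervals immediate. *)
Definition pvb p x s t M := forall n u, nd u -> s <= u 0%N -> u n <= t ->
  pvsum p x u n <= M.

Definition pvset p x s t :=
  [set r | exists n u, [/\ nd u, s <= u 0%N, u n <= t & r = pvsum p x u n]].

(** The p-variation without the p-th root: in this form it is superadditive in the interval. *)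
Definition pv p x s t := sup (pvset p x s t).

Definition pvfin p x := forall T, exists M, pvb p x 0 T M.

Lemma pvsum_ge0 p x u n : 0 <= pvsum p x u n.
Proof. by apply: sumr_ge0 => i _; exact: powR_ge0. Qed.

Lemma pvb_mono p x s t s' t' M M' : pvb p x s t M -> s <= s' -> t' <= t ->
  M <= M' -> pvb p x s' t' M'.
Proof.
move=> H ss tt MM n u ndu u0 un; apply: le_trans MM.
by apply: H => //; [exact: le_trans ss u0|exact: le_trans un tt].
Qed.

Lemma pvset_neq0 p x s t : s <= t -> pvset p x s t (pvsum p x (fun=> s) 0).
Proof. by move=> st; exists 0%N, (fun=> s); split => // i j _. Qed.

Lemma pv_le p x s t M : s <= t -> pvb p x s t M -> pv p x s t <= M.
Proof.
move=> st H; apply: ge_sup; first by exists (pvsum p x (fun=> s) 0); exact: pvset_neq0.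
by move=> _ [n [u [ndu u0 un ->]]]; exact: H.
Qed.

Lemma pvbP p x s t M : pvb p x s t M -> pvb p x s t (pv p x s t).
Proof.
move=> H n u ndu u0 un; apply: sup_upper_bound; last by exists n, u.
have st : s <= t by rewrite (le_trans u0) // (le_trans (ndu 0%N n (leq0n _))).
split; first by exists (pvsum p x (fun=> s) 0); exact: pvset_neq0.
by exists M => _ [k [v [? ? ? ->]]]; exact: H.
Qed.

Lemma pvfin_pvb p x s t : pvfin p x -> 0 <= s -> pvb p x s t (pv p x s t).
Proof.
by move=> /(_ t)[M H] s0; apply: (pvbP _ _ _ _ M); apply: pvb_mono H _ _ _.
Qed.

Lemma pv_ge0 p x s t : 0 <= pv p x s t.
Proof.
rewrite /pv; have [hs|/sup_out ->//] := pselect (has_sup (pvset p x s t)).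
have [r Hr] := hs.1; apply: le_trans (sup_upper_bound hs Hr).
by case: Hr => n [u [_ _ _ ->]]; exact: pvsum_ge0.
Qed.

Lemma pv_control p x : pvfin p x -> control (pv p x).
Proof.
move=> fx; split=> [s t _ _|r s t r0 rs st]; first exact: pv_ge0.
have H := pvfin_pvb _ _ r t fx r0.
rewrite -lerBrDr; apply: pv_le => // n u ndu u0 un.
rewrite lerBrDr addrC -lerBrDr; apply: pv_le => // k v ndv v0 vk.
rewrite lerBrDr addrC.
(* The second chain begins at index n+1, so the step from [u n] to [v 0] appears as one extra term,
   which is nonnegative and dropped. *)
pose w i := if (i <= n)%N then u i else v (i - n.+1)%N.
have wu i : (i <= n)%N -> w i = u i by rewrite /w => ->.
have wv i : w (n.+1 + i)%N = v i by rewrite /w addSn ltnNge leq_addr /= subSS addKn.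
have ndw : nd w.
  apply: ndS => i; have [i_n|ni] := ltnP i n.
    by rewrite !wu // ?(ltnW i_n) //; exact: ndu.
  have [->|ne] := eqVneq i n.
    by rewrite wu // -[n.+1]addn0 wv; apply: le_trans un v0.
  have ni' : (n < i)%N by rewrite ltn_neqAle eq_sym ne.
  by rewrite -(subnKC ni') -addnS !wv; exact: ndv.
have := H (n.+1 + k)%N w ndw; rewrite wu // wv => /(_ u0 vk).
apply: le_trans; rewrite /pvsum big_split_ord /= big_ord_recr /=.
rewrite -addrA; apply: lerD.
  by rewrite le_eqVlt; apply/orP; left; apply/eqP; apply: eq_bigr => i _; rewrite !wu // ltnW.
rewrite -[leLHS]add0r; apply: lerD; first exact: powR_ge0.
rewrite le_eqVlt; apply/orP; left; apply/eqP; apply: eq_bigr => i _.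
by rewrite -addnS !wv.
Qed.

Lemma pv_incr p x s t : pvfin p x -> 0 <= s -> s <= t ->
  `|x t - x s| `^ p <= pv p x s t.
Proof.
move=> fx s0 st; have := pvfin_pvb _ _ s t fx s0 1%N (fun i => if i is 0%N then s else t).
rewrite /pvsum big_ord1; apply => //.
by apply: ndS => -[|i].
Qed.

Lemma pv_controlled p x T : 0 < p -> pvfin p x -> controlled x 1 (pv p x) p^-1 T.
Proof.
move=> p0 fx s t s0 st _; rewrite mul1r powR_inv_le ?pv_ge0 //; exact: pv_incr.
Qed.

Lemma pvsum_control p x (w : R -> R -> R) s t u n : control w -> 0 <= s ->
  (forall a b, s <= a -> a <= b -> b <= t -> `|x b - x a| `^ p <= w a b) ->
  nd u -> s <= u 0%N -> u n <= t -> pvsum p x u n <= w (u 0%N) (u n).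
Proof.
move=> cw s0 H ndu u0; have u00 := le_trans s0 u0.
elim: n => [|n IH] un; first by rewrite /pvsum big_ord0 cw.1.
have un' : u n <= t by exact: le_trans (ndu _ _ (leqnSn n)) un.
have u0n : u 0%N <= u n by exact: ndu.
rewrite /pvsum big_ord_recr /=.
apply: le_trans (cw.2 _ _ _ u00 u0n (ndu _ _ (leqnSn n))); apply: lerD; first exact: IH.
by apply: H => //; [exact: le_trans u0 u0n|exact: ndu].
Qed.

Lemma pvb_control p x (w : R -> R -> R) s t : control w -> 0 <= s ->
  (forall a b, s <= a -> a <= b -> b <= t -> `|x b - x a| `^ p <= w a b) ->
  pvb p x s t (w s t).
Proof.
move=> cw s0 H n u ndu u0 un.
apply: (le_trans (pvsum_control p x w s t u n cw s0 H ndu u0 un)).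
by apply: (control_mono w) => //; exact: ndu.
Qed.

Lemma pvbD p x y s t M N : 0 <= p -> pvb p x s t M -> pvb p y s t N ->
  pvb p (fun r => x r + y r) s t (2 `^ p * (M + N)).
Proof.
move=> p0 Hx Hy n u ndu u0 un.
apply: (@le_trans _ _ (2 `^ p * (pvsum p x u n + pvsum p y u n))).
  rewrite /pvsum -big_split /= big_distrr /=; apply: ler_sum => i _.
  apply: le_trans (powR_sum_le _ _ _ p0 (normr_ge0 _) (normr_ge0 _)).
  apply: powR_le => //.
  by rewrite opprD addrACA ler_normD.
by apply: ler_wpM2l; [exact: powR_ge0|apply: lerD; [exact: Hx|exact: Hy]].
Qed.

Lemma pvbN p x s t M : pvb p x s t M -> pvb p (fun r => - x r) s t M.
Proof.
move=> Hx n u ndu u0 un; rewrite /pvsum.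
under eq_bigr do rewrite -opprD normrN.
exact: Hx.
Qed.

Lemma pvbB p x y s t M N : 0 <= p -> pvb p x s t M -> pvb p y s t N ->
  pvb p (fun r => x r - y r) s t (2 `^ p * (M + N)).
Proof. by move=> p0 Hx Hy; apply: pvbD => //; exact: pvbN. Qed.

Lemma pvb_ext p x y s t M : (forall r, s <= r -> r <= t -> x r = y r) ->
  pvb p x s t M -> pvb p y s t M.
Proof.
move=> xy Hx n u ndu u0 un.
have E i : (i <= n)%N -> y (u i) = x (u i).
  move=> i_n; rewrite xy //; first exact: le_trans u0 (ndu _ _ _).
  exact: le_trans (ndu _ _ i_n) un.
have -> : pvsum p y u n = pvsum p x u n; last exact: Hx.
by apply: eq_bigr => i _; rewrite !E // ltnW.
Qed.

(** A monotone change of time maps chains to chains. Stopping, delaying and freezing a path are all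
    of this form. *)
Lemma pvb_time p x (phi : R -> R) s t s' t' M :
  (forall a b, s <= a -> a <= b -> b <= t -> phi a <= phi b) ->
  (forall a, s <= a -> a <= t -> s' <= phi a <= t') ->
  pvb p x s' t' M -> pvb p (x \o phi) s t M.
Proof.
move=> mphi rphi H n u ndu u0 un.
have us i : s <= u i by apply: le_trans u0 (ndu _ _ _).
pose v i := phi (u (minn i n)).
have ut i : u (minn i n) <= t by apply: le_trans un; apply: ndu; exact: geq_minr.
have ndv : nd v.
  move=> i j ij; apply: mphi => //; apply: ndu.
  by rewrite leq_min geq_minr andbT (leq_trans (geq_minl _ _)).
have := H n v ndv.
have /andP[-> _] := rphi _ (us (minn 0 n)) (ut 0%N).
have /andP[_ ->] := rphi _ (us (minn n n)) (ut n) => /(_ isT isT).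
apply: le_trans; rewrite le_eqVlt; apply/orP; left; apply/eqP; apply: eq_bigr => i _.
by rewrite /v /= (minn_idPl (ltn_ord i)) (minn_idPl (ltnW (ltn_ord i))).
Qed.

Lemma finite_min n (P : nat -> R -> Prop) :
  (forall i d d', P i d -> 0 < d' -> d' <= d -> P i d') ->
  (forall i, exists2 d, 0 < d & P i d) ->
  exists2 d, 0 < d & forall i, (i <= n)%N -> P i d.
Proof.
move=> Pm Pe; elim: n => [|n [d d0 Hd]].
  by have [d d0 Hd] := Pe 0%N; exists d => // i; rewrite leqn0 => /eqP ->.
have [d' d'0 Hd'] := Pe n.+1; exists (Num.min d d'); first by rewrite lt_min d0.
move=> i; rewrite leq_eqVlt => /orP[/eqP ->|].
  by apply: Pm Hd' _ _; rewrite ?lt_min ?d0 // ge_min lexx orbT.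
by rewrite ltnS => /Hd H; apply: Pm H _ _; rewrite ?lt_min ?d0 // ge_min lexx.
Qed.

(* Scaling by [c < 1] replaces the continuity of the power function. *)
Lemma pvb_approx p x s t M : 0 < p ->
  (forall n u, nd u -> s <= u 0%N -> u n <= t -> forall d, 0 < d ->
   exists y, pvsum p y u n <= M /\
     forall i, (i <= n)%N -> `|y (u i) - x (u i)| < d) ->
  pvb p x s t M.
Proof.
move=> p0 H n u ndu u0 un.
pose a i := `|x (u i.+1) - x (u i)|.
have key c : 0 < c -> c < 1 -> c * pvsum p x u n <= M.
  move=> c0 c1; pose lam := c `^ p^-1.
  have lam0 : 0 < lam by exact: powR_gt0.
  have lamp : lam `^ p = c by apply: powRK => //; exact: ltW.
  have lam1 : lam < 1.
    have e1 : 1 `^ p^-1 = 1 :> R by rewrite powR1.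
    rewrite /lam -[ltRHS]e1; apply: gt0_ltr_powR; rewrite ?invr_gt0 ?nnegrE //.
    exact: ltW.
  (* An approximation this close shortens each nonzero increment by a factor lam at worst, where
     lam^p = c. *)
  have [d d0 Hd] : exists2 d, 0 < d & forall i, (i <= n)%N -> 0 < a i ->
      2 * d <= (1 - lam) * a i.
    apply: (finite_min n (fun i d => 0 < a i -> 2 * d <= (1 - lam) * a i)).
      by move=> i d d' Hd d'0 dd' /Hd; lra.
    move=> i; have [ai|ai] := ltP 0 (a i); last first.
      by exists 1 => // h0; have := lt_le_trans h0 ai; rewrite ltxx.
    by exists ((1 - lam) * a i / 2) => [|_]; [rewrite divr_gt0 // mulr_gt0 ?subr_gt0|lra].
  have [y [yM yx]] := H n u ndu u0 un d d0.
  apply: le_trans yM; rewrite /pvsum big_distrr /=; apply: ler_sum => i _.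
  have -> : c * `|x (u i.+1) - x (u i)| `^ p = (lam * a i) `^ p.
    by rewrite (powRM _ (ltW lam0) (normr_ge0 _)) lamp.
  apply: powR_le; first exact: ltW.
    by apply: mulr_ge0; [exact: ltW|exact: normr_ge0].
  have [ai|ai] := ltP 0 (a i); last first.
    have -> : a i = 0 by apply/eqP; rewrite eq_le ai normr_ge0.
    by rewrite mulr0.
  have h1 := Hd i (ltnW (ltn_ord i)) ai.
  have h2 := yx i (ltnW (ltn_ord i)); have h3 := yx i.+1 (ltn_ord i).
  have : a i <= `|y (u i.+1) - y (u i)| + `|y (u i) - x (u i)| + `|y (u i.+1) - x (u i.+1)|.
    have -> : a i = `|(y (u i.+1) - y (u i)) + (y (u i) - x (u i)) - (y (u i.+1) - x (u i.+1))|.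
      by rewrite /a; congr `|_|; ring.
    by apply: (le_trans (ler_normB _ _)); rewrite lerD2r; exact: ler_normD.
  move=> h4; lraof h1 h2 h3 h4.
apply/ler_addgt0Pl => e e0.
have S0 := pvsum_ge0 p x u n; set S := pvsum p x u n in key S0 *.
(* With this c the loss S - c S is at most e. *)
pose c := S / (S + e).
have [->|Sn] := eqVneq S 0.
  by rewrite addr_ge0 ?(ltW e0) //; have := key (1/2) ltac:(lra) ltac:(lra); apply: le_trans;
  rewrite mulr_ge0.
have Sp : 0 < S by rewrite lt_neqAle eq_sym Sn.
have Se : 0 < S + e by lra.
have := key (S / (S + e)) (divr_gt0 Sp Se) ltac:(rewrite ltr_pdivrMr //; lra).
have -> : S / (S + e) * S = S - e * (S / (S + e)) by field; rewrite gt_eqF.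
have : e * (S / (S + e)) <= e by rewrite ger_pMr // ler_pdivrMr //; lra.
lra.
Qed.

(** Lower semicontinuity of the p-variation: on the finitely many nodes of a chain pointwise
    convergence is uniform. *)
Lemma pvb_lim p (xk : nat -> R -> R) x s t M : 0 < p ->
  (forall k, pvb p (xk k) s t M) ->
  (forall a, s <= a -> a <= t -> forall d, 0 < d ->
     exists K, forall k, (K <= k)%N -> `|xk k a - x a| < d) ->
  pvb p x s t M.
Proof.
move=> p0 H1 H2; apply: pvb_approx => // n u ndu u0 un d d0.
have [K HK] : exists K, forall i, (i <= n)%N -> forall k, (K <= k)%N -> `|xk k (u i) - x (u i)| < d.
  have Hu i : (i <= n)%N -> exists K, forall k, (K <= k)%N -> `|xk k (u i) - x (u i)| < d.
    move=> i_n; apply: H2 => //; first exact: le_trans u0 (ndu _ _ _).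
    exact: le_trans (ndu _ _ i_n) un.
  elim: n un Hu => [|n IH] un Hu.
    by have [K HK] := Hu 0%N (leqnn _); exists K => i; rewrite leqn0 => /eqP ->.
  have [K HK] := IH (le_trans (ndu _ _ (leqnSn n)) un) (fun i i_n => Hu i (leqW i_n)).
  have [K' HK'] := Hu n.+1 (leqnn _); exists (maxn K K') => i.
  rewrite leq_eqVlt => /orP[/eqP -> k|]; first by rewrite geq_max => /andP[_]; exact: HK'.
  by rewrite ltnS => i_n k; rewrite geq_max => /andP[+ _]; exact: HK.
by exists (xk K); split; [exact: H1|move=> i i_n; exact: HK].
Qed.

Lemma inv_small (d : R) : 0 < d -> exists K, forall k, (K <= k)%N -> (k.+1%:R)^-1 < d.
Proof.
move=> d0; exists (Num.truncn d^-1) => k Kk.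
rewrite invf_plt ?posrE ?ltr0n //; apply: (lt_le_trans (truncnS_gt _)).
by rewrite ler_nat.
Qed.

(** [control_right_small] misses the intervals that start at s itself. Freezing the path on [s,m] at
    its value at m gives paths of small variation; as m decreases to s they converge pointwise by
    right continuity, and lower semicontinuity concludes. *)
Lemma pv_right_small p x s e : 0 < p -> pvfin p x -> right_cont x s -> 0 <= s -> 0 < e ->
  exists2 d, 0 < d & forall t, s <= t -> t < s + d -> pv p x s t <= e.
Proof.
move=> p0 fx rx s0 e0.
have [d d0 Hd] := control_right_small _ s e (pv_control _ _ fx) s0 e0.
exists d => // t st' td; move: st'; rewrite [s <= t]le_eqVlt => /orP[/eqP <-|st].
  by rewrite control_diag ?(ltW e0) //; exact: pv_control.
apply: pv_le; first exact: ltW.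
have ts : 0 < t - s by rewrite subr_gt0.
apply: (pvb_lim p (fun k => x \o (fun a => Num.max a (Num.min t (s + k.+1%:R^-1))))) => //.
  move=> k; set m := Num.min t _.
  have sm : s < m by rewrite lt_min st ltrDl invr_gt0 ltr0n.
  have mt : m <= t by rewrite ge_min lexx.
  apply: (pvb_time _ _ _ _ _ m t).
  - by move=> a b _ ab _; rewrite ge_max !le_max lexx ab !orbT.
  - by move=> a _ a_t; rewrite le_max lexx orbT ge_max a_t mt.
  - apply: (pvb_mono _ _ m t m t (pv p x m t)) => //.
      by apply: pvfin_pvb => //; exact: le_trans s0 (ltW sm).
    by apply/ltW/Hd.
move=> a sa a_t d' d'0 /=; move: sa; rewrite [s <= a]le_eqVlt => /orP[/eqP <-|sa].
  have [d2 d20 Hd2] := rx s s0 (lexx _) d' d'0.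
  have [K HK] := inv_small _ d20; exists K => k Kk.
  rewrite max_r; last by rewrite le_min (ltW st) lerDl invr_ge0 ler0n.
  apply: Hd2; first by rewrite lt_min st ltrDl invr_gt0 ltr0n.
  by rewrite gt_min ltrD2l HK // orbT.
have [K HK] := inv_small _ (ltac:(by rewrite subr_gt0) : 0 < a - s).
exists K => k Kk; rewrite max_l ?subrr ?normr0 //.
by rewrite ge_min -lerBrDl (ltW (HK k Kk)) orbT.
Qed.

End PVariation.

(** * Càdlàg paths, left limits and local variation *)

Section Cadlag.
Context {R : realType}.
Implicit Types (x y xl yl : R -> R) (p s t M T d e : R).

Definition rcont x := forall s, 0 <= s -> forall e, 0 < e ->
  exists2 d, 0 < d & forall u, s < u -> u < s + d -> `|x u - x s| < e.

Lemma rcont_right_cont x T : rcont x -> right_cont x T.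
Proof. by move=> H s s0 _; exact: H. Qed.

Definition left_lim x xl := xl 0 = x 0 /\
  forall t, 0 < t -> forall e, 0 < e ->
  exists2 d, 0 < d & forall u, 0 <= u -> t - d < u -> u < t -> `|x u - xl t| < e.

Lemma cvg_rightP x s (l : R) : x @ s^'+ --> l <->
  forall e, 0 < e -> exists2 d, 0 < d & forall u, s < u -> u < s + d -> `|x u - l| < e.
Proof.
split=> [/cvgrPdist_lt H e e0|H].
  have [d /= d0 Hd] := H e e0; exists d => // u su ud.
  by rewrite distrC; apply: Hd => //=; rewrite ltr_distlC; lra.
apply/cvgrPdist_lt => e e0; have [d d0 Hd] := H e e0.
exists d => //= u; rewrite /ball_ /= ltr_distlC => /andP[_ ud] su.
by rewrite distrC; exact: Hd.
Qed.

Lemma cvg_leftP x s (l : R) : x @ s^'- --> l <->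
  forall e, 0 < e -> exists2 d, 0 < d & forall u, s - d < u -> u < s -> `|x u - l| < e.
Proof.
split=> [/cvgrPdist_lt H e e0|H].
  have [d /= d0 Hd] := H e e0; exists d => // u su ud.
  by rewrite distrC; apply: Hd => //=; rewrite ltr_distlC; lra.
apply/cvgrPdist_lt => e e0; have [d d0 Hd] := H e e0.
exists d => //= u; rewrite /ball_ /= ltr_distlC => /andP[ud _] su.
by rewrite distrC; exact: Hd.
Qed.

Lemma cadlag_rcont x : cadlag x -> rcont x.
Proof. by move=> [H _] s s0 e e0; have /cvg_rightP := H s s0; exact. Qed.

Lemma cadlag_left_lim x : cadlag x -> left_lim x (lleft x).
Proof.
move=> [_ H]; split; first by rewrite /lleft lexx.
move=> t t0 e e0; have [l Hl] := H t t0.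
have -> : lleft x t = l by rewrite /lleft leNgt t0 /=; apply: (cvg_lim (@norm_hausdorff _ _)).
move/cvg_leftP : Hl => /(_ e e0)[d d0 Hd]; exists d => // u _; exact: Hd.
Qed.

(** Being controlled gives the Cauchy criterion on the left of t, hence left limits. *)
Lemma controlled_cadlag x : rcont x ->
  (forall T, 0 < T -> exists w A b, [/\ control w, 0 <= A, 0 < b & controlled x A w b T]) ->
  cadlag x.
Proof.
move=> rx H; split=> [t t0|t t0]; first by apply/cvg_rightP; exact: rx.
have [w [A [b [cw A0 b0 xw]]]] := H t t0.
have : cauchy (x @ t^'-).
  apply: cauchy_exP => e e0.
  have [d d0 Hd] := controlled_left cw A0 b0 xw t0 (lexx t) e0.
  pose d' := Num.min d t.
  have d'0 : 0 < d' by rewrite lt_min d0.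
  have d'd : d' <= d by rewrite ge_min lexx.
  have d't : d' <= t by rewrite ge_min lexx orbT.
  exists (x (t - d' / 2)); exists d' => //= u; rewrite /ball_ /= ltr_distlC => /andP[du _] ut.
  rewrite /= -ball_normE /= distrC; apply: Hd; lra.
by move/cauchy_cvg => /cvg_ex[l Hl]; exists l.
Qed.

Lemma left_limB x xl y yl : left_lim x xl -> left_lim y yl ->
  left_lim (fun t => x t - y t) (fun t => xl t - yl t).
Proof.
move=> [x0 Hx] [y0 Hy]; split; first by rewrite x0 y0.
move=> t t0 e e0; have e20 : 0 < e / 2 by rewrite divr_gt0.
have [d d0 Hd] := Hx t t0 _ e20; have [d' d'0 Hd'] := Hy t t0 _ e20.
exists (Num.min d d') => [|u u0 du ut]; first by rewrite lt_min d0.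
have du' : t < u + Num.min d d' by rewrite -ltrBlDr.
have [d1 d2] := lt_add_min _ _ _ _ du'.
have h1 : `|x u - xl t| < e / 2 by apply: Hd; rewrite // ltrBlDr.
have h2 : `|y u - yl t| < e / 2 by apply: Hd'; rewrite // ltrBlDr.
have -> : x u - y u - (xl t - yl t) = (x u - xl t) - (y u - yl t) by ring.
by apply: (le_lt_trans (ler_normB _ _)); lra.
Qed.

Lemma left_lim_approx x xl T t e : left_lim x xl -> 0 < T -> 0 <= t -> t < T -> 0 < e ->
  exists u, [/\ 0 <= u, u < T, u <= t & `|x u - xl t| < e].
Proof.
move=> [x0 Hx] T0 t0 tT e0.
have [->|tn] := eqVneq t 0; first by exists 0; split; rewrite ?x0 ?subrr ?normr0.
have tp : 0 < t by rewrite lt_neqAle eq_sym tn.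
have [d d0 Hd] := Hx t tp e e0.
pose d' := Num.min d t.
have d'0 : 0 < d' by rewrite lt_min d0.
have d'd : d' <= d by rewrite ge_min lexx.
have d't : d' <= t by rewrite ge_min lexx orbT.
exists (t - d' / 2); split; [lra|lra|lra|apply: Hd; lra].
Qed.

Lemma left_lim_zero x xl T : left_lim x xl -> 0 < T ->
  (forall t, 0 <= t -> t < T -> x t = 0) -> forall t, 0 <= t -> t < T -> xl t = 0.
Proof.
move=> lx T0 H t t0 tT; apply/eqP; rewrite -normr_le0; apply/ler_addgt0Pl => e e0.
have [u [u0 uT _]] := left_lim_approx x xl T t e lx T0 t0 tT e0.
by rewrite H // sub0r normrN addr0 => /ltW.
Qed.

Lemma left_lim_ext x xl y yl T : left_lim x xl -> left_lim y yl -> 0 < T ->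
  (forall t, 0 <= t -> t < T -> x t = y t) -> forall t, 0 <= t -> t < T -> xl t = yl t.
Proof.
move=> lx ly T0 xy t t0 tT; apply/eqP; rewrite -subr_eq0; apply/eqP.
apply: (left_lim_zero _ (fun t => xl t - yl t) T (left_limB _ _ _ _ lx ly)) => //.
by move=> r r0 rT; rewrite xy // subrr.
Qed.

(** The left limits are pointwise limits of the path delayed by 1/(k+1), and a delay does not
    increase the variation. *)
Lemma left_lim_pvb p x xl T M : 0 < p -> left_lim x xl -> pvb p x 0 T M ->
  pvb p xl 0 T M.
Proof.
move=> p0 [x0 Hx] H.
apply: (pvb_lim p (fun k => x \o (fun a => Num.max 0 (a - k.+1%:R^-1)))) => //.
  move=> k; have k0 : 0 < k.+1%:R^-1 :> R by rewrite invr_gt0 ltr0n.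
  apply: (pvb_time _ _ _ _ _ 0 T) => //.
  - by move=> a b _ ab _; rewrite ge_max !le_max lexx /= lerD2r ab orbT.
  - move=> a a0 aT; rewrite le_max lexx /= ge_max (le_trans a0 aT) /=.
    by apply: le_trans aT; rewrite gerBl ltW.
move=> a a0 aT d d0 /=.
have [->|an] := eqVneq a 0.
  by exists 0%N => k _; rewrite max_l ?x0 ?subrr ?normr0 // sub0r oppr_le0 invr_ge0.
have ap : 0 < a by rewrite lt_neqAle eq_sym an.
have [d' d'0 Hd'] := Hx a ap d d0.
have [K HK] := inv_small _ d'0; exists K => k Kk.
have k0 : 0 < k.+1%:R^-1 :> R by rewrite invr_gt0 ltr0n.
have h := HK k Kk.
apply: Hd'; first by rewrite le_max lexx.
- by rewrite lt_max ltrD2l ltrN2 h orbT.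
- by rewrite gt_max ap /= gtrBl.
Qed.

Lemma pvfin_lleft p x : 0 < p -> cadlag x -> pvfin p x -> pvfin p (lleft x).
Proof.
move=> p0 /cadlag_left_lim lx fx T; have [M H] := fx T; exists M.
exact: left_lim_pvb lx H.
Qed.

Lemma pvfin_cadlag p x : 0 < p -> rcont x -> pvfin p x -> cadlag x.
Proof.
move=> p0 rx fx; apply: controlled_cadlag => // T T0.
exists (pv p x), 1, p^-1; split => //; [exact: pv_control|by rewrite invr_gt0|exact: pv_controlled].
Qed.

(** A general control may keep positive mass on every interval starting at s; this excludes it, and
    holds for the variation of right-continuous paths. *)
Definition right_small (w : R -> R -> R) := forall s, 0 <= s -> forall e, 0 < e ->
  exists2 d, 0 < d & forall t, s <= t -> t < s + d -> w s t <= e.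

Lemma pv_right_small0 p y : 0 < p -> pvfin p y -> rcont y -> right_small (pv p y).
Proof.
by move=> p0 fy ry s s0 e e0; apply: pv_right_small => //; exact: rcont_right_cont.
Qed.

Lemma controlled_rcont q x (w : R -> R -> R) : 0 < q -> control w -> right_small w ->
  (forall T, 0 <= T -> exists2 A, 0 <= A & controlled x A w q^-1 T) -> rcont x.
Proof.
move=> q0 cw rw H s s0 e e0.
have s10 : 0 <= s + 1 by lra.
have [A A0 xA] := H (s + 1) s10.
have A1 : 0 < A + 1 by lra.
have q1 : 0 < q^-1 by rewrite invr_gt0.
have [d d0 Hd] := powR_small q^-1 (e / (A + 1)) q1 (divr_gt0 e0 A1).
have d20 : 0 < d / 2 by rewrite divr_gt0.
have [d' d'0 Hd'] := rw s s0 (d / 2) d20.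
exists (Num.min 1 d') => [|u su ud]; first by rewrite lt_min d'0 ltr01.
have [/ltW u1 ud'] := lt_add_min _ _ _ _ ud.
apply: (le_lt_trans (xA s u s0 (ltW su) u1)).
have pd : w s u < d by have := Hd' u (ltW su) ud' => h; lraof h d0.
have := Hd _ (cw.1 s u s0 (ltW su)) pd; rewrite ltr_pdivlMr // => h.
have := powR_ge0 (w s u) q^-1 => h'; lraof h h'.
Qed.

Lemma controlled_pvb q x (w : R -> R -> R) A sg T : 0 < q -> control w -> 0 <= A ->
  0 <= sg -> (forall s t, sg <= s -> s <= t -> t <= T -> `|x t - x s| <= A * w s t `^ q^-1) ->
  pvb q x sg T (A `^ q * w sg T).
Proof.
move=> q0 cw A0 sg0 xA.
apply: (pvb_control _ _ (fun s t => A `^ q * w s t)) => //.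
  by apply: controlZ => //; exact: powR_ge0.
move=> a b a0 ab bT; have a0' := le_trans sg0 a0.
rewrite -(powRK _ _ q0 (cw.1 a b a0' ab)) -powRM ?powR_ge0 //.
by apply: powR_le; [exact: ltW|exact: normr_ge0|exact: xA].
Qed.

(** A path that vanishes up to sg is unchanged if the time before sg is frozen, so only the mass of
    w after sg counts. This is the source of the small factor in the contraction. *)
Lemma controlled_pvb_zero q x (w : R -> R -> R) A sg T : 0 < q -> control w -> 0 <= A ->
  0 <= sg -> sg <= T ->
  (forall s t, sg <= s -> s <= t -> t <= T -> `|x t - x s| <= A * w s t `^ q^-1) ->
  (forall t, 0 <= t -> t <= sg -> x t = 0) -> pvb q x 0 T (A `^ q * w sg T).
Proof.
move=> q0 cw A0 sg0 sgT xA x0; have H := controlled_pvb _ _ _ _ _ _ q0 cw A0 sg0 xA.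
have H' : pvb q (x \o Num.max sg) 0 T (A `^ q * w sg T).
  apply: (pvb_time _ _ _ _ _ sg T) H.
  - by move=> a b _ ab _; rewrite ge_max !le_max lexx ab orbT.
  - by move=> a _ aT; rewrite le_max lexx ge_max sgT.
apply: pvb_ext H' => r r0 _ /=; case: (leP sg r) => // /ltW rs.
by rewrite !x0.
Qed.

Lemma right_smallD (w w' : R -> R -> R) : right_small w -> right_small w' ->
  right_small (fun s t => w s t + w' s t).
Proof.
move=> hw hw' s s0 e e0; have e20 : 0 < e / 2 by rewrite divr_gt0.
have [d d0 Hd] := hw s s0 _ e20; have [d' d'0 Hd'] := hw' s s0 _ e20.
exists (Num.min d d') => [|t st td]; first by rewrite lt_min d0.
have [td1 td2] := lt_add_min _ _ _ _ td.
by have := Hd t st td1; have := Hd' t st td2 => h1 h2; lraof h1 h2.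
Qed.

Lemma right_small_sum (I : finType) (w : I -> R -> R -> R) : (forall i, right_small (w i)) ->
  right_small (fun s t => \sum_i w i s t).
Proof.
move=> hw s s0 e e0.
suff : forall (r : seq I) e, 0 < e -> exists2 d, 0 < d & forall t, s <= t -> t < s + d ->
  \sum_(i <- r) w i s t <= e by move=> /(_ (index_enum I) e e0).
elim=> [|i r IH] e' e'0; first by exists 1 => // t _ _; rewrite big_nil ltW.
have e20 : 0 < e' / 2 by rewrite divr_gt0.
have [d d0 Hd] := hw i s s0 _ e20; have [d' d'0 Hd'] := IH _ e20.
exists (Num.min d d') => [|t st td]; first by rewrite lt_min d0.
rewrite big_cons; have [td1 td2] := lt_add_min _ _ _ _ td.
by have := Hd t st td1; have := Hd' t st td2 => h1 h2; lraof h1 h2.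
Qed.

Lemma rcont_local x : (forall s, 0 <= s -> exists v y, [/\ s < v, rcont y &
    forall u, s <= u -> u <= v -> x u = y u]) -> rcont x.
Proof.
move=> H s s0 e e0; have [v [y [sv ry xy]]] := H s s0; have [r r0 Hr] := ry s s0 e e0.
exists (Num.min r (v - s)) => [|u su ur]; first by rewrite lt_min r0 subr_gt0.
have [ur' uv] := lt_add_min _ _ _ _ ur; rewrite addrC subrK in uv.
by rewrite !xy ?lexx ?(ltW su) ?(ltW sv) ?(ltW uv) //; exact: Hr.
Qed.

Lemma rcont_cst (c : R) : rcont (fun=> c).
Proof. by move=> s s0 e e0; exists 1 => // u _ _; rewrite subrr normr0. Qed.

End Cadlag.

(** * The integral as a function of its upper limit *)

Section RSIntegral.
Context {R : realType}.
Implicit Types (h y : R -> R).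

(** The default value is 0 where no integral exists; every estimate below assumes existence
    explicitly. *)
Definition RSint h y (t : R) : R := xget 0 [set I | lRS h y t I].

Lemma RSintP h y t : (exists I, lRS h y t I) -> lRS h y t (RSint h y t).
Proof. by move=> [I HI]; rewrite /RSint; case: xgetP => // H; case: (H I). Qed.

Lemma RSint_eq h y t I : 0 <= t -> lRS h y t I -> RSint h y t = I.
Proof.
move=> t0 HI; apply: (RS_unique _ _ _ _ _ _ _ _ _ _ t0 _ HI).
by apply: RSintP; exists I.
Qed.

Lemma RSint_ext h h' y t : 0 <= t -> (exists I, lRS h y t I) ->
  (forall s, 0 <= s -> s < t -> h s = h' s) -> RSint h y t = RSint h' y t.
Proof.
move=> t0 ex hh; apply/esym/RSint_eq => //.
by apply: (lRS_ext h) => //; exact: RSintP.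
Qed.

Lemma RSintB h h' y t : 0 <= t -> (exists I, lRS h y t I) -> (exists I, lRS h' y t I) ->
  RSint h y t - RSint h' y t = RSint (fun s => h s - h' s) y t.
Proof.
by move=> t0 e e'; apply/esym/RSint_eq => //; apply: lRSB; exact: RSintP.
Qed.

Lemma RS_exists w1 (h y : R -> R) q T A b1 : 1 <= q -> pvfin q y -> rcont y ->
  control w1 -> 0 <= A -> 0 < b1 -> 1 < b1 + q^-1 -> 0 <= T ->
  controlled h A w1 b1 (T + 1) -> exists I, lRS h y T I.
Proof.
move=> q1 fy ry cw1 A0 b10 b12 T0 hw.
have q0 : 0 < q by lra.
have cy := pv_control _ _ fy.
(* [young_exists] wants one control for both functions; the sum dominates each of the two. *)
apply: (young_exists (fun s t => w1 s t + pv q y s t) h y T A 1 b1 q^-1) => //.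
- exact: controlD.
- by rewrite invr_gt0.
- move=> s t s0 st tT; apply: (le_trans (hw s t s0 st tT)).
  apply: ler_wpM2l => //; apply: powR_le; [exact: ltW|exact: cw1.1|].
  by rewrite lerDl pv_ge0.
- move=> s t s0 st tT; apply: (le_trans (pv_controlled _ _ _ q0 fy s t s0 st tT)).
  apply: ler_wpM2l => //; apply: powR_le; [by rewrite invr_ge0 ltW|exact: pv_ge0|].
  by rewrite lerDr cw1.1.
- exact: rcont_right_cont.
Qed.

Lemma RSint_young w1 (h y : R -> R) q T A b1 s t : 1 <= q -> pvfin q y ->
  control w1 -> 0 <= A -> 0 < b1 -> 1 < b1 + q^-1 ->
  controlled h A w1 b1 T -> 0 <= s -> s <= t -> t <= T ->
  (exists I, lRS h y s I) -> (exists I, lRS h y t I) ->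
  `|RSint h y t - RSint h y s - h s * (y t - y s)| <=
     young_const (b1 + q^-1) * 2 `^ (b1 + q^-1) * A * w1 s t `^ b1 * pv q y s t `^ q^-1.
Proof.
move=> q1 fy cw1 A0 b10 b12 hw s0 st tT es et.
have q0 : 0 < q by lra.
apply: (lRS_increment h y s t) => //; [exact: RSintP|exact: RSintP|].
move=> n u ndu u0 un; rewrite -u0 -un.
apply: chain_young2 => //.
- exact: pv_control.
- by rewrite invr_gt0.
- by move=> a b a0 ab bt; apply: hw => //; rewrite un in bt; exact: le_trans tT.
- exact: pv_controlled.
- by rewrite u0.
Qed.

Lemma RSint_bound w1 (h y : R -> R) q T A b1 s t B W : 1 <= q -> pvfin q y ->
  control w1 -> 0 <= A -> 0 < b1 -> 1 < b1 + q^-1 ->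
  controlled h A w1 b1 T -> 0 <= s -> s <= t -> t <= T ->
  (exists I, lRS h y s I) -> (exists I, lRS h y t I) -> `|h s| <= B -> w1 s t `^ b1 <= W ->
  `|RSint h y t - RSint h y s| <=
     (young_const (b1 + q^-1) * 2 `^ (b1 + q^-1) * A * W + B) * pv q y s t `^ q^-1.
Proof.
move=> q1 fy cw1 A0 b10 b12 hw s0 st tT es et hB wW; have q0 : 0 < q by lra.
rewrite -(subrK (h s * (y t - y s)) (_ - _)) mulrDl; apply: (le_trans (ler_normD _ _)).
apply: lerD.
  apply: (le_trans (RSint_young w1 h y q T A b1 s t q1 fy cw1 A0 b10 b12 hw s0 st tT es et)).
  apply: ler_wpM2r; first exact: powR_ge0.
  apply: ler_wpM2l wW; apply: mulr_ge0 => //.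
  by apply: mulr_ge0; [rewrite ltW // young_const_gt0|exact: powR_ge0].
rewrite normrM; apply: ler_pM => //.
by rewrite -[leRHS]mul1r; exact: (pv_controlled _ _ t q0 fy).
Qed.

Lemma RSint_crude (h y : R -> R) M s t : pvfin 1 y -> 0 <= s -> s <= t -> 0 <= M ->
  (forall r, s <= r -> r < t -> `|h r| <= M) ->
  (exists I, lRS h y s I) -> (exists I, lRS h y t I) ->
  `|RSint h y t - RSint h y s| <= M * pv 1 y s t.
Proof.
move=> fy s0 st M0 hM es et; rewrite -[X in `|X|]subr0.
apply: (lRS_increment h y s t) => //; [exact: RSintP|exact: RSintP|].
move=> n u ndu u0 un; rewrite subr0 /rsum.
apply: (le_trans (ler_norm_sum _ _ _)).
have us : s <= u 0%N by rewrite u0.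
have ut : u n <= t by rewrite un.
have := pvfin_pvb _ _ s t fy s0 n u ndu us ut; move=> /(ler_wpM2l M0).
apply: le_trans; rewrite /pvsum big_distrr /= big_mkord; apply: ler_sum => i _.
rewrite normrM powRr1 //.
(* A degenerate step contributes nothing; otherwise its left node lies before t, where h is
   bounded. *)
have [->|ne] := eqVneq (u i.+1) (u i); first by rewrite subrr normr0 !mulr0.
apply: ler_wpM2r => //; apply: hM; first by rewrite -u0 ndu.
apply: (@lt_le_trans _ _ (u i.+1)); first by rewrite lt_neqAle eq_sym ne ndu.
by rewrite -un ndu.
Qed.

End RSIntegral.

(** * Running maxima *)

Section RunningMax.
Context {R : realType}.
Implicit Types (u v w : R -> R) (s t T M e : R) (F : seq R).

Definition bounded_on u := forall T, exists M, forall s, 0 <= s -> s <= T -> `|u s| <= M.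

Lemma cadlag_bounded u : cadlag u -> bounded_on u.
Proof.
move=> cu T.
have ru := cadlag_rcont _ cu; have [_ lu] := cadlag_left_lim _ cu.
have [T0|T0] := ltP 0 T; last first.
  by exists `|u 0| => s s0 sT; have -> : s = 0 by apply/eqP; rewrite eq_le s0 (le_trans sT T0).
pose P s t := exists M, forall r, s <= r -> r <= t -> `|u r| <= M.
have [M HM] : P 0 T; last by exists M.
apply: (interval_induction P) => //.
- move=> r s t _ rs st [M1 H1] [M2 H2]; exists (Num.max M1 M2) => a ra a_t.
  rewrite le_max; have [as_|sa] := leP a s; first by rewrite H1.
  by rewrite H2 ?orbT // ltW.
- move=> s s0; have [d d0 Hd] := ru s s0 1 ltr01; exists d => // t st td.
  exists (`|u s| + 1) => r sr rt.
  have [->|ne] := eqVneq r s; first by rewrite lerDl.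
  have h : `|u r - u s| < 1 by apply: Hd; [rewrite lt_neqAle eq_sym ne|exact: le_lt_trans td].
  have -> : u r = u s + (u r - u s) by rewrite addrC subrK.
  by apply: (le_trans (ler_normD _ _)); rewrite lerD2l ltW.
- move=> t t0; have [d d0 Hd] := lu t t0 1 ltr01; exists d => // s s0 ts st.
  exists (`|u t| + (`|lleft u t| + 1)) => r sr rt.
  have [->|ne] := eqVneq r t; first by rewrite lerDl addr_ge0.
  have h : `|u r - lleft u t| < 1.
    apply: Hd; [exact: le_trans sr|exact: lt_le_trans sr|by rewrite lt_neqAle ne].
  have -> : u r = lleft u t + (u r - lleft u t) by rewrite addrC subrK.
  apply: (le_trans (ler_normD _ _)); apply: (@le_trans _ _ (`|lleft u t| + 1)).
    by rewrite lerD2l ltW.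
  by rewrite lerDr.
Qed.

Lemma bounded_onB u v : bounded_on u -> bounded_on v -> bounded_on (fun t => u t - v t).
Proof.
move=> hu hv T; have [M HM] := hu T; have [N HN] := hv T; exists (M + N) => s s0 sT.
by apply: (le_trans (ler_normB _ _)); apply: lerD; [exact: HM|exact: HN].
Qed.

(** The element 0 builds the positive part into the supremum. *)
Definition rmax u t := sup [set r | r = 0 \/ exists s, [/\ 0 <= s, s <= t & r = u s]].

Section Basic.
Variable u : R -> R.
Hypothesis bu : bounded_on u.

Lemma rmax_has_sup t : has_sup [set r | r = 0 \/ exists s, [/\ 0 <= s, s <= t & r = u s]].
Proof.
split; first by exists 0; left.
have [M HM] := bu t; exists (Num.max 0 M) => _ [->|[s [s0 st ->]]].
  by rewrite le_max lexx.
by rewrite le_max (le_trans (ler_norm _) (HM s s0 st)) orbT.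
Qed.

Lemma rmax_ge0 t : 0 <= rmax u t.
Proof. by apply: sup_upper_bound; [exact: rmax_has_sup|left]. Qed.

Lemma rmax_ge s t : 0 <= s -> s <= t -> u s <= rmax u t.
Proof. by move=> s0 st; apply: sup_upper_bound; [exact: rmax_has_sup|right; exists s]. Qed.

Lemma rmax_le t c : 0 <= c -> (forall s, 0 <= s -> s <= t -> u s <= c) -> rmax u t <= c.
Proof.
move=> c0 H; apply: ge_sup; first by exists 0; left.
by move=> _ [->//|[s [s0 st ->]]]; exact: H.
Qed.

Lemma rmax_mono s t : s <= t -> rmax u s <= rmax u t.
Proof.
move=> st; apply: rmax_le; first exact: rmax_ge0.
by move=> r r0 rs; apply: rmax_ge => //; exact: le_trans st.
Qed.

Lemma rmax_split s t c : rmax u s <= c ->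
  (forall r, s < r -> r <= t -> u r <= c) -> rmax u t <= c.
Proof.
move=> sc H; apply: rmax_le; first exact: le_trans (rmax_ge0 s) sc.
move=> r r0 rt; have [rs|sr] := leP r s; last exact: H.
by apply: le_trans sc; exact: rmax_ge.
Qed.

Lemma rmax_approx t e : 0 < e -> rmax u t <= e \/
  exists s, [/\ 0 <= s, s <= t & rmax u t - e <= u s].
Proof.
move=> e0; have [r [->|[s [s0 st ->]]] H] := sup_adherent e0 (rmax_has_sup t).
  by left; rewrite -subr_le0 ltW.
by right; exists s; split => //; exact: ltW.
Qed.

Lemma rmax_control : control (fun s t => rmax u t - rmax u s).
Proof.
split=> [s t _ st|r s t _ _ _]; first by rewrite subr_ge0 rmax_mono.
by rewrite addrC addrA subrK.
Qed.

Lemma rmax_rcont : rcont u -> rcont (rmax u).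
Proof.
move=> ru s s0 e e0; have e20 : 0 < e / 2 by rewrite divr_gt0.
have [d d0 Hd] := ru s s0 _ e20; exists d => // t st td.
rewrite ger0_norm ?subr_ge0 ?rmax_mono ?(ltW st) //.
suff : rmax u t <= rmax u s + e / 2 by lra.
apply: (rmax_split s); first by rewrite lerDl ltW.
move=> r sr rt; have := Hd r sr (le_lt_trans rt td); rewrite ltr_distl => /andP[_].
by have := rmax_ge s s s0 (lexx _); lra.
Qed.

(** For a monotone path the p-th power of the increment is superadditive, hence a control dominating
    every chain sum. *)
Lemma rmax_pvfin p : 1 <= p -> pvfin p (rmax u).
Proof.
move=> p1 T; exists ((rmax u T - rmax u 0) `^ p).
apply: (pvb_control _ _ (fun s t => (rmax u t - rmax u s) `^ p)) => //.
  exact: (control_powR p _ p1 rmax_control).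
by move=> a b _ ab _; rewrite ger0_norm // subr_ge0 rmax_mono.
Qed.

Lemma rmax_cadlag : rcont u -> cadlag (rmax u).
Proof.
by move=> ru; apply: (pvfin_cadlag 1); [|exact: rmax_rcont|exact: rmax_pvfin].
Qed.

Lemma rmax0 : u 0 <= 0 -> rmax u 0 = 0.
Proof.
move=> u0; apply/eqP; rewrite eq_le rmax_ge0 andbT; apply: rmax_le => // s s0 s0'.
by have -> : s = 0 by apply/eqP; rewrite eq_le s0 s0'.
Qed.

End Basic.

Lemma rmax_ext u v t : (forall s, 0 <= s -> s <= t -> u s = v s) -> rmax u t = rmax v t.
Proof.
move=> uv; rewrite /rmax; congr sup; apply/seteqP; split=> r /= [->|[s [s0 st ->]]];
  by [left|right; exists s; split => //; rewrite uv].
Qed.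

(** Over finitely many times the maximum is attained, which the comparison of two running maxima
    exploits; [rmax] is then approximated by such maxima. *)
Definition fmax F u t := \big[Num.max/0]_(s <- F | s <= t) u s.

Lemma fmax_ge0 F u t : 0 <= fmax F u t.
Proof.
by rewrite /fmax; elim/big_rec: _ => // s x _ x0; rewrite le_max x0 orbT.
Qed.

Lemma fmax_ge F u s t : s \in F -> s <= t -> u s <= fmax F u t.
Proof.
move=> sF st; rewrite /fmax; elim: F sF => // a F IH.
rewrite inE big_cons => /orP[/eqP <-|/IH H]; first by rewrite st le_max lexx.
by case: ifP => // _; rewrite le_max H orbT.
Qed.

Lemma fmax_attained F u t : fmax F u t = 0 \/
  exists s, [/\ s \in F, s <= t & fmax F u t = u s].
Proof.
rewrite /fmax; elim: F => [|a F IH]; first by left; rewrite big_nil.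
rewrite big_cons; case: ifP => at_.
  rewrite maxEle; case: ifP => _.
    case: IH => [->|[s [sF st ->]]]; first by left.
    by right; exists s; split => //; rewrite inE sF orbT.
  by right; exists a; rewrite inE eqxx.
case: IH => [->|[s [sF st ->]]]; first by left.
by right; exists s; split => //; rewrite inE sF orbT.
Qed.

Lemma fmax_le F u t c : 0 <= c -> (forall s, s \in F -> s <= t -> u s <= c) -> fmax F u t <= c.
Proof. by move=> c0 H; case: (fmax_attained F u t) => [->//|[s [sF st ->]]]; exact: H. Qed.

Lemma fmax_mono F u s t : s <= t -> fmax F u s <= fmax F u t.
Proof.
move=> st; apply: fmax_le; first exact: fmax_ge0.
by move=> r rF rs; apply: fmax_ge => //; exact: le_trans st.
Qed.

(* The difference of two running maxima can only increase while the first one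
   increases, i.e. at a time when the first maximum is attained, and there the
   difference of the functions is even larger. *)
Lemma fmax_up F u v s t : s <= t ->
  fmax F u s - fmax F v s < fmax F u t - fmax F v t ->
  exists r, [/\ s <= r, r <= t, r \in F & fmax F u t - fmax F v t <= u r - v r].
Proof.
move=> st H; have mv := fmax_mono F v s t st.
have Hu : fmax F u s < fmax F u t by lra.
case: (fmax_attained F u t) => [E|[r [rF rt E]]].
  by move: Hu; rewrite E ltNge fmax_ge0.
exists r; split => //; last by rewrite E lerD2l lerN2 fmax_ge.
rewrite leNgt; apply/negP => /ltW rs.
by have := fmax_ge F u r s rF rs; rewrite -E leNgt Hu.
Qed.

End RunningMax.

(** * Comparison of variations when one path overtakes every move of another *)

Section Alternating.
Context {R : realType}.
Implicit Types (E d : R -> R).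

(* [e] is the value of E at the last node of a chain of E that has swallowed all
   the completed monotone runs of d; the current run of d goes from e to the
   current value x, and is overtaken by the value of E at a later time. *)
Definition pending p (E : R -> R) (t S x : R) := exists k v sg,
  [/\ nd v, 0 <= v 0%N, v k <= sg, sg <= t &
  S <= pvsum p E v k + `|x - E (v k)| `^ p /\
  ((E (v k) <= x /\ x <= E sg) \/ (E sg <= x /\ x <= E (v k)))].

Lemma pvsumN p (E : R -> R) v k : pvsum p (fun r => - E r) v k = pvsum p E v k.
Proof. by apply: eq_bigr => i _; rewrite -opprD normrN. Qed.

Lemma pendingN p (E : R -> R) t S x : pending p (fun r => - E r) t S (- x) -> pending p E t S x.
Proof.
move=> [k [v [sg [ndv v0 vs st [HS H]]]]]; exists k, v, sg; split => //.
by move: HS H; rewrite pvsumN -opprD normrN !lerN2 => HS [[]|[]] ? ?; split => //; [right|left].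
Qed.

Lemma snoc_chain p (E : R -> R) v k sg : nd v -> v k <= sg ->
  exists v', [/\ nd v', v' 0%N = v 0%N, v' k.+1 = sg &
   pvsum p E v' k.+1 = pvsum p E v k + `|E sg - E (v k)| `^ p].
Proof.
move=> ndv vs; exists (fun i => if (i <= k)%N then v i else sg); split.
- apply: ndS => i; case: ifP => [ik|/negbT]; last first.
    by rewrite -ltnNge => ki; rewrite leqNgt ltnS (ltnW ki).
  by case: ifP => _; [exact: ndv|exact: le_trans (ndv _ _ ik) vs].
- by [].
- by rewrite ltnn.
- rewrite /pvsum big_ord_recr /= leqnn ltnn; congr (_ + _); apply: eq_bigr => i _.
  by rewrite (ltn_ord i) (ltnW (ltn_ord i)).
Qed.

Lemma pending_up p (E : R -> R) s t S x y : 1 <= p -> s <= t -> x <= y ->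
  (exists r, [/\ s <= r, r <= t & y <= E r]) ->
  pending p E s S x -> pending p E t (S + `|y - x| `^ p) y.
Proof.
move=> p1 st xy [r [sr rt yr]] [k [v [sg [ndv v0 vs ss [HS H]]]]].
have p0 : 0 <= p by lra.
(* The current run is upward or empty: the new move prolongs it, and superadditivity of the power
   lets one long move replace two. *)
have [ex|xe] := leP (E (v k)) x.
  exists k, v, r; split => //; first by rewrite (le_trans vs) // (le_trans ss).
  split; last by left; split => //; exact: le_trans ex xy.
  apply: (le_trans (lerD HS (lexx _))); rewrite -addrA lerD2l.
  apply: (le_trans (powR_superadd _ _ _ p1 (normr_ge0 _) (normr_ge0 _))).
  apply: powR_le => //.
  by rewrite !ger0_norm ?subr_ge0 //; [lra|exact: le_trans xy].
(* The current run is downward, and E has meanwhile gone to x or below at sg. Making sg a node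
   closes the run, at least as long for E as for d, and the new upward run starts from E sg <= x. *)
have Es : E sg <= x by case: H => -[] // h; move: xe; rewrite ltNge h.
have [v' [ndv' v'0 v'k Hs]] := snoc_chain p E v k sg ndv vs.
exists k.+1, v', r; split => //.
- by rewrite v'0.
- by rewrite v'k (le_trans ss).
- rewrite Hs v'k; split; last by left; split => //; exact: le_trans xy.
  rewrite -addrA; apply: (le_trans (lerD HS (lexx _))); rewrite -addrA lerD2l.
  apply: lerD; apply: powR_le => //.
    by rewrite distrC !(distrC _ (E (v k))) !ger0_norm ?subr_ge0 //; lra.
  by rewrite !ger0_norm ?subr_ge0 //; [lra|exact: le_trans xy].
Qed.

Lemma pending_step p (E : R -> R) s t S x y : 1 <= p -> s <= t ->
  (x < y -> exists r, [/\ s <= r, r <= t & y <= E r]) ->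
  (y < x -> exists r, [/\ s <= r, r <= t & E r <= y]) ->
  pending p E s S x -> pending p E t (S + `|y - x| `^ p) y.
Proof.
move=> p1 st up down H.
have [xy|yx|xy] := ltgtP x y.
- by apply: (pending_up _ _ s _ _ x) => //; [exact: ltW|exact: up].
- apply: pendingN; have -> : `|y - x| = `|- y - - x| by rewrite -opprD normrN.
  apply: (pending_up _ _ s) => //; first by rewrite lerN2 ltW.
    by have [r [sr rt h]] := down yx; exists r; rewrite lerN2.
  apply: pendingN; move: H; rewrite opprK; congr (pending p _ s S x).
  by apply/funext => r; rewrite opprK.
- rewrite -xy subrr normr0 powR0 ?addr0; last by rewrite gt_eqF //; lra.
  by case: H => k [v [sg [? ? ? ss ?]]]; exists k, v, sg; split => //; exact: le_trans st.
Qed.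

(** Whenever d moves, E reaches at least as far in the same direction within the same time interval.
    The chain for E is built run by run with [pending] as invariant. *)
Lemma alternating p (E d : R -> R) T M n u : 1 <= p -> pvb p E 0 T M -> nd u ->
  u 0%N = 0 -> u n <= T -> d 0 = E 0 ->
  (forall i, (i < n)%N -> d (u i) < d (u i.+1) ->
     exists r, [/\ u i <= r, r <= u i.+1 & d (u i.+1) <= E r]) ->
  (forall i, (i < n)%N -> d (u i.+1) < d (u i) ->
     exists r, [/\ u i <= r, r <= u i.+1 & E r <= d (u i.+1)]) ->
  pvsum p d u n <= M.
Proof.
move=> p1 HM ndu u0 unT d0 up down.
have H i : (i <= n)%N -> pending p E (u i) (pvsum p d u i) (d (u i)).
  elim: i => [_|i IH i_n].
    exists 0%N, (fun=> 0), 0; rewrite u0 d0 /pvsum !big_ord0 subrr add0r.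
    by split => //; split; [exact: powR_ge0|left].
  rewrite /pvsum big_ord_recr /=; apply: (pending_step _ _ (u i)) => //.
  - exact: ndu.
  - exact: up.
  - exact: down.
  - by apply: IH; exact: ltnW.
have [k [v [sg [ndv v0 vs st [HS Hd]]]]] := H n (leqnn n).
(* The last run is still open; the node sg closes it. *)
have [v' [ndv' v'0 v'k Hs]] := snoc_chain p E v k sg ndv vs.
apply: (le_trans HS); have : pvsum p E v' k.+1 <= M.
  apply: HM => //; first by rewrite v'0.
  by rewrite v'k (le_trans st).
apply: le_trans; rewrite Hs lerD2l; apply: powR_le => //; first by lra.
case: Hd => -[h1 h2].
  by rewrite !ger0_norm ?subr_ge0 //; [lra|exact: le_trans h2].
rewrite distrC [leRHS]distrC !ger0_norm ?subr_ge0 //; [lra|exact: le_trans h2].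
Qed.

End Alternating.

(** * Lipschitz property of the running maximum in p-variation *)

Section RunningMaxLipschitz.
Context {R : realType}.
Implicit Types (u v w : R -> R) (s t T M e : R).

(** One near-maximizer is collected for each node. The bound is stated for all larger sets G so that
    one set can serve two functions. *)
Lemma rmax_fmax u (c : nat -> R) n e : bounded_on u -> (forall i, 0 <= c i) -> 0 < e ->
  exists F : seq R, [/\ 0 \in F, forall s, s \in F -> 0 <= s &
    forall i, (i <= n)%N -> forall G : seq R, {subset F <= G} ->
      rmax u (c i) - e <= fmax G u (c i)].
Proof.
move=> bu c0 e0.
have /choice[f Hf] : forall i, exists s, [/\ 0 <= s, s <= c i &
    rmax u (c i) - e <= Num.max 0 (u s)].
  move=> i; have [h|[s [s0 sc h]]] := rmax_approx u bu (c i) e e0.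
    by exists 0; split => //; rewrite le_max subr_le0 h.
  by exists s; split => //; rewrite le_max h orbT.
exists (0 :: [seq f i | i <- iota 0 n.+1]); split.
- by rewrite inE eqxx.
- by move=> s; rewrite inE => /orP[/eqP ->//|/mapP[i _ ->]]; case: (Hf i).
move=> i i_n G FG; have [f0 fc h] := Hf i; apply: (le_trans h).
rewrite ge_max fmax_ge0 /=; apply: fmax_ge => //; apply: FG.
by rewrite inE; apply/orP; right; apply: map_f; rewrite mem_iota.
Qed.

Lemma fmax_rmax u F t : bounded_on u -> (forall s, s \in F -> 0 <= s) -> fmax F u t <= rmax u t.
Proof.
move=> bu F0; apply: fmax_le; first exact: rmax_ge0.
by move=> s sF st; apply: rmax_ge => //; exact: F0.
Qed.

(** Both maxima are replaced by maxima over one common finite set of times. There [fmax_up], used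
    for (u,v) and for (v,u), provides the upward and downward conditions of [alternating] with E = u
    - v. *)
Lemma rmax_lipschitz p u v T M : 1 <= p -> bounded_on u -> bounded_on v ->
  u 0 = v 0 -> u 0 <= 0 -> pvb p (fun t => u t - v t) 0 T M ->
  pvb p (fun t => rmax u t - rmax v t) 0 T M.
Proof.
move=> p1 bu bv uv u0 HM; have p0 : 0 < p by lra.
apply: pvb_approx => // n c ndc c0 cT e e0.
have c0' i : 0 <= c i by apply: le_trans c0 (ndc _ _ _).
have e20 : 0 < e / 2 by rewrite divr_gt0.
have [F1 [F10 F1p HF1]] := rmax_fmax u c n (e / 2) bu c0' e20.
have [F2 [F20 F2p HF2]] := rmax_fmax v c n (e / 2) bv c0' e20.
pose F := F1 ++ F2.
have Fp s : s \in F -> 0 <= s by rewrite mem_cat => /orP[/F1p|/F2p].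
have FF1 : {subset F1 <= F} by move=> s; rewrite mem_cat => ->.
have FF2 : {subset F2 <= F} by move=> s; rewrite mem_cat orbC => ->.
exists (fun t => fmax F u t - fmax F v t); split; last first.
  move=> i i_n; have h1 := HF1 i i_n F FF1; have h2 := HF2 i i_n F FF2.
  have h3 := fmax_rmax u F (c i) bu Fp; have h4 := fmax_rmax v F (c i) bv Fp.
  by rewrite ltr_distl; apply/andP; split; lraof h1 h2 h3 h4 e0.
have f0 w : w 0 <= 0 -> fmax F w 0 = 0.
  move=> w0; apply/eqP; rewrite eq_le fmax_ge0 andbT; apply: fmax_le => // s sF s0.
  by have -> : s = 0 by apply/eqP; rewrite eq_le s0 Fp.
(* The chain is prefixed with time 0, where both differences vanish, since [alternating] needs a
   common starting value. *)
pose c' i := if i is j.+1 then c j else 0.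
have ndc' : nd c' by apply: ndS => -[|i] //=; exact: ndc.
have : pvsum p (fun t => fmax F u t - fmax F v t) c' n.+1 <= M.
  apply: (alternating p (fun t => u t - v t) _ T) => //.
  - by rewrite !f0 -?uv // !subrr.
  - move=> i _ H; have [r [? ? _ ?]] := fmax_up F u v _ _ (ndc' i i.+1 (leqnSn i)) H.
    by exists r.
  - move=> i _ H.
    have [|r [? ? _ h]] := fmax_up F v u _ _ (ndc' i i.+1 (leqnSn i)); first by lra.
    by exists r; split => //; lra.
apply: le_trans; rewrite /pvsum big_ord_recl /= lerDr; exact: powR_ge0.
Qed.

End RunningMaxLipschitz.

(** * The one-dimensional Skorokhod problem *)

Section Skorokhod1.
Context {R : realType}.
Implicit Types (v w k x y l : R -> R) (s t T M e : R).

Definition rRS (h y : R -> R) T I :=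
  is_RS (@right_tag R) (fun a b : R => a * b) h y T I.

(** With v = l - y, k - v is x - l. If k(T) exceeded the running maximum c, then at all nodes where
    k is above the midpoint c' the integrand would be at least c' - c, while k still rises by k(T) -
    c': the sums would stay away from 0. *)
Lemma reflection_rmax v k T : (forall t, 0 <= t -> v t <= k t) -> k 0 = 0 ->
  (forall s t, 0 <= s -> s <= t -> k s <= k t) ->
  0 <= T -> rRS (fun s => k s - v s) k T 0 -> k T = rmax v T.
Proof.
move=> vk k0 mk T0 H.
pose A := [set r | r = 0 \/ exists s, [/\ 0 <= s, s <= T & r = v s]].
have kT0 : 0 <= k T by rewrite -k0 mk.
have ubA : ubound A (k T).
  move=> _ [->//|[s [s0 sT ->]]]; exact: le_trans (vk s s0) (mk s T s0 sT).
have hA : has_sup A by split; [exists 0; left|exists (k T)].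
apply/eqP; rewrite eq_le; apply/andP; split; last by apply: ge_sup; [exact: hA.1|exact: ubA].
rewrite leNgt; apply/negP => lt.
set c := rmax v T in lt; have c0 : 0 <= c by apply: sup_upper_bound => //; left.
pose c' := (c + k T) / 2.
have cc' : c < c' by rewrite /c'; lra.
have c'k : c' < k T by rewrite /c'; lra.
have e0 : 0 < (c' - c) * (k T - c') by rewrite mulr_gt0 // subr_gt0.
have [d d0 Hd] := H _ e0.
have [n [u [ndu u0 un uT um]]] := fine_chain 0 T d T0 d0.
have up i : 0 <= u i by rewrite -u0 ndu.
have dk i : 0 <= k (u i.+1) - k (u i) by rewrite subr_ge0 mk // ndu.
have := Hd n u u0 un (fun i _ => conj (ndu _ _ (leqnSn i)) (um i)).
rewrite subr0 ltNge => /negP; apply.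
have kn : c' < k (u n) by rewrite un.
have [j [_ jn cj jmin]] := first_index (fun i => c' < k (u i)) 0 n (leq0n _) kn.
have j0 : (0 < j)%N.
  by rewrite lt0n; apply/eqP => E; move: cj; rewrite E u0 k0 ltNge (le_trans c0) // ltW.
have p1 : (j.-1.+1 = j)%N by rewrite prednK.
have j1n : (j.-1 <= n)%N by rewrite (leq_trans _ jn) // leq_pred.
have kj1 : k (u j.-1) <= c' by have := jmin j.-1 (leq0n _); rewrite p1 => /(_ (leqnn _)); rewrite -leNgt.
apply: le_trans (ler_norm _); rewrite -(big_mkord predT
  (fun i => (k (right_tag (u i) (u i.+1)) - v (right_tag (u i) (u i.+1))) * (k (u i.+1) - k (u i)))).
(* The cut is one step before the first node j above c', so that the whole rise from at most c' is
   counted. The right tags of these steps are the nodes from j on, where the integrand is large. *)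
rewrite (big_cat_nat (leq0n j.-1) j1n) /=.
rewrite -[leLHS]add0r; apply: lerD.
  by apply: sumr_ge0 => i _; apply: mulr_ge0 => //; rewrite subr_ge0; apply: vk; exact: up.
apply: (@le_trans _ _ (\sum_(j.-1 <= i < n) (c' - c) * (k (u i.+1) - k (u i)))).
  rewrite -big_distrr /= telescope_diff // un; apply: ler_wpM2l; first by rewrite subr_ge0 ltW.
  by rewrite lerD2l lerN2.
apply: ler_sum_nat => i /andP[ji i_n].
apply: ler_wpM2r => //; rewrite /right_tag.
have ki : c' < k (u i.+1).
  by apply: (lt_le_trans cj); apply: mk => //; apply: ndu; rewrite -p1 ltnS.
have vc : v (u i.+1) <= c.
  by apply: sup_upper_bound => //; right; exists (u i.+1); rewrite up uT.
lraof ki vc.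
Qed.

(** The scheme of [cauchy_on] for the integral of k - v against k, with k the running maximum; its
    terms are nonnegative, so an upper bound suffices. *)
Definition flat_on v (eta s t : R) := forall e, 0 < e -> exists2 d, 0 < d &
  forall u m n, fine d s t u m n ->
  \sum_(m <= i < n) (rmax v (u i.+1) - v (u i.+1)) * (rmax v (u i.+1) - rmax v (u i))
    <= e + eta * (rmax v t - rmax v s).

(** If v oscillates by at most eta on [s,t), then a step that raises k ends with k <= v + eta at its
    right node, so its term is at most eta times the increment of k. The step across t is treated
    apart. *)
Lemma flat_on_small v eta s t : bounded_on v -> rcont v -> 0 <= s -> s < t -> 0 < eta ->
  (forall r r', s <= r -> r < t -> s <= r' -> r' < t -> v r <= v r' + eta) ->
  flat_on v eta s t.
Proof.
move=> bv rv s0 st eta0 osc e e0; set k := rmax v.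
have mk a b : a <= b -> k a <= k b by exact: rmax_mono.
have t0 : 0 < t by exact: le_lt_trans st.
have k0 a : 0 <= k a by exact: rmax_ge0.
have [N HN] := bv (t + 1).
pose W := k (t + 1) + `|N|.
have W0 : 0 <= W by rewrite addr_ge0.
have HW a : 0 <= a -> a <= t + 1 -> 0 <= k a - v a <= W.
  move=> a0 a1; rewrite subr_ge0 rmax_ge //=; have h := HN a a0 a1.
  rewrite /W; apply: lerD; first exact: mk.
  by apply: (le_trans (ler_norm _)); rewrite normrN (le_trans h) // ler_norm.
have D0 : 0 < W + 2 * k (t + 1) + 1 by have := k0 (t + 1); lra.
(* W bounds k - v and k(t+1) bounds the increments of k; the two alternatives for the step across t
   cost W e' and 2 k(t+1) e'. *)
pose e' := e / (W + 2 * k (t + 1) + 1).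
have e'0 : 0 < e' by exact: divr_gt0.
have e'E : e' * (W + 2 * k (t + 1) + 1) = e by rewrite /e' mulfVK // gt_eqF.
have [d1 d10 H1] := rv t (ltW t0) e' e'0.
have [d2 d20 H2] := control_left_small _ t e' (rmax_control v bv) t0 e'0.
pose d := Num.min (Num.min d1 d2) (Num.min 1 (t - s)).
have [d0 [dd1 dd2 d_1 dts]] : 0 < d /\ [/\ d <= d1, d <= d2, d <= 1 & d <= t - s].
  by rewrite /d !ge_min !lt_min !lexx ?orbT d10 d20 ltr01 subr_gt0 st.
exists d => // u m n [ndu um mn /andP[sum_ umd] [/andP[tun und] uit]].
have mn' : (m < n)%N.
  by rewrite ltn_neqAle mn andbT; apply/eqP => E; move: umd; rewrite E => h; lraof h dts tun.
have p1 : (n.-1.+1 = n)%N by rewrite prednK // (leq_ltn_trans _ mn').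
have mn1 : (m <= n.-1)%N by rewrite -ltnS p1.
have n1n : (n.-1 < n)%N by rewrite p1.
have sui i : (m <= i)%N -> s <= u i by move=> mi; apply: le_trans sum_ (ndu _ _ mi).
have -> : \sum_(m <= i < n) (k (u i.+1) - v (u i.+1)) * (k (u i.+1) - k (u i)) =
   \sum_(m <= i < n.-1) (k (u i.+1) - v (u i.+1)) * (k (u i.+1) - k (u i)) +
   (k (u n) - v (u n)) * (k (u n) - k (u n.-1)).
  by rewrite -{1}p1 big_nat_recr //= p1.
rewrite addrC; apply: lerD; last first.
  apply: (@le_trans _ _ (\sum_(m <= i < n.-1) eta * (k (u i.+1) - k (u i)))); last first.
    rewrite -big_distrr /= telescope_diff //; apply: ler_wpM2l; first exact: ltW.
    by apply: lerB; apply: mk => //; rewrite ltW // uit.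
  apply: ler_sum_nat => i /andP[mi i_n].
  have i1n : (i.+1 < n)%N by rewrite -p1 ltnS.
  have dk : 0 <= k (u i.+1) - k (u i) by rewrite subr_ge0 mk // ndu.
  have split_ : k (u i.+1) <= Num.max (k (u i)) (v (u i.+1) + eta).
    apply: (rmax_split v bv (u i)); first by rewrite le_max lexx.
    move=> r ur ru; rewrite le_max; apply/orP; right; apply: osc.
    - by apply: le_trans (sui i mi) (ltW ur).
    - by apply: le_lt_trans ru (uit _ i1n).
    - by apply: sui; rewrite leqW.
    - exact: uit.
  move: split_; rewrite le_max => /orP[h|h].
    have -> : k (u i.+1) - k (u i) = 0 by apply/eqP; rewrite eq_le dk andbT subr_le0.
    by rewrite !mulr0.
  by apply: ler_wpM2r => //; rewrite lerBlDl.
set a := u n.-1; set b := u n; rewrite -/b in tun und.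
have at_ : a < t by exact: uit.
have td : t - d < a by have := um n.-1; rewrite p1 -/a -/b => h; lraof h tun.
have a0 : 0 <= a by apply: le_trans s0 (sui _ mn1).
have b0 : 0 <= b by apply: le_trans (ltW t0) tun.
have b1 : b <= t + 1 by lraof und d_1.
have ab : a <= b by exact: le_trans (ltW at_) tun.
have dk : 0 <= k b - k a by rewrite subr_ge0 mk.
have dkle : k b - k a <= k (t + 1) by have := mk _ _ b1; have := k0 a => h h'; lraof h h'.
have /andP[w0 wW] := HW b b0 b1.
have osc_t r : t <= r -> r <= b -> v r <= v b + 2 * e'.
  have near r' : t <= r' -> r' <= b -> `|v r' - v t| <= e'.
    move=> tr rb; have [->|ne] := eqVneq r' t; first by rewrite subrr normr0 ltW.
    apply/ltW/H1; first by rewrite lt_neqAle eq_sym ne.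
    by lraof rb und dd1.
  move=> tr rb; have := near r tr rb; have := near b tun (lexx _).
  by rewrite !ler_distl => /andP[h1 _] /andP[_ h2]; lraof h1 h2.
(* Times before t raise k by at most e', as k has little variation left of t; from t on v is within
   2 e' of v(b), by right continuity. So either the increment of k or the integrand is small. *)
have split_ : k b <= Num.max (k a + e') (v b + 2 * e').
  apply: (rmax_split v bv a); first by rewrite le_max lerDl (ltW e'0).
  move=> r ar rb; rewrite le_max; have [tr|rt] := leP t r; first by rewrite osc_t // orbT.
  apply/orP; left; apply: (@le_trans _ _ (k r)).
    by apply: rmax_ge => //; exact: le_trans a0 (ltW ar).
  have h : t - d2 < a by lraof td dd2.
  by have := H2 a r a0 h (ltW ar) rt; rewrite -/k => h'; lraof h'.
rewrite -e'E; have kt0 := k0 (t + 1).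
have eW := mulr_ge0 (ltW e'0) W0; have ek := mulr_ge0 (ltW e'0) kt0.
move: split_; rewrite le_max => /orP[h|h].
  have : (k b - v b) * (k b - k a) <= W * e' by apply: ler_pM => //; lraof h.
  by move=> h'; lraof h' eW ek e'0.
have : (k b - v b) * (k b - k a) <= (2 * e') * k (t + 1) by apply: ler_pM => //; lraof h.
by move=> h'; lraof h' eW ek e'0.
Qed.

Lemma flat_on_cat v eta r s t : r < s -> s < t ->
  flat_on v eta r s -> flat_on v eta s t -> flat_on v eta r t.
Proof.
move=> rs st Prs Pst e e0.
have e20 : 0 < e / 2 by rewrite divr_gt0.
have [d1 d10 H1] := Prs _ e20; have [d2 d20 H2] := Pst _ e20.
pose d := Num.min (Num.min d1 d2) (s - r).
have [d0 [dd1 dd2 dsr]] : 0 < d /\ [/\ d <= d1, d <= d2 & d <= s - r].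
  by rewrite /d !ge_min !lt_min !lexx ?orbT d10 d20 subr_gt0 rs.
exists d => // u m n fu.
have [j [mj jn fu1 fu2]] := fine_split d r s t u m n rs st dsr fu.
rewrite (big_cat_nat mj jn) /=.
have E1 := H1 _ _ _ (fine_le _ _ _ _ _ _ _ dd1 fu1).
have E2 := H2 _ _ _ (fine_le _ _ _ _ _ _ _ dd2 fu2).
by apply: (le_trans (lerD E1 E2)); lra.
Qed.

(** A càdlàg path oscillates little just after s and just before t, so [flat_on_small] applies on
    either side of every point. *)
Lemma rmax_flat v T : cadlag v -> 0 <= T ->
  rRS (fun s => rmax v s - v s) (rmax v) T 0.
Proof.
move=> cv T0.
have bv := cadlag_bounded _ cv; have rv := cadlag_rcont _ cv.
have [_ lv] := cadlag_left_lim _ cv.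
have flat eta : 0 < eta -> 0 < T -> flat_on v eta 0 T.
  move=> eta0; have eta20 : 0 < eta / 2 by rewrite divr_gt0.
  apply: interval_induction.
  - by move=> r s t _; exact: flat_on_cat.
  - move=> s s0; have [d d0 Hd] := rv s s0 _ eta20; exists d => // t st td.
    apply: flat_on_small => // r r' sr rt sr' rt'.
    have near a : s <= a -> a < t -> `|v a - v s| <= eta / 2.
      move=> sa at_; have [->|ne] := eqVneq a s; first by rewrite subrr normr0 ltW.
      by apply/ltW/Hd; [rewrite lt_neqAle eq_sym ne|exact: lt_trans td].
    have := near r sr rt; have := near r' sr' rt'.
    by rewrite !ler_distl => /andP[h1 _] /andP[_ h2]; lraof h1 h2.
  - move=> t t0; have [d d0 Hd] := lv t t0 _ eta20; exists d => // s s0 ts st.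
    apply: flat_on_small => // r r' sr rt sr' rt'.
    have near a : s <= a -> a < t -> `|v a - lleft v t| <= eta / 2.
      by move=> sa at_; apply/ltW/Hd => //; [exact: le_trans sa|exact: lt_le_trans sa].
    have := near r sr rt; have := near r' sr' rt'.
    by rewrite !ler_distl => /andP[h1 _] /andP[_ h2]; lraof h1 h2.
apply: RS_of_chains => e e0.
have mk := rmax_mono v bv.
have key : exists2 d, 0 < d & forall n u, nd u -> u 0%N = 0 -> u n = T ->
   (forall i, (n <= i)%N -> u i = T) -> (forall i, u i.+1 - u i < d) ->
   \sum_(0 <= i < n) (rmax v (u i.+1) - v (u i.+1)) * (rmax v (u i.+1) - rmax v (u i)) < e.
  have zero u j n : (j <= n)%N -> (forall i, (j <= i)%N -> u i = T) ->
     \sum_(j <= i < n) (rmax v (u i.+1) - v (u i.+1)) * (rmax v (u i.+1) - rmax v (u i)) = 0.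
    move=> jn uT; rewrite big_nat_cond big1 // => i; rewrite andbT => /andP[ji i_n].
    by rewrite !uT ?subrr ?mulr0 // leqW.
  have [T00|Tp] := eqVneq T 0.
    exists 1 => // n u ndu u0 un uT _; rewrite zero // => i _.
    have [/uT//|/ltnW i_n] := leqP n i.
    by apply/eqP; rewrite T00 eq_le -{1}T00 -{1}un -u0 !ndu.
  have T1 : 0 < T by rewrite lt_neqAle eq_sym Tp.
  have k0 : 0 <= rmax v T - rmax v 0 by rewrite subr_ge0 mk.
  pose eta := e / (2 * (rmax v T - rmax v 0 + 1)).
  have eta0 : 0 < eta by apply: divr_gt0 => //; lraof k0.
  have e40 : 0 < e / 4 by rewrite divr_gt0.
  have [d d0 Hd] := flat eta eta0 T1 _ e40; exists d => // n u ndu u0 un uT um.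
  have [j [jn fj ujT]] := fine_first d T n u d0 ndu u0 un uT um.
  rewrite (big_cat_nat (leq0n j) jn) /= (zero u j n jn ujT) addr0.
  apply: (le_lt_trans (Hd _ _ _ fj)).
  have : eta * (rmax v T - rmax v 0) <= e / 2.
    have -> : eta = (e / 2) / (rmax v T - rmax v 0 + 1).
      by rewrite /eta; field; apply/eqP => h; lraof h k0.
    rewrite mulrAC -mulrA ger_pMr ?divr_gt0 // ler_pdivrMr ?mul1r; lraof k0.
  by move=> h; lraof h e0.
have [d d0 Hd] := key; exists d => // n u ndu u0 un uT um.
have up i : 0 <= u i by rewrite -u0 ndu.
rewrite subr0 ger0_norm; last first.
  apply: sumr_ge0 => i _; apply: mulr_ge0; rewrite subr_ge0.
    by apply: rmax_ge => //; exact: up.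
  by apply: mk; exact: ndu.
by have := Hd n u ndu u0 un uT um; rewrite big_mkord.
Qed.

End Skorokhod1.

(** * The l1 norm against the Euclidean and operator norms *)

Section Norms.
Context {R : realType} {d : nat}.
Implicit Types (v w : 'cV[R]_d) (A : 'M[R]_d).

(** The l1 norm fits coordinatewise estimates: it dominates [enorm], which in turn dominates each
    coordinate, so the hypotheses transfer with the constants unchanged. *)
Definition n1 v : R := \sum_i `|v i 0|.

Lemma n1_ge0 v : 0 <= n1 v.
Proof. by apply: sumr_ge0 => i _. Qed.

Lemma sum_ge (I : finType) (F : I -> R) i : (forall j, 0 <= F j) -> F i <= \sum_j F j.
Proof. by move=> F0; rewrite (bigD1 i) //= lerDl sumr_ge0. Qed.

Lemma n1_ge v i : `|v i 0| <= n1 v.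
Proof. by rewrite /n1 (bigD1 i) //= lerDl sumr_ge0. Qed.

Lemma n1_0 : n1 0 = 0.
Proof. by rewrite /n1 big1 // => i _; rewrite mxE normr0. Qed.

Lemma n1D v w : n1 (v + w) <= n1 v + n1 w.
Proof. by rewrite /n1 -big_split; apply: ler_sum => i _; rewrite mxE ler_normD. Qed.

Lemma n1Z c v : n1 (c *: v) = `|c| * n1 v.
Proof. by rewrite /n1 big_distrr; apply: eq_bigr => i _; rewrite mxE normrM. Qed.

Lemma n1_le v c : (forall i, `|v i 0| <= c) -> n1 v <= d%:R * c.
Proof.
move=> H; apply: (@le_trans _ _ (\sum_(i < d) c)); first exact: ler_sum.
by rewrite sumr_const card_ord mulr_natl.
Qed.

Lemma enorm_ge v i : `|v i 0| <= enorm v.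
Proof.
rewrite -sqrtr_sqr; apply: ler_wsqrtr.
by rewrite (bigD1 i) //= lerDl sumr_ge0 // => j _; exact: sqr_ge0.
Qed.

Lemma enormB_ge v w i : `|v i 0 - w i 0| <= enorm (v - w).
Proof. by have := enorm_ge (v - w) i; rewrite !mxE. Qed.

Lemma enorm_le v : enorm v <= n1 v.
Proof.
rewrite -(ger0_norm (n1_ge0 v)) -sqrtr_sqr; apply: ler_wsqrtr.
rewrite expr2 {1}/n1 big_distrl /=; apply: ler_sum => i _.
have -> : v i 0 ^+ 2 = `|v i 0| * `|v i 0| by rewrite -normrM -expr2 ger0_norm ?sqr_ge0.
by apply: ler_wpM2l => //; exact: n1_ge.
Qed.

Lemma enorm_ge0 v : 0 <= enorm v.
Proof. exact: sqrtr_ge0. Qed.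

Lemma opnorm_ge A i j : `|A i j| <= opnorm A.
Proof.
have ej : enorm (delta_mx j 0 : 'cV[R]_d) <= 1.
  apply: (le_trans (enorm_le _)); rewrite /n1 (bigD1 j) //= big1 => [|k kj].
    by rewrite !mxE !eqxx normr1 addr0.
  by rewrite !mxE (negbTE kj) normr0.
apply: (@le_trans _ _ (enorm (A *m delta_mx j 0))).
  have -> : A i j = (A *m delta_mx j 0 : 'cV[R]_d) i 0 by rewrite -colE mxE.
  exact: enorm_ge.
apply: sup_upper_bound; last by exists (delta_mx j 0).
split; first by exists (enorm (A *m delta_mx j 0)), (delta_mx j 0).
(* The supremum in [opnorm] dominates its elements only once the set is known to be bounded; the sum
   of all entries is a bound. *)
exists (\sum_i \sum_k `|A i k|) => _ [v v1 <-].
apply: (le_trans (enorm_le _)); apply: ler_sum => k _; rewrite mxE.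
apply: (le_trans (ler_norm_sum _ _ _)); apply: ler_sum => k' _.
by rewrite normrM ler_piMr // (le_trans (enorm_ge v k')).
Qed.

End Norms.

(** * The four-point estimate by the mean value theorem *)

Section MeanValue.
Context {R : realType} {d : nat}.
Implicit Types (v w x y a b : 'cV[R]_d) (h : 'cV[R]_d -> R).

Lemma diff_grad h x v : differentiable h x ->
  'd h x v = \sum_k v k 0 * grad h x k 0.
Proof.
move=> dh.
have lin (c : R) w : 'd h x (c *: w) = c * 'd h x w by exact: linearZ.
have {1}-> : v = \sum_k v k 0 *: delta_mx k 0.
  by rewrite {1}(matrix_sum_delta v); apply: eq_bigr => i _; rewrite big_ord1.
rewrite raddf_sum; apply: eq_bigr => k _.
by apply: etrans (lin (v k 0) (delta_mx k 0)) _; rewrite mxE.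
Qed.

Lemma diff_line h b v (s : R) : (forall x, differentiable h x) ->
  is_derive s 1 (fun s : R => h (b + s *: v)) (\sum_k v k 0 * grad h (b + s *: v) k 0).
Proof.
move=> dh; rewrite -(diff_grad h (b + s *: v) v (dh _)); have d1 : is_diff s (fun s : R => b + s *: v) (fun s => s *: v).
  have := @is_diffD _ _ _ (cst b) (fun s : R => s *: v) 0 (fun s => s *: v) s _ _.
  by rewrite add0r; apply.
have d2 : differentiable (fun s : R => h (b + s *: v)) s.
  by apply: (@differentiable_comp _ _ _ _ (fun s : R => b + s *: v) h).
have e : 'd (fun s : R => h (b + s *: v)) s = 'd h (b + s *: v) \o (fun s => s *: v) :> (R -> R).
  rewrite (@diff_comp _ _ _ _ (fun s : R => b + s *: v) h) //.
  by rewrite [X in _ \o X]diff_val.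
split; first exact: diff_derivable.
by rewrite deriveE // e /= scale1r.
Qed.

Lemma dot_diff v w x y : \sum_k v k 0 * x k 0 - \sum_k w k 0 * y k 0 =
  \sum_k (v - w) k 0 * x k 0 + \sum_k w k 0 * (x k 0 - y k 0) :> R.
Proof. by rewrite -sumrB -big_split; apply: eq_bigr => k _; rewrite !mxE /=; ring. Qed.

(** The mean value theorem is applied to the difference of h along the segments from b1 to a1 and
    from b0 to a0. For a1, b1 two paths at a later time and a0, b0 at an earlier one, this bounds
    the increment of h(x) - h(x') through the difference of the paths. *)
Lemma four_points h (M C G gam : R) a1 b1 a0 b0 :
  (forall x, differentiable h x) -> 0 <= gam -> 0 <= C -> 0 <= G ->
  (forall x, n1 x <= M -> forall k, `|grad h x k 0| <= G) ->
  (forall x y, n1 x <= M -> n1 y <= M ->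
     forall k, `|grad h x k 0 - grad h y k 0| <= C * n1 (x - y) `^ gam) ->
  n1 a1 <= M -> n1 b1 <= M -> n1 a0 <= M -> n1 b0 <= M ->
  `|h a1 - h b1 - (h a0 - h b0)| <= G * n1 (a1 - b1 - (a0 - b0)) +
     C * 2 `^ gam * n1 (a0 - b0) * (n1 (a1 - a0) `^ gam + n1 (b1 - b0) `^ gam).
Proof.
move=> dh g0 C0 G0 HG HC a1M b1M a0M b0M.
pose P (s : R) := b1 + s *: (a1 - b1); pose Q (s : R) := b0 + s *: (a0 - b0).
pose phi (s : R) := h (P s) - h (Q s).
have dphi (s : R) : is_derive s 1 phi (\sum_k (a1 - b1) k 0 * grad h (P s) k 0 -
    \sum_k (a0 - b0) k 0 * grad h (Q s) k 0).
  apply: (@is_deriveB _ _ _ (fun s : R => h (P s)) (fun s : R => h (Q s)) s 1 _ _).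
    exact: diff_line.
  exact: diff_line.
have cphi : {within `[0, 1], continuous phi}.
  apply: continuous_subspaceT => s.
  by apply: differentiable_continuous; apply/derivable1_diffP; case: (dphi s).
have [s /andP[s0 s1] Hs] := MVT ltr01 (fun s _ => dphi s) cphi.
rewrite /= !bnd_simp in s0 s1.
have -> : h a1 - h b1 - (h a0 - h b0) = phi 1 - phi 0.
  rewrite /phi /P /Q !scale1r !scale0r !addr0 ![_ + (_ - _)]addrC !subrK; ring.
have ball_ (a b : 'cV[R]_d) : n1 a <= M -> n1 b <= M -> n1 (b + s *: (a - b)) <= M.
  move=> aM bM; have -> : b + s *: (a - b) = s *: a + (1 - s) *: b.
    by rewrite scalerBr scalerBl scale1r addrCA.
  apply: (le_trans (n1D _ _)); rewrite !n1Z !ger0_norm ?subr_ge0 ?(ltW s0) ?(ltW s1) //.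
  have -> : M = s * M + (1 - s) * M by ring.
  by apply: lerD; apply: ler_wpM2l => //; rewrite ?subr_ge0 ltW.
have PM := ball_ a1 b1 a1M b1M; have QM := ball_ a0 b0 a0M b0M.
rewrite Hs subr0 mulr1.
(* One part has different directions and a bounded gradient; the other has the same direction a0 -
   b0 and gradients at nearby points, compared by the Hölder bound. *)
rewrite dot_diff.
apply: (le_trans (ler_normD _ _)); apply: lerD.
  apply: (le_trans (ler_norm_sum _ _ _)); rewrite mulrC /n1 big_distrl /=.
  by apply: ler_sum => k _; rewrite normrM; apply: ler_wpM2l => //; exact: HG.
have PQ : n1 (P s - Q s) `^ gam <= 2 `^ gam * (n1 (a1 - a0) `^ gam + n1 (b1 - b0) `^ gam).
  apply: le_trans (powR_sum_le _ _ _ g0 (n1_ge0 _) (n1_ge0 _)).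
  apply: powR_le => //; first exact: n1_ge0.
  have -> : P s - Q s = s *: (a1 - a0) + (1 - s) *: (b1 - b0).
    by apply/matrixP => i j; rewrite /P /Q !mxE; ring.
  apply: (le_trans (n1D _ _)); rewrite !n1Z !ger0_norm ?subr_ge0 ?(ltW s0) ?(ltW s1) //.
  by apply: lerD; apply: ler_piMl; rewrite ?n1_ge0 ?gerBl ?(ltW s0) ?(ltW s1).
apply: (le_trans (ler_norm_sum _ _ _)).
have -> : C * 2 `^ gam * n1 (a0 - b0) * (n1 (a1 - a0) `^ gam + n1 (b1 - b0) `^ gam) =
   n1 (a0 - b0) * (C * (2 `^ gam * (n1 (a1 - a0) `^ gam + n1 (b1 - b0) `^ gam))) by ring.
rewrite {1}/n1 big_distrl /=; apply: ler_sum => k _; rewrite normrM; apply: ler_wpM2l => //.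
by apply: (le_trans (HC _ _ PM QM k)); apply: ler_wpM2l.
Qed.

End MeanValue.

(** * The hypotheses on the coefficients in coordinates *)

Section Coefficients.
Context {R : realType} {d : nat}.
Variables (f : 'cV[R]_d -> 'cV[R]_d) (g : 'cV[R]_d -> 'M[R]_d).

Lemma nat_ge (M : R) : exists k : nat, M <= k%:R.
Proof. by exists (Num.truncn M).+1; exact/ltW/truncnS_gt. Qed.

Lemma growth_coord : (exists L : R, 0 < L /\ forall x, enorm (f x) <= L * (1 + enorm x)) ->
  exists2 L : R, 0 <= L & forall x i, `|f x i 0| <= L * (1 + n1 x).
Proof.
move=> [L [L0 H]]; exists L; first exact: ltW.
move=> x i; apply: (le_trans (enorm_ge _ i)); apply: (le_trans (H x)).
by rewrite ler_pM2l // lerD2l enorm_le.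
Qed.

Lemma lipschitz_coord : (forall k : nat, exists Lk : R, 0 < Lk /\
     forall x y, enorm x <= k%:R -> enorm y <= k%:R ->
       enorm (f x - f y) <= Lk * enorm (x - y)) ->
  forall M, exists2 L : R, 0 <= L & forall x y i, n1 x <= M -> n1 y <= M ->
    `|f x i 0 - f y i 0| <= L * n1 (x - y).
Proof.
move=> H M; have [k Mk] := nat_ge M; have [L [L0 HL]] := H k.
exists L; first exact: ltW.
move=> x y i xM yM; apply: (le_trans (enormB_ge _ _ i)); apply: (le_trans (HL x y _ _)).
- exact: le_trans (enorm_le _) (le_trans xM Mk).
- exact: le_trans (enorm_le _) (le_trans yM Mk).
- by rewrite ler_pM2l // enorm_le.
Qed.

Lemma holder_coord (p : R) : 1 <= p -> (exists alpha C : R, p - 1 < alpha <= 1 /\ 0 < C /\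
     forall x y, opnorm (g x - g y) <= C * enorm (x - y) `^ alpha) ->
  exists al C : R, [/\ p - 1 < al, al <= 1, 0 <= C &
     forall x y i j, `|g x i j - g y i j| <= C * n1 (x - y) `^ al].
Proof.
move=> p1 [al [C [/andP[al0 al1] [C0 H]]]]; exists al, C; split => //; first exact: ltW.
move=> x y i j; have := opnorm_ge (g x - g y) i j; rewrite !mxE => h.
apply: (le_trans h); apply: (le_trans (H x y)); rewrite ler_pM2l //.
by apply: powR_le; [lra|exact: enorm_ge0|exact: enorm_le].
Qed.

Lemma four_points_coord (p : R) : 1 <= p ->
  (forall (i j : 'I_d) (x : 'cV[R]_d), differentiable (fun v => g v i j) x) ->
  (exists gamma : R, p - 1 < gamma <= 1 /\
     forall k : nat, exists C : R, 0 < C /\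
       forall (i j : 'I_d) x y, enorm x <= k%:R -> enorm y <= k%:R ->
         enorm (grad (fun v => g v i j) x - grad (fun v => g v i j) y)
           <= C * enorm (x - y) `^ gamma) ->
  exists gam : R, [/\ p - 1 < gam, gam <= 1 & forall M, exists2 C : R, 0 <= C &
    forall i j a1 b1 a0 b0, n1 a1 <= M -> n1 b1 <= M -> n1 a0 <= M -> n1 b0 <= M ->
    `|g a1 i j - g b1 i j - (g a0 i j - g b0 i j)| <= C * (n1 (a1 - b1 - (a0 - b0)) +
     n1 (a0 - b0) * (n1 (a1 - a0) `^ gam + n1 (b1 - b0) `^ gam))].
Proof.
move=> p1 dg [gam [/andP[g0 g1] H]]; exists gam; split => // M.
have gam0 : 0 <= gam by lra.
have [k Mk] := nat_ge M; have [C [C0 HC]] := H k.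
have Mk' (x : 'cV[R]_d) : n1 x <= M -> enorm x <= k%:R.
  by move=> xM; exact: le_trans (enorm_le _) (le_trans xM Mk).
have HC' i j x y : n1 x <= M -> n1 y <= M -> forall m,
  `|grad (fun v => g v i j) x m 0 - grad (fun v => g v i j) y m 0| <= C * n1 (x - y) `^ gam.
  move=> xM yM m.
  apply: (le_trans (enormB_ge _ _ m)); apply: (le_trans (HC i j x y (Mk' _ xM) (Mk' _ yM))).
  by rewrite ler_pM2l //; apply: powR_le => //; [exact: enorm_ge0|exact: enorm_le].
pose S := \sum_(i : 'I_d) \sum_(j : 'I_d) \sum_(m : 'I_d) `|grad (fun v => g v i j) 0 m 0|.
have S0 : 0 <= S by do 3![apply: sumr_ge0 => ? _].
have HS i j m : `|grad (fun v => g v i j) 0 m 0| <= S.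
  have T0 i' j' m' : 0 <= `|grad (fun v => g v i' j') 0 m' 0| by exact: normr_ge0.
  apply: (le_trans (sum_ge _ (fun m => `|grad (fun v => g v i j) 0 m 0|) m (T0 i j))).
  apply: (le_trans (sum_ge _ (fun j => \sum_(m : 'I_d) `|grad (fun v => g v i j) 0 m 0|) j _)).
    by move=> j'; apply: sumr_ge0 => m' _.
  apply: (sum_ge _ (fun i => \sum_(j : 'I_d) \sum_(m : 'I_d) `|grad (fun v => g v i j) 0 m 0|)).
  by move=> i'; apply: sumr_ge0 => j' _; apply: sumr_ge0 => m' _.
(* (H2) bounds only differences of gradients; on the ball the gradient is its value at 0 plus a
   Hölder term for the distance to 0. *)
pose G := S + C * `|M| `^ gam.
have G0 : 0 <= G by rewrite addr_ge0 // mulr_ge0 ?powR_ge0 // ltW.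
have HG i j x : n1 x <= M -> forall m, `|grad (fun v => g v i j) x m 0| <= G.
  move=> xM m; have M0 : 0 <= M := le_trans (n1_ge0 x) xM.
  have M0' : n1 (0 : 'cV[R]_d) <= M by rewrite n1_0.
  set g1' := grad _ x m 0; set g0' := grad (fun v => g v i j) 0 m 0.
  have -> : g1' = g0' + (g1' - g0') by rewrite addrC subrK.
  apply: (le_trans (ler_normD _ _)); apply: lerD; first exact: HS.
  apply: (le_trans (HC' i j x 0 xM M0' m)); rewrite subr0 ler_pM2l //.
  by apply: powR_le; [|exact: n1_ge0|rewrite ger0_norm].
exists (G + C * 2 `^ gam); first by rewrite addr_ge0 // mulr_ge0 ?powR_ge0 // ltW.
move=> i j a1 b1 a0 b0 a1M b1M a0M b0M.
apply: (le_trans (four_points (fun v => g v i j) M C G gam a1 b1 a0 b0 (dg i j) gam0 (ltW C0) G0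
  (HG i j) (HC' i j) a1M b1M a0M b0M)).
have K0 : 0 <= C * 2 `^ gam by rewrite mulr_ge0 ?powR_ge0 // ltW.
set K := C * _ in K0 *; set D1 := n1 (a1 - b1 - _); set D2 := n1 (a0 - b0).
set E := _ + n1 (b1 - b0) `^ gam.
have D10 : 0 <= D1 by exact: n1_ge0.
have D20 : 0 <= D2 * E by rewrite mulr_ge0 ?n1_ge0 // addr_ge0 ?powR_ge0.
have -> : (G + K) * (D1 + D2 * E) = G * D1 + K * D2 * E + (K * D1 + G * (D2 * E)) by ring.
by rewrite lerDl; apply: addr_ge0; apply: mulr_ge0.
Qed.

End Coefficients.

(** * Vector paths of finite p-variation *)

Section Paths.
Context {R : realType} {d : nat}.
Implicit Types (x : R -> 'cV[R]_d) (p s t T : R).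

Definition coord x (i : 'I_d) : R -> R := fun t => x t i 0.

Definition PV p x s t := \sum_i pv p (coord x i) s t.

Definition PVfin p x := forall i, pvfin p (coord x i).

(** The class in which the fixed point is sought; left limits come with finite variation
    ([adm_cadlag]). *)
Definition adm p x := PVfin p x /\ forall i, rcont (coord x i).

Definition lpath x (t : R) : 'cV[R]_d := \col_i lleft (coord x i) t.

Lemma coord_lpath x i : coord (lpath x) i = lleft (coord x i).
Proof. by apply/funext => t; rewrite /coord mxE. Qed.

Lemma PV_ge0 p x s t : 0 <= PV p x s t.
Proof. by apply: sumr_ge0 => i _; exact: pv_ge0. Qed.

Lemma PV_control p x : PVfin p x -> control (PV p x).
Proof. by move=> fx; apply: control_sum => i; exact: pv_control. Qed.

Lemma pv_PV p x i s t : pv p (coord x i) s t <= PV p x s t.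
Proof. by apply: (sum_ge _ (fun i => pv p (coord x i) s t)) => j; exact: pv_ge0. Qed.

Lemma PV_incr p x s t : 0 < p -> PVfin p x -> 0 <= s -> s <= t ->
  n1 (x t - x s) <= d%:R * PV p x s t `^ p^-1.
Proof.
move=> p0 fx s0 st; apply: n1_le => i; rewrite !mxE.
rewrite powR_inv_le ?PV_ge0 //; apply: le_trans (pv_PV p x i s t).
exact: (pv_incr p (coord x i)).
Qed.

Lemma adm_cadlag p x i : 0 < p -> adm p x -> cadlag (coord x i).
Proof. by move=> p0 [fx rx]; exact: pvfin_cadlag p0 (rx i) (fx i). Qed.

Lemma adm_left_lim p x i : 0 < p -> adm p x -> left_lim (coord x i) (coord (lpath x) i).
Proof. by move=> p0 ax; rewrite coord_lpath; apply: cadlag_left_lim; exact: adm_cadlag ax. Qed.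

Lemma PVfin_lpath p x : 0 < p -> adm p x -> PVfin p (lpath x).
Proof.
move=> p0 ax i; rewrite coord_lpath; apply: pvfin_lleft => //; first exact: adm_cadlag ax.
exact: ax.1.
Qed.

Lemma PV_lpath p x T : 0 < p -> 0 <= T -> adm p x -> PV p (lpath x) 0 T <= PV p x 0 T.
Proof.
move=> p0 T0 ax; apply: ler_sum => i _; apply: pv_le => //.
by apply: left_lim_pvb (adm_left_lim p x i p0 ax) _ => //; apply: pvfin_pvb => //; exact: ax.1.
Qed.

Lemma lpath0 p x : 0 < p -> adm p x -> lpath x 0 = x 0.
Proof.
move=> p0 ax; apply/colP => i.
exact: (adm_left_lim p x i p0 ax).1.
Qed.

Lemma lpath_incr p x s t T : 0 < p -> adm p x -> 0 <= s -> s <= t -> t <= T ->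
  n1 (lpath x t - lpath x s) <= d%:R * PV p x 0 T `^ p^-1.
Proof.
move=> p0 ax s0 st tT; have flx := PVfin_lpath p x p0 ax.
have T0 : 0 <= T by exact: le_trans (le_trans s0 st) tT.
apply: (le_trans (PV_incr p _ s t p0 flx s0 st)); apply: ler_wpM2l; first exact: ler0n.
apply: powR_le; [by rewrite invr_ge0 ltW|exact: PV_ge0|].
apply: (le_trans _ (PV_lpath p x T p0 T0 ax)).
exact: (control_mono _ 0 s t T (PV_control p _ flx)).
Qed.

Lemma lpath_bound p x t T : 0 < p -> adm p x -> 0 <= t -> t <= T ->
  n1 (lpath x t) <= n1 (x 0) + d%:R * PV p x 0 T `^ p^-1.
Proof.
move=> p0 ax t0 tT.
have -> : lpath x t = x 0 + (lpath x t - lpath x 0).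
  by rewrite (lpath0 p) // addrC subrK.
by apply: (le_trans (n1D _ _)); rewrite lerD2l; exact: (lpath_incr p).
Qed.

End Paths.

(** * The integral operator: existence, growth and contraction *)

Section Equation.
Context {R : realType} {d : nat}.

Set Implicit Arguments.
(** The hypotheses in the form in which they act: coordinatewise, in the l1 norm, and with the
    differentiability in (H2) replaced by the four-point bound. *)
Record setting (p al C1 gam L : R) (f : 'cV[R]_d -> 'cV[R]_d) (g : 'cV[R]_d -> 'M[R]_d)
    (a : R -> R) (z : R -> 'cV[R]_d) : Prop := Setting {
  st_p : 1 <= p;
  st_al : p - 1 < al <= 1;
  st_gam : p - 1 < gam <= 1;
  st_C1 : 0 <= C1;
  st_L : 0 <= L;
  st_fgrowth : forall x i, `|f x i 0| <= L * (1 + n1 x);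
  st_flip : forall M : R, exists2 K : R, 0 <= K &
    forall x y i, n1 x <= M -> n1 y <= M -> `|f x i 0 - f y i 0| <= K * n1 (x - y);
  st_gholder : forall x y i j, `|g x i j - g y i j| <= C1 * n1 (x - y) `^ al;
  st_gfour : forall M : R, exists2 C : R, 0 <= C &
    forall i j a1 b1 a0 b0, n1 a1 <= M -> n1 b1 <= M -> n1 a0 <= M -> n1 b0 <= M ->
    `|g a1 i j - g b1 i j - (g a0 i j - g b0 i j)| <= C * (n1 (a1 - b1 - (a0 - b0)) +
     n1 (a0 - b0) * (n1 (a1 - a0) `^ gam + n1 (b1 - b0) `^ gam));
  st_a : rcont a /\ pvfin 1 a;
  st_z : adm p z }.
Unset Implicit Arguments.

Definition Yop (f : 'cV[R]_d -> 'cV[R]_d) (g : 'cV[R]_d -> 'M[R]_d) (a : R -> R) (z : R -> 'cV[R]_d) (x0 : 'cV[R]_d) (x : R -> 'cV[R]_d)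
    (t : R) : 'cV[R]_d :=
  \col_i (x0 i 0 + RSint (fun s => f (lpath x s) i 0) a t +
     \sum_j RSint (fun s => g (lpath x s) i j) (coord z j) t).

(** The power p on the variation of a puts both integrators on the same footing: the increments of
    either are at most ctl^(1/p). *)
Definition ctl (p : R) (a : R -> R) (z : R -> 'cV[R]_d) (s t : R) := pv 1 a s t `^ p + PV p z s t.

Context {p al C1 gam L : R} {f : 'cV[R]_d -> 'cV[R]_d} {g : 'cV[R]_d -> 'M[R]_d}
  {a : R -> R} {z : R -> 'cV[R]_d}.
Implicit Types (x : R -> 'cV[R]_d).

Lemma st_p0 : setting p al C1 gam L f g a z -> 0 < p.
Proof. by move=> H; have := st_p H; lra. Qed.

Lemma st_al0 : setting p al C1 gam L f g a z -> 0 < al.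
Proof.
by move=> H; have := st_p H; have /andP[] := st_al H; lra.
Qed.

Lemma st_gam0 : setting p al C1 gam L f g a z -> 0 < gam.
Proof.
by move=> H; have := st_p H; have /andP[] := st_gam H; lra.
Qed.

(** This is where the thresholds alpha > p - 1 and gamma > p - 1 come from. *)
Lemma young_exponent (b : R) : 0 < p -> p - 1 < b -> 1 < b / p + p^-1.
Proof.
move=> p0 pb; rewrite -{2}[p^-1]mul1r -mulrDl ltr_pdivlMr // mul1r; lra.
Qed.

Lemma ctl_control : setting p al C1 gam L f g a z -> control (ctl p a z).
Proof.
move=> H; apply: controlD.
  by apply: control_powR; [exact: (st_p H)|apply: pv_control; exact: (st_a H).2].
by apply: PV_control; exact: (st_z H).1.
Qed.

Lemma ctl_a s t : 0 < p -> pv 1 a s t <= ctl p a z s t `^ p^-1.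
Proof.
move=> p0; rewrite powR_inv_le ?pv_ge0 // /ctl; first by rewrite lerDl PV_ge0.
by rewrite addr_ge0 ?powR_ge0 ?PV_ge0.
Qed.

Lemma ctl_z s t j : 0 < p -> pv p (coord z j) s t `^ p^-1 <= ctl p a z s t `^ p^-1.
Proof.
move=> p0; apply: powR_le; [by rewrite invr_ge0 ltW|exact: pv_ge0|].
by apply: (le_trans (pv_PV p z j s t)); rewrite lerDr powR_ge0.
Qed.

(** The path of left limits stays in a ball, where f is Lipschitz; so the integrand has exponent 1/p
    against exponent 1 for a, and the sum exceeds 1. *)
Lemma RS_f x i t : setting p al C1 gam L f g a z -> adm p x -> 0 <= t ->
  exists I, lRS (fun s => f (lpath x s) i 0) a t I.
Proof.
move=> H ax t0; have p0 := st_p0 H.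
have [ra fa] := st_a H.
set M := n1 (x 0) + d%:R * PV p x 0 (t + 1) `^ p^-1.
have [K K0 HK] := st_flip H M.
have flx := PVfin_lpath p x p0 ax.
apply: (RS_exists (PV p (lpath x)) _ a 1 t (K * d%:R) p^-1) => //.
- exact: PV_control.
- by rewrite mulr_ge0.
- by rewrite invr_gt0.
- by rewrite invr1 ltrDr invr_gt0.
move=> r s r0 rs s1; rewrite -mulrA.
have s0 := le_trans r0 rs.
apply: (le_trans (HK _ _ i _ _)).
- exact: (lpath_bound p).
- by apply: (lpath_bound p) => //; exact: le_trans s1.
- by apply: ler_wpM2l => //; exact: PV_incr.
Qed.

Lemma g_controlled x i j T : setting p al C1 gam L f g a z -> adm p x ->
  controlled (fun s => g (lpath x s) i j) (C1 * d%:R `^ al) (PV p (lpath x)) (al / p) T.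
Proof.
move=> H ax s t s0 st tT; have p0 := st_p0 H; have al0 := st_al0 H.
have flx := PVfin_lpath p x p0 ax.
apply: (le_trans (st_gholder H _ _ i j)); rewrite -mulrA.
apply: ler_wpM2l; first exact: (st_C1 H).
rewrite [al / p]mulrC powRrM -powRM ?powR_ge0 //.
by apply: powR_le; [exact: ltW|exact: n1_ge0|exact: PV_incr].
Qed.

Lemma RS_g x i j t : setting p al C1 gam L f g a z -> adm p x -> 0 <= t ->
  exists I, lRS (fun s => g (lpath x s) i j) (coord z j) t I.
Proof.
move=> H ax t0; have p0 := st_p0 H; have al0 := st_al0 H.
have [fz rz] := st_z H.
have flx := PVfin_lpath p x p0 ax.
apply: (RS_exists (PV p (lpath x)) _ _ p t (C1 * d%:R `^ al) (al / p)) => //.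
- exact: (st_p H).
- exact: PV_control.
- by rewrite mulr_ge0 ?powR_ge0 // (st_C1 H).
- exact: divr_gt0.
- by apply: young_exponent => //; case/andP: (st_al H).
- exact: g_controlled.
Qed.

Lemma Yop_incr (x0 : 'cV[R]_d) x i s t :
  coord (Yop f g a z x0 x) i t - coord (Yop f g a z x0 x) i s =
  (RSint (fun s => f (lpath x s) i 0) a t - RSint (fun s => f (lpath x s) i 0) a s) +
  \sum_j (RSint (fun s => g (lpath x s) i j) (coord z j) t -
          RSint (fun s => g (lpath x s) i j) (coord z j) s).
Proof. by rewrite /coord !mxE sumrB; ring. Qed.

(** The constant Q does not depend on x, and the bound is linear in the norm V^(1/p): this is what
    rules out blow-up. *)
Lemma Yop_growth (x0 : 'cV[R]_d) : setting p al C1 gam L f g a z -> exists2 Q, 0 <= Q &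
  forall x, adm p x -> x 0 = x0 -> forall S i, 
  controlled (coord (Yop f g a z x0 x) i) (Q * (1 + PV p x 0 S `^ p^-1)) (ctl p a z) p^-1 S.
Proof.
move=> H; have p0 := st_p0 H; have al0 := st_al0 H.
have [fz rz] := st_z H.
have [ra fa] := st_a H.
have L0 := st_L H; have C10 := st_C1 H.
have /andP[pal al1] := st_al H.
have th1 := young_exponent al p0 pal.
pose K2 := young_const (al / p + p^-1) * 2 `^ (al / p + p^-1).
have K20 : 0 <= K2.
  by apply: mulr_ge0; [apply: ltW; exact: young_const_gt0|exact: powR_ge0].
pose D : R := d%:R; have D0 : 0 <= D by exact: ler0n.
pose C2 := C1 * D `^ al; have C20 : 0 <= C2 by rewrite mulr_ge0 ?powR_ge0.
pose G0 := \sum_i \sum_j `|g x0 i j|.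
have G00 : 0 <= G0 by do 2![apply: sumr_ge0 => ? _].
have HG0 i j : `|g x0 i j| <= G0.
  have N0 i' j' : 0 <= `|g x0 i' j'| by exact: normr_ge0.
  apply: (le_trans (sum_ge _ (fun j => `|g x0 i j|) j (N0 i))).
  apply: (sum_ge _ (fun i => \sum_j `|g x0 i j|)) => i'.
  by apply: sumr_ge0 => j' _.
(* Qf comes from the linear growth of f; in Qg the terms stand for g at x0, for the Hölder deviation
   from it and for the Young remainder. *)
pose Qf := L * (1 + n1 x0 + D); pose Qg := G0 + C2 * (1 + K2).
have n0 : 0 <= n1 x0 by exact: n1_ge0.
have Qf0 : 0 <= Qf by rewrite mulr_ge0 // !addr_ge0.
have Qg0 : 0 <= Qg by rewrite addr_ge0 // mulr_ge0 // addr_ge0.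
exists (Qf + D * Qg); first by rewrite addr_ge0 // mulr_ge0.
move=> x ax xx0 S i s t s0 st tS.
set V := PV p x 0 S; set N := V `^ p^-1; set c := ctl p a z s t `^ p^-1.
have V0 : 0 <= V by exact: PV_ge0.
have N0 : 0 <= N by exact: powR_ge0.
have c0 : 0 <= c by exact: powR_ge0.
have t0 := le_trans s0 st.
have flx := PVfin_lpath p x p0 ax.
(* The Hölder exponent al <= 1 keeps the growth at most linear in N. *)
have Nal : N `^ al <= 1 + N by apply: powR_le1D => //; exact: ltW.
rewrite Yop_incr; apply: (le_trans (ler_normD _ _)).
have -> : (Qf + D * Qg) * (1 + N) * c = Qf * (1 + N) * c + D * (Qg * (1 + N) * c) by ring.
apply: lerD.
  apply: (@le_trans _ _ (L * (1 + n1 x0 + D * N) * pv 1 a s t)).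
    apply: RSint_crude => //; [|move=> r sr rt|exact: RS_f|exact: RS_f].
      by rewrite mulr_ge0 // !addr_ge0 // mulr_ge0.
    have r0 := le_trans s0 sr; have rS : r <= S by exact: le_trans (ltW rt) tS.
    apply: (le_trans (st_fgrowth H _ _)); apply: ler_wpM2l => //.
    by rewrite -addrA lerD2l -xx0; exact: (lpath_bound p).
  apply: ler_pM.
  - by rewrite mulr_ge0 // !addr_ge0 // mulr_ge0.
  - exact: pv_ge0.
  - rewrite /Qf -mulrA; apply: ler_wpM2l => //.
    have -> : (1 + n1 x0 + D) * (1 + N) = 1 + n1 x0 + D * N + (D + (1 + n1 x0) * N) by ring.
    by rewrite lerDl addr_ge0 // mulr_ge0 // addr_ge0.
  - exact: ctl_a.
apply: (le_trans (ler_norm_sum _ _ _)).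
apply: (@le_trans _ _ (\sum_(j < d) Qg * (1 + N) * c)); last first.
  by rewrite sumr_const card_ord mulr_natl.
apply: ler_sum => j _.
set h := fun s => g (lpath x s) i j.
have hs : `|h s| <= G0 + C2 * (1 + N).
  have -> : h s = g x0 i j + (h s - g x0 i j) by rewrite addrC subrK.
  apply: (le_trans (ler_normD _ _)); apply: lerD => //.
  apply: (le_trans (st_gholder H _ _ i j)).
  rewrite /C2 -mulrA; apply: ler_wpM2l => //.
  apply: (@le_trans _ _ ((D * N) `^ al)).
    apply: powR_le; [exact: ltW|exact: n1_ge0|].
    rewrite -xx0 -(lpath0 p x p0 ax); apply: (lpath_incr p) => //; exact: le_trans tS.
  by rewrite powRM //; apply: ler_wpM2l => //; exact: powR_ge0.
have wN : PV p (lpath x) s t `^ (al / p) <= 1 + N.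
  apply: le_trans Nal; rewrite /N -powRrM mulrC.
  apply: powR_le; [by rewrite mulr_ge0 ?invr_ge0 // ltW|exact: PV_ge0|].
  apply: (le_trans _ (PV_lpath p x S p0 (le_trans t0 tS) ax)).
  exact: (control_mono _ 0 s t S (PV_control p _ flx)).
apply: (le_trans (RSint_bound (PV p (lpath x)) h (coord z j) p S C2 (al / p) s t _ _
  (st_p H) (fz j) (PV_control _ _ flx) C20 (divr_gt0 al0 p0) th1
  (g_controlled x i j S H ax) s0 st tS (RS_g x i j s H ax s0) (RS_g x i j t H ax t0) hs wN)).
have N1 : 0 <= 1 + N by exact: addr_ge0.
apply: ler_pM; [|exact: powR_ge0| |exact: ctl_z].
  rewrite -/K2; apply: addr_ge0; first by apply: mulr_ge0 => //; exact: mulr_ge0.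
  by apply: addr_ge0 => //; exact: mulr_ge0.
have -> : Qg * (1 + N) = K2 * C2 * (1 + N) + (G0 + C2 * (1 + N)) + G0 * N by rewrite /Qg; ring.
by rewrite lerDl mulr_ge0.
Qed.

Lemma Yop_incrB (x0 : 'cV[R]_d) x x' i s t :
  setting p al C1 gam L f g a z -> adm p x -> adm p x' -> 0 <= s -> 0 <= t ->
  (coord (Yop f g a z x0 x) i t - coord (Yop f g a z x0 x') i t) -
  (coord (Yop f g a z x0 x) i s - coord (Yop f g a z x0 x') i s) =
  (RSint (fun s => f (lpath x s) i 0 - f (lpath x' s) i 0) a t -
   RSint (fun s => f (lpath x s) i 0 - f (lpath x' s) i 0) a s) +
  \sum_j (RSint (fun s => g (lpath x s) i j - g (lpath x' s) i j) (coord z j) t -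
          RSint (fun s => g (lpath x s) i j - g (lpath x' s) i j) (coord z j) s).
Proof.
move=> H ax ax' s0 t0.
have -> : forall u v u' v' : R, (u - v) - (u' - v') = (u - u') - (v - v') by move=> *; ring.
rewrite !Yop_incr opprD addrACA -sumrB; congr (_ + _).
  rewrite -(RSintB _ _ _ _ t0 (RS_f x i t H ax t0) (RS_f x' i t H ax' t0)).
  by rewrite -(RSintB _ _ _ _ s0 (RS_f x i s H ax s0) (RS_f x' i s H ax' s0)); ring.
apply: eq_bigr => j _.
rewrite -(RSintB _ _ _ _ t0 (RS_g x i j t H ax t0) (RS_g x' i j t H ax' t0)).
by rewrite -(RSintB _ _ _ _ s0 (RS_g x i j s H ax s0) (RS_g x' i j s H ax' s0)); ring.
Qed.

(** On a ball of paths the integrand g(x) - g(x') is Hölder with a constant proportional to the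
    distance N, thanks to the four-point bound. The factor that makes this a contraction comes
    later, from the smallness of [ctl] on a short interval. *)
Lemma Yop_contraction (x0 : 'cV[R]_d) (r0 : R) : setting p al C1 gam L f g a z -> 0 <= r0 ->
  exists2 Q, 0 <= Q &
  forall x x', adm p x -> adm p x' -> x 0 = x0 -> x' 0 = x0 -> forall S N, 0 < N ->
  PV p x 0 S <= r0 -> PV p x' 0 S <= r0 -> PV p (fun t => x t - x' t) 0 S <= N `^ p ->
  forall i, controlled (fun t => coord (Yop f g a z x0 x) i t - coord (Yop f g a z x0 x') i t)
     (Q * N) (ctl p a z) p^-1 S.
Proof.
move=> H r00; have p0 := st_p0 H; have gam0 := st_gam0 H.
have [fz rz] := st_z H.
have [ra fa] := st_a H.
have /andP[pgam gam1] := st_gam H.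
have p1 := st_p H.
have th1 := young_exponent gam p0 pgam.
pose K2 := young_const (gam / p + p^-1) * 2 `^ (gam / p + p^-1).
have K20 : 0 <= K2.
  by apply: mulr_ge0; [apply: ltW; exact: young_const_gt0|exact: powR_ge0].
pose D : R := d%:R; have D0 : 0 <= D by exact: ler0n.
pose M := n1 x0 + D * r0 `^ p^-1.
have [Lf Lf0 HLf] := st_flip H M.
have [C C0 HC] := st_gfour H M.
pose A0 := C * (D + D * (2 * D `^ gam)).
have A00 : 0 <= A0 by rewrite mulr_ge0 // addr_ge0 // mulr_ge0 // mulr_ge0 // powR_ge0.
pose W0 := (1 + (r0 + r0)) `^ (gam / p).
have W00 : 0 <= W0 by exact: powR_ge0.
exists (Lf * D + D * (K2 * A0 * W0 + C * D)).
  by rewrite addr_ge0 ?mulr_ge0 // addr_ge0 // mulr_ge0 // mulr_ge0.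
move=> x x' ax ax' xx0 xx0' S N N0 Vx Vx' VD i s t s0 st tS.
have t0 := le_trans s0 st; have S0 := le_trans t0 tS.
have flx := PVfin_lpath p x p0 ax; have flx' := PVfin_lpath p x' p0 ax'.
have ip0 : 0 <= p^-1 by rewrite invr_ge0 ltW.
have pip0 : 0 < p^-1 by rewrite invr_gt0.
have bound (y : R -> 'cV[R]_d) r : adm p y -> y 0 = x0 -> PV p y 0 S <= r0 -> 0 <= r -> r <= S -> n1 (lpath y r) <= M.
  move=> ay y0 Vy r0' rS; apply: (le_trans (lpath_bound p y r S p0 ay r0' rS)).
  rewrite y0 lerD2l; apply: ler_wpM2l; first exact: D0.
  by apply: powR_le; [exact: ip0|exact: PV_ge0|exact: Vy].
pose Dl := fun t => lpath x t - lpath x' t.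
have cDl j : coord Dl j = fun t => coord (lpath x) j t - coord (lpath x') j t.
  by apply/funext => r; rewrite /coord /Dl !mxE.
have fDl : PVfin p Dl.
  move=> j T; have [M1 H1] := flx j T; have [M2 H2] := flx' j T.
  by rewrite cDl; exists (2 `^ p * (M1 + M2)); apply: pvbB => //; exact: ltW.
have fD j : pvfin p (coord (fun t => x t - x' t) j).
  move=> T; have [M1 H1] := ax.1 j T; have [M2 H2] := ax'.1 j T.
  exists (2 `^ p * (M1 + M2)).
  have -> : coord (fun t => x t - x' t) j = fun t => coord x j t - coord x' j t.
    by apply/funext => r; rewrite /coord !mxE.
  by apply: pvbB => //; exact: ltW.
have VDl : PV p Dl 0 S <= N `^ p.
  apply: le_trans VD; apply: ler_sum => j _; apply: pv_le => //.
  have ll : left_lim (coord (fun t => x t - x' t) j) (coord Dl j).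
    have := left_limB _ _ _ _ (adm_left_lim p x j p0 ax) (adm_left_lim p x' j p0 ax').
    congr left_lim; apply/funext => r; by rewrite /coord /Dl !mxE.
  by apply: left_lim_pvb ll _ => //; exact: pvfin_pvb.
have Dl0 : Dl 0 = 0 by rewrite /Dl !(lpath0 p) // xx0 xx0' subrr.
have cD := PV_control p Dl fDl.
have cx := PV_control p _ flx; have cx' := PV_control p _ flx'.
have NK : (N `^ p) `^ p^-1 = N by exact: (powRKV p N p0 (ltW N0)).
have nDl r : 0 <= r -> r <= S -> n1 (Dl r) <= D * N.
  move=> r0' rS; have := PV_incr p Dl 0 r p0 fDl (lexx _) r0'; rewrite Dl0 subr0 => h.
  apply: (le_trans h); apply: ler_wpM2l => //.
  rewrite -[leRHS]NK; apply: powR_le; [exact: ip0|exact: PV_ge0|].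
  by apply: le_trans VDl; exact: (control_mono _ 0 0 r S cD (lexx _) (lexx _) r0' rS).
set c := ctl p a z s t `^ p^-1; have c0 : 0 <= c by exact: powR_ge0.
rewrite (Yop_incrB _ _ _ _ _ _ H) //; apply: (le_trans (ler_normD _ _)).
have -> : (Lf * D + D * (K2 * A0 * W0 + C * D)) * N * c =
  Lf * (D * N) * c + D * ((K2 * (A0 * N) * W0 + C * (D * N)) * c) by ring.
have DN0 : 0 <= D * N by rewrite mulr_ge0 // ltW.
apply: lerD.
  apply: (@le_trans _ _ (Lf * (D * N) * pv 1 a s t)); last first.
    by apply: ler_wpM2l; [rewrite mulr_ge0|exact: ctl_a].
  have ef r : 0 <= r -> exists I, lRS (fun s => f (lpath x s) i 0 - f (lpath x' s) i 0) a r I.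
    move=> r0'; have [I1 h1] := RS_f x i r H ax r0'; have [I2 h2] := RS_f x' i r H ax' r0'.
    by exists (I1 - I2); exact: lRSB.
  apply: RSint_crude => //; [by rewrite mulr_ge0| |exact: ef|exact: ef].
  move=> r sr rt; have r0' := le_trans s0 sr; have rS := le_trans (ltW rt) tS.
  apply: (le_trans (HLf _ _ i (bound x r ax xx0 Vx r0' rS) (bound x' r ax' xx0' Vx' r0' rS))).
  by apply: ler_wpM2l => //; exact: nDl.
apply: (le_trans (ler_norm_sum _ _ _)).
apply: (@le_trans _ _ (\sum_(j < d) (K2 * (A0 * N) * W0 + C * (D * N)) * c)); last first.
  by rewrite sumr_const card_ord [leRHS]mulr_natl.
apply: ler_sum => j _.
set h := fun s => g (lpath x s) i j - g (lpath x' s) i j.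
(* The variation of the difference is normalized by N^p, so that its mass on [0,S] is at most 1 and
   N moves into the Hölder constant, where it appears linearly. *)
pose w u v := (N `^ p)^-1 * PV p Dl u v + (PV p (lpath x) u v + PV p (lpath x') u v).
have Np : 0 < N `^ p by exact: powR_gt0.
have iNp : 0 <= (N `^ p)^-1 by rewrite invr_ge0 ltW.
have cw : control w by apply: controlD; [exact: controlZ|exact: controlD].
have hw : controlled h (A0 * N) w (gam / p) S.
  move=> u v u0 uv vS; have v0 := le_trans u0 uv; have uS := le_trans uv vS.
  have -> : h v - h u = g (lpath x v) i j - g (lpath x' v) i j -
     (g (lpath x u) i j - g (lpath x' u) i j) by [].
  apply: (le_trans (HC i j _ _ _ _ (bound x v ax xx0 Vx v0 vS) (bound x' v ax' xx0' Vx' v0 vS)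
     (bound x u ax xx0 Vx u0 uS) (bound x' u ax' xx0' Vx' u0 uS))).
  rewrite /A0 -!mulrA; apply: ler_wpM2l => //.
  set W := w u v `^ (gam / p).
  have W_0 : 0 <= W by exact: powR_ge0.
  have gp0 : 0 <= gam / p by rewrite mulr_ge0 // ltW.
  have piece (y : R -> 'cV[R]_d) : adm p y -> PV p (lpath y) u v <= w u v ->
     n1 (lpath y v - lpath y u) `^ gam <= D `^ gam * W.
    move=> ay Vw; have fly := PVfin_lpath p y p0 ay.
    apply: (@le_trans _ _ ((D * PV p (lpath y) u v `^ p^-1) `^ gam)).
      by apply: powR_le; [exact: ltW|exact: n1_ge0|exact: (PV_incr p (lpath y) u v p0 fly u0 uv)].
    rewrite powRM ?powR_ge0 //; apply: ler_wpM2l; first exact: powR_ge0.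
    by rewrite -powRrM [p^-1 * _]mulrC; apply: powR_le => //; exact: PV_ge0.
  have wx : PV p (lpath x) u v <= w u v.
    by rewrite /w addrCA lerDl addr_ge0 ?PV_ge0 // mulr_ge0 ?PV_ge0.
  have wx' : PV p (lpath x') u v <= w u v.
    by rewrite /w addrA lerDr addr_ge0 ?PV_ge0 // mulr_ge0 ?PV_ge0.
  have wD : (N `^ p)^-1 * PV p Dl u v <= w u v by rewrite /w lerDl addr_ge0 ?PV_ge0.
  have P1 := piece x ax wx; have P2 := piece x' ax' wx'.
  have P3 : n1 (Dl v - Dl u) <= D * (N * W).
    apply: (le_trans (PV_incr p Dl u v p0 fDl u0 uv)); apply: ler_wpM2l => //.
    have -> : PV p Dl u v = N `^ p * ((N `^ p)^-1 * PV p Dl u v).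
      by rewrite mulrA mulfV ?mul1r // gt_eqF.
    set r := _^-1 * _ in wD *.
    have r_0 : 0 <= r by rewrite mulr_ge0 ?PV_ge0.
    (* With r <= 1 and gam <= 1 the exponent 1/p may be lowered to gam/p, the exponent common to all
       terms. *)
    have r1 : r <= 1.
      rewrite /r mulrC ler_pdivrMr // mul1r; apply: le_trans VDl.
      exact: (control_mono _ 0 u v S cD).
    rewrite (powRM _ (ltW Np) r_0) NK; apply: ler_wpM2l; first exact: ltW.
    apply: (@le_trans _ _ (r `^ (gam / p))); last by apply: powR_le.
    have [->|rn] := eqVneq r 0.
      by rewrite powR0 ?powR_ge0 // gt_eqF.
    apply: ger_powR; first by rewrite lt_neqAle eq_sym rn r_0.
    by rewrite ler_piMl.
  have -> : (D + D * (2 * D `^ gam)) * (N * W) = D * (N * W) + (D * N) * (D `^ gam * W + D `^ gam * W).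
    by ring.
  apply: lerD; first by exact: P3.
  exact: (ler_pM (n1_ge0 _) (addr_ge0 (powR_ge0 _ _) (powR_ge0 _ _)) (nDl u u0 uS) (lerD P1 P2)).
have eg r : 0 <= r -> exists I, lRS h (coord z j) r I.
  move=> r0'; have [I1 h1] := RS_g x i j r H ax r0'; have [I2 h2] := RS_g x' i j r H ax' r0'.
  by exists (I1 - I2); exact: lRSB.
have AN0 : 0 <= A0 * N by rewrite mulr_ge0 // ltW.
have sS := le_trans st tS.
have hs : `|h s| <= C * (D * N).
  have bs := bound x s ax xx0 Vx s0 sS; have bs' := bound x' s ax' xx0' Vx' s0 sS.
  (* With a0 = b0 the four-point bound degenerates to a Lipschitz bound for g. *)
  have := HC i j _ _ _ _ bs bs' bs bs; rewrite !subrr !subr0 n1_0 mul0r addr0 => h1.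
  by apply: (le_trans h1); apply: ler_wpM2l => //; exact: nDl.
have wW : w s t `^ (gam / p) <= W0.
  apply: powR_le; [by rewrite mulr_ge0 // ltW|exact: cw.1|].
  apply: (le_trans (control_mono _ 0 s t S cw (lexx _) s0 st tS)); apply: lerD.
    by rewrite mulrC ler_pdivrMr // mul1r.
  apply: lerD; first exact: le_trans (PV_lpath p x S p0 S0 ax) Vx.
  exact: le_trans (PV_lpath p x' S p0 S0 ax') Vx'.
apply: (le_trans (RSint_bound w h (coord z j) p S (A0 * N) (gam / p) s t _ _
  p1 (fz j) cw AN0 (divr_gt0 gam0 p0) th1 hw s0 st tS (eg s s0) (eg t t0) hs wW)).
apply: ler_wpM2l; last exact: ctl_z.
by apply: addr_ge0; [apply: mulr_ge0 => //; apply: mulr_ge0|apply: mulr_ge0].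
Qed.

(** Left limits and left tags: the value of x at T does not enter the integrals up to T. Hence the
    equation determines the jump at T from the past. *)
Lemma Yop_ext (x0 : 'cV[R]_d) x x' T : setting p al C1 gam L f g a z ->
  adm p x -> adm p x' -> 0 <= T ->
  (forall t, 0 <= t -> t < T -> x t = x' t) -> Yop f g a z x0 x T = Yop f g a z x0 x' T.
Proof.
move=> H ax ax' T0 xx; have p0 := st_p0 H.
have lxx t : 0 <= t -> t < T -> lpath x t = lpath x' t.
  move=> t0 tT; apply/colP => i.
  apply: (left_lim_ext _ _ _ _ T (adm_left_lim p x i p0 ax) (adm_left_lim p x' i p0 ax')) => //.
    exact: le_lt_trans tT.
  by move=> r r0 rT; rewrite /coord xx.
apply/colP => i; rewrite !mxE; congr (_ + _ + _).
  by apply: (RSint_ext _ _ _ _ T0 (RS_f x i T H ax T0)) => s s0 sT; rewrite lxx.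
by apply: eq_bigr => k _; apply: (RSint_ext _ _ _ _ T0 (RS_g x i k T H ax T0)) => s s0 sT; rewrite lxx.
Qed.

Lemma Yop0 (x0 : 'cV[R]_d) x : setting p al C1 gam L f g a z -> adm p x ->
  Yop f g a z x0 x 0 = x0.
Proof.
move=> H ax; apply/colP => i; rewrite !mxE.
rewrite (lRS0 _ _ _ (RSintP _ _ _ (RS_f x i 0 H ax (lexx _)))) addr0.
by rewrite big1 ?addr0 // => k _; exact: (lRS0 _ _ _ (RSintP _ _ _ (RS_g x i k 0 H ax (lexx _)))).
Qed.

End Equation.

(** * Stopping and gluing paths *)

Section PathOperations.
Context {R : realType} {d : nat}.
Implicit Types (x y : R -> 'cV[R]_d) (p s t S T M : R).

(** Time is clamped at 0 as well, so that the stopped path is determined, at every real time, by x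
    on [0,sg]. *)
Definition stop (sg : R) x : R -> 'cV[R]_d := fun t => x (Num.max 0 (Num.min t sg)).

Lemma stopE sg x t : 0 <= t -> t <= sg -> stop sg x t = x t.
Proof. by move=> t0 ts; rewrite /stop min_l // max_r. Qed.

Lemma stop_after sg x t : 0 <= sg -> sg <= t -> stop sg x t = x sg.
Proof. by move=> s0 st; rewrite /stop min_r // max_r. Qed.

Lemma stop_ext sg x y : 0 <= sg -> (forall t, 0 <= t -> t <= sg -> x t = y t) -> stop sg x = stop sg y.
Proof.
move=> s0 H; apply/funext => t; rewrite /stop; apply: H; first by rewrite le_max lexx.
by rewrite ge_max s0 ge_min lexx orbT.
Qed.

Lemma pvb_stop p x i sg M : 0 <= sg -> pvb p (coord x i) 0 sg M ->
  forall T, pvb p (coord (stop sg x) i) 0 T M.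
Proof.
move=> s0 H T; apply: (pvb_time p (coord x i) (fun t => Num.max 0 (Num.min t sg)) 0 T 0 sg) => //.
- move=> a b _ ab _.
  have h : Num.min a sg <= Num.min b sg by rewrite le_min !ge_min ab lexx orbT.
  by rewrite ge_max !le_max lexx h orbT.
- by move=> a _ _; rewrite le_max lexx ge_max s0 ge_min lexx orbT.
Qed.

Lemma rcont_stop x i sg : 0 <= sg -> rcont (coord x i) -> rcont (coord (stop sg x) i).
Proof.
move=> sg0 H; apply: rcont_local => s s0; have [ss|ss] := ltP s sg.
  exists sg, (coord x i); split => // u su us.
  by rewrite /coord stopE // (le_trans s0).
exists (s + 1), (fun=> x sg i 0); split; [by rewrite ltrDl|exact: rcont_cst|].
by move=> u su _; rewrite /coord stop_after // (le_trans ss).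
Qed.

Lemma adm_stop p x sg : 0 <= sg -> adm p x -> adm p (stop sg x).
Proof.
move=> s0 [fx rx]; split=> i; last exact: rcont_stop.
by move=> T; have [M H] := fx i sg; exists M; exact: pvb_stop.
Qed.

Lemma PV_ext p x y s t : (forall r, s <= r -> r <= t -> x r = y r) -> s <= t ->
  PVfin p x -> 0 <= s -> PV p y s t <= PV p x s t.
Proof.
move=> xy st fx s0; apply: ler_sum => i _; apply: pv_le => //.
apply: (pvb_ext _ (coord x i)); last exact: pvfin_pvb.
by move=> r sr rt; rewrite /coord xy.
Qed.

Lemma adm_local p x : (forall T, 0 <= T -> exists y, adm p y /\
  forall t, 0 <= t -> t <= T -> x t = y t) -> adm p x.
Proof.
move=> H; split=> i.
  move=> T; have [T0|T0] := leP 0 T; last first.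
    exists 0 => n u ndu u0 uT; exfalso.
    have := lt_le_trans (le_lt_trans uT T0) u0.
    by rewrite ltNge ndu.
  have [y [ay xy]] := H T T0; have [M HM] := ay.1 i T; exists M.
  by apply: (pvb_ext _ (coord y i)) => // r r0 rT; rewrite /coord xy.
apply: rcont_local => s s0; have [|y [ay xy]] := H (s + 1); first by lra.
exists (s + 1), (coord y i); split; [by rewrite ltrDl|exact: ay.2|].
by move=> u su u1; rewrite /coord xy // (le_trans s0).
Qed.

Lemma coordB x y i : coord (fun t => x t - y t) i = fun t => coord x i t - coord y i t.
Proof. by apply/funext => t; rewrite /coord !mxE. Qed.

Lemma PVfinB p x y : 0 <= p -> PVfin p x -> PVfin p y -> PVfin p (fun t => x t - y t).
Proof.
move=> p0 fx fy i T; have [M1 H1] := fx i T; have [M2 H2] := fy i T.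
by rewrite coordB; exists (2 `^ p * (M1 + M2)); exact: pvbB.
Qed.

Lemma PVD p x y T : 0 <= p -> 0 <= T -> PVfin p x -> PVfin p y ->
  PV p (fun t => x t + y t) 0 T <= 2 `^ p * (PV p x 0 T + PV p y 0 T).
Proof.
move=> p0 T0 fx fy; rewrite /PV -big_split big_distrr /=; apply: ler_sum => i _.
apply: pv_le => //.
have -> : coord (fun t => x t + y t) i = fun t => coord x i t + coord y i t.
  by apply/funext => t; rewrite /coord !mxE.
by apply: pvbD => //; exact: pvfin_pvb.
Qed.

Lemma PV_sum_le p x T M : 0 <= T -> (forall i, pvb p (coord x i) 0 T M) -> PV p x 0 T <= d%:R * M.
Proof.
move=> T0 H; apply: (@le_trans _ _ (\sum_(i < d) M)).
  by apply: ler_sum => i _; exact: pv_le.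
by rewrite sumr_const card_ord mulr_natl.
Qed.

Lemma PV_zero p x T : 0 < p -> PVfin p x -> x 0 = 0 -> PV p x 0 T = 0 ->
  forall t, 0 <= t -> t <= T -> x t = 0.
Proof.
move=> p0 fx x0 V0 t t0 tT; have := PV_incr p x 0 t p0 fx (lexx _) t0.
have Vt : PV p x 0 t = 0.
  apply/eqP; rewrite eq_le PV_ge0 andbT -[leRHS]V0.
  exact: (control_mono _ 0 0 t T (PV_control p x fx)).
rewrite Vt powR0 ?mulr0 ?x0 ?subr0; last by rewrite gt_eqF // invr_gt0.
move=> h; apply/colP => i; rewrite mxE; apply/eqP.
by rewrite -normr_le0; apply: le_trans h; exact: n1_ge.
Qed.

End PathOperations.

(** * Auxiliary limits *)

Section Analysis.
Context {R : realType}.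

(** Variation bounded uniformly before t survives the addition of one jump at t: a chain has at most
    one step that crosses t, and after it the path is constant. *)
Lemma pvb_jump (p : R) (x : R -> R) t M c : 0 < t -> 0 < p ->
  (forall v, 0 <= v -> v < t -> pvb p x 0 v M) -> (forall u, t <= u -> x u = c) ->
  pvfin p x.
Proof.
move=> t0 p0 HM xc T.
have M0 : 0 <= M.
  apply: le_trans (HM 0 (lexx _) t0 0%N (fun=> 0) _ (lexx _) (lexx _)); last by move=> i j.
  exact: pvsum_ge0.
(* Before t the path stays within M^(1/p) of x(0), so B bounds the step that crosses t. *)
pose B := `|c - x 0| + M `^ p^-1; exists (M + B `^ p) => n u ndu u0 _.
have inc v : 0 <= v -> v < t -> `|x v - x 0| <= M `^ p^-1.
  move=> v0 vt; rewrite powR_inv_le //.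
  have := HM v v0 vt 1%N (fun i => if i is 0%N then 0 else v).
  by rewrite /pvsum big_ord1; apply => //; apply: ndS => -[|i].
have [ut|tu] := ltP (u n) t.
  apply: (@le_trans _ _ M); last by rewrite lerDl powR_ge0.
  by apply: (HM (u n)) => //; apply: le_trans u0 (ndu _ _ _).
have [j [_ jn tj jmin]] := first_index (fun i => t <= u i) 0 n (leq0n _) tu.
have xc' i : (j <= i)%N -> x (u i) = c by move=> ji; apply: xc; exact: le_trans (ndu _ _ ji).
have tail m : (j <= m)%N -> pvsum p x u m = pvsum p x u j.
  elim: m => [|m IH]; first by rewrite leqn0 => /eqP ->.
  rewrite leq_eqVlt => /orP[/eqP -> //|]; rewrite ltnS => jm.
  rewrite /pvsum big_ord_recr /= -/(pvsum p x u m) IH // !xc' ?leqW //.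
  by rewrite subrr normr0 powR0 ?addr0 // gt_eqF.
rewrite tail //; case: j tj jn jmin xc' {tail} => [|j] tj jn jmin xc'.
  by rewrite /pvsum big_ord0 addr_ge0 ?powR_ge0.
have ujt : u j < t by have := jmin j (leq0n _) (leqnn _); rewrite -ltNge.
have uj0 : 0 <= u j by apply: le_trans u0 (ndu _ _ _).
rewrite /pvsum big_ord_recr /=; apply: lerD.
  exact: (HM (u j) uj0 ujt j u ndu u0 (lexx _)).
apply: powR_le; [exact: ltW|exact: normr_ge0|rewrite xc' //].
have -> : c - x (u j) = (c - x 0) - (x (u j) - x 0) by ring.
by apply: (le_trans (ler_normB _ _)); rewrite lerD2l; exact: inc.
Qed.

Lemma rcontD (u v : R -> R) : rcont u -> rcont v -> rcont (fun t => u t + v t).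
Proof.
move=> ru rv s s0 e e0; have e20 : 0 < e / 2 by rewrite divr_gt0.
have [r r0 Hr] := ru s s0 _ e20; have [r' r'0 Hr'] := rv s s0 _ e20.
exists (Num.min r r') => [|a sa ar]; first by rewrite lt_min r0.
have [ar1 ar2] := lt_add_min _ _ _ _ ar.
have h1 : `|u a - u s| < e / 2 by exact: Hr.
have h2 : `|v a - v s| < e / 2 by exact: Hr'.
have -> : u a + v a - (u s + v s) = (u a - u s) + (v a - v s) by ring.
by apply: (le_lt_trans (ler_normD _ _)); lraof h1 h2.
Qed.

Lemma rcontN (u : R -> R) : rcont u -> rcont (fun t => - u t).
Proof.
move=> ru s s0 e e0; have [r r0 Hr] := ru s s0 e e0; exists r => // a sa ar.
by rewrite -opprD normrN; exact: Hr.
Qed.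

(** The supremum of the u(n) - b(n) lies below every u(m) + b(m), which gives a limit together with
    its rate. *)
Lemma seq_limit (u b : nat -> R) :
  (forall n m, (n <= m)%N -> `|u m - u n| <= b n) -> exists l, forall n, `|u n - l| <= b n.
Proof.
move=> H; pose A := [set u n - b n | n in setT].
have key n m : u n - b n <= u m + b m.
  have h1 := H n (maxn n m) (leq_maxl _ _); have h2 := H m (maxn n m) (leq_maxr _ _).
  move: h1 h2; rewrite !ler_distl => /andP[h1 h1'] /andP[h2 h2']; lraof h1 h1' h2 h2'.
have hA : has_sup A.
  split; first by exists (u 0%N - b 0%N), 0%N.
  by exists (u 0%N + b 0%N) => _ [n _ <-].
exists (sup A) => n; rewrite ler_distlC.
have h1 : u n - b n <= sup A by apply: sup_upper_bound => //; exists n.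
have h2 : sup A <= u n + b n by apply: ge_sup => [|_ [m _ <-] //]; exact: hA.1.
by rewrite h1 h2.
Qed.

Lemma geometric_small (c rho e : R) : 0 <= c -> 0 <= rho -> rho < 1 -> 0 < e ->
  exists n, c * rho ^+ n < e.
Proof.
move=> c0 r0 r1 e0; have c1 : 0 < c + 1 by lra.
have : (fun n => rho ^+ n) @ \oo --> (0 : R) by apply: cvg_expr; rewrite ger0_norm.
move=> /cvgrPdist_lt /(_ (e / (c + 1)) (divr_gt0 e0 c1)) [N _ HN].
exists N; have := HN N (leqnn N); rewrite /= sub0r normrN ger0_norm ?exprn_ge0 //.
rewrite ltr_pdivlMr //; have := exprn_ge0 N r0 => h h'; lraof h h'.
Qed.

End Analysis.

(** * The reflection map on vector paths *)

Section Reflection.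
Context {R : realType} {d : nat}.
Implicit Types (x y l : R -> 'cV[R]_d) (p s t S T M : R).

Definition Psi l y : R -> 'cV[R]_d :=
  fun t => y t + \col_i rmax (fun s => coord l i s - coord y i s) t.

Lemma coord_Psi l y i : coord (Psi l y) i =
  fun t => coord y i t + rmax (fun s => coord l i s - coord y i s) t.
Proof. by apply/funext => t; rewrite /coord /Psi !mxE. Qed.

Definition barrier l (x0 : 'cV[R]_d) :=
  forall i, [/\ rcont (coord l i), bounded_on (coord l i) & coord l i 0 <= x0 i 0].

Lemma adm_bounded p x i : 0 < p -> adm p x -> bounded_on (coord x i).
Proof. by move=> p0 ax; apply: cadlag_bounded; exact: adm_cadlag ax. Qed.

(** The barrier cancels in (l - y) - (l - y'), so its variation, which may be infinite, does not
    enter. *)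
Lemma Psi_lipschitz p l (x0 : 'cV[R]_d) y y' S M i : 1 <= p -> barrier l x0 -> adm p y -> adm p y' ->
  y 0 = x0 -> y' 0 = x0 -> pvb p (fun t => coord y i t - coord y' i t) 0 S M ->
  pvb p (fun t => coord (Psi l y) i t - coord (Psi l y') i t) 0 S (2 `^ p * (M + M)).
Proof.
move=> p1 hl ay ay' y0 y0' HM; have p0 : 0 < p by lra.
have [rl bl l0] := hl i.
have b1 := bounded_onB _ _ bl (adm_bounded p y i p0 ay).
have b2 := bounded_onB _ _ bl (adm_bounded p y' i p0 ay').
have K : pvb p (fun t => rmax (fun s => coord l i s - coord y i s) t -
                         rmax (fun s => coord l i s - coord y' i s) t) 0 S M.
  apply: rmax_lipschitz => //.
  - by rewrite /coord y0 y0'.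
  - by rewrite /coord y0 subr_le0.
  - apply: pvb_ext (pvbN _ _ _ _ _ HM) => r _ _; ring.
have := pvbD _ _ _ _ _ _ _ (ltW p0) HM K.
by apply: pvb_ext => r _ _; rewrite !coord_Psi; ring.
Qed.

Lemma adm_Psi p l (x0 : 'cV[R]_d) y : 1 <= p -> barrier l x0 -> adm p y -> adm p (Psi l y).
Proof.
move=> p1 hl ay; have p0 : 0 < p by lra.
split=> i; rewrite coord_Psi; have [rl bl _] := hl i.
  have b1 := bounded_onB _ _ bl (adm_bounded p y i p0 ay).
  move=> T; have [M1 H1] := ay.1 i T; have [M2 H2] := rmax_pvfin _ b1 p p1 T.
  by exists (2 `^ p * (M1 + M2)); apply: pvbD => //; exact: ltW.
have b1 := bounded_onB _ _ bl (adm_bounded p y i p0 ay).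
apply: rcontD; first exact: ay.2.
apply: rmax_rcont => //; apply: rcontD => //; apply: rcontN; exact: ay.2.
Qed.

Lemma Psi0 p l (x0 : 'cV[R]_d) y : 0 < p -> barrier l x0 -> adm p y -> y 0 = x0 -> Psi l y 0 = x0.
Proof.
move=> p0 hl ay y0; apply/colP => i; rewrite /Psi !mxE y0.
have [_ bl l0] := hl i.
rewrite rmax0 ?addr0 //; last by rewrite /coord y0 subr_le0.
exact: (bounded_onB _ _ bl (adm_bounded p y i p0 ay)).
Qed.

Lemma Psi_ext l y y' t : (forall s, 0 <= s -> s <= t -> y s = y' s) -> 0 <= t ->
  Psi l y t = Psi l y' t.
Proof.
move=> H t0; apply/colP => i; rewrite /Psi !mxE H //; congr (_ + _).
by apply: rmax_ext => s s0 st; rewrite /coord H.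
Qed.

End Reflection.

Lemma le_half {R : realType} (v : R) : v <= 2^-1 * v -> v <= 0.
Proof. lra. Qed.


(** Every level from 2c + 1 on is preserved by a growth estimate with small factor: this keeps the
    Picard iterates in one ball. *)
Lemma growth_closed {R : realType} (c u v : R) : u <= 2^-1 -> 0 <= v -> 2 * c + 1 <= v ->
  c + u * (1 + v) <= v.
Proof.
move=> u2 v0 cv; have : u * (1 + v) <= 2^-1 * (1 + v) by apply: ler_wpM2r => //; lra.
lra.
Qed.

(** The same estimate read as an a priori bound, for a solution instead of an iterate. *)
Lemma growth_bound {R : realType} (c u v : R) : u <= 2^-1 -> 0 <= v -> v <= c + u * (1 + v) ->
  v <= 2 * c + 1.
Proof.
move=> u2 v0 cv; have : u * (1 + v) <= 2^-1 * (1 + v) by apply: ler_wpM2r => //; lra.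
lra.
Qed.

Lemma small_factor {R : realType} (K e u : R) : 0 <= K -> 0 <= e -> 0 <= u -> u <= e / (K + 1) ->
  K * u <= e.
Proof.
move=> K0 e0 u0; have K1 : 0 < K + 1 by lra.
by rewrite ler_pdivlMr // => h; apply: le_trans h; lra.
Qed.

(** * Limits of geometrically converging paths *)

Section Picard.
Context {R : realType} {d : nat}.
Implicit Types (X : nat -> R -> 'cV[R]_d).

Lemma PV_sub_self (p : R) (x : R -> 'cV[R]_d) S : 0 < p -> 0 <= S ->
  PV p (fun t => x t - x t) 0 S <= 0.
Proof.
move=> p0 S0; rewrite -[leRHS](mulr0 d%:R); apply: PV_sum_le => // i n u _ _ _.
rewrite /pvsum big1 // => j _.
by rewrite coordB !subrr normr0 powR0 // gt_eqF.
Qed.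

Lemma PV_diff_value (p : R) (x y : R -> 'cV[R]_d) S M t i : 0 < p -> PVfin p x -> PVfin p y ->
  x 0 = y 0 -> PV p (fun t => x t - y t) 0 S <= M -> 0 <= t -> t <= S ->
  `|x t i 0 - y t i 0| <= M `^ p^-1.
Proof.
move=> p0 fx fy xy VM t0 tS.
have fD := PVfinB p x y (ltW p0) fx fy.
have M0 : 0 <= M by exact: le_trans (PV_ge0 _ _ _ _) VM.
rewrite powR_inv_le //; apply: le_trans VM.
apply: (le_trans _ (control_mono _ 0 0 t S (PV_control p _ fD) (lexx _) (lexx _) t0 tS)).
apply: (le_trans _ (pv_PV p _ i 0 t)).
have := pv_incr p _ 0 t (fD i) (lexx _) t0.
by rewrite coordB /coord xy subrr subr0.
Qed.

(** The rate rho satisfies 2 b rho = 1, where b = 2^p is the factor lost at each use of the triangle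
    inequality. In G the factor d + 1 covers the passage from each coordinate to their sum and keeps
    G positive when d = 0. *)
Lemma picard_limit (p : R) X S A (r0 : R) : 0 < p -> 0 < S -> 0 < A ->
  let b := 2 `^ p in let rho := (2 * b)^-1 in let G n := (d%:R + 1) * (2 * b * (A * rho ^+ n)) in
  (forall n, adm p (X n)) -> (forall n, X n 0 = X 0%N 0) -> (forall n, PV p (X n) 0 S <= r0) ->
  (forall n, PV p (fun t => X n.+1 t - X n t) 0 S <= A * rho ^+ n) ->
  exists x, [/\ adm p x, PV p x 0 S <= d%:R * r0,
    (forall n, PV p (fun t => x t - X n t) 0 S <= G n),
    (forall n t i, 0 <= t -> t <= S -> `|X n t i 0 - x t i 0| <= G n `^ p^-1) &
    forall e, 0 < e -> exists n, G n `^ p^-1 < e /\ G n.+1 `^ p^-1 < e].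
Proof.
move=> p0 S0 A0 b rho G aX X0 VX DX.
have S0' := ltW S0; have p00 := ltW p0.
have b1 : 1 <= b by rewrite /b -[leLHS](powRr0 2) ler_powR // ler1n.
have b0 : 0 < 2 * b by apply: mulr_gt0 => //; exact: lt_le_trans b1.
have rho0 : 0 < rho by rewrite invr_gt0.
have rho1 : rho < 1 by rewrite invf_lt1 //; lra.
have brho : 2 * b * rho = 1 by rewrite mulfV // gt_eqF.
have d1 : 1 <= d%:R + 1 :> R by rewrite lerDr ler0n.
have Ar0 n : 0 < 2 * b * (A * rho ^+ n) by apply: mulr_gt0 => //; apply: mulr_gt0 => //; exact: exprn_gt0.
have G0 n : 0 < G n by apply: mulr_gt0 => //; exact: lt_le_trans d1.
have G1 n : 2 * b * (A * rho ^+ n) <= G n by rewrite ler_peMl // ltW.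
have Gd n : d%:R * (2 * b * (A * rho ^+ n)) <= G n.
  by rewrite /G ler_pM2r // lerDl.
have GS n m : (n <= m)%N -> G m <= G n.
  move=> nm; apply: ler_wpM2l; first exact: le_trans d1.
  apply: ler_wpM2l; first exact: ltW.
  apply: ler_wpM2l; first exact: ltW.
  by apply: ler_wiXn2l => //; exact: ltW.
have bsmall e : 0 < e -> exists n, forall k, (n <= k)%N -> G k `^ p^-1 < e.
  move=> e0; have ip0 : 0 < p^-1 by rewrite invr_gt0.
  have [r r_0 Hr] := powR_small p^-1 e ip0 e0.
  have GE n : G n = (d%:R + 1) * (2 * b * A) * rho ^+ n by rewrite /G; ring.
  have cp : 0 <= (d%:R + 1) * (2 * b * A).
    apply: mulr_ge0; first exact: le_trans d1.
    by apply: mulr_ge0; exact: ltW.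
  have [n Hn] := geometric_small _ rho r cp (ltW rho0) rho1 r_0.
  exists n => k nk; apply: Hr; first exact: ltW.
  by apply: (le_lt_trans (GS n k nk)); rewrite GE.
have cauchy m : forall n, PV p (fun t => X (m + n)%N t - X n t) 0 S <= 2 * b * (A * rho ^+ n).
  elim: m => [|m IH] n; first by apply: (le_trans (PV_sub_self p (X n) S p0 S0')); exact: ltW.
  have -> : (fun t => X (m.+1 + n)%N t - X n t) =
     fun t => (X n.+1 t - X n t) + (X (m + n.+1)%N t - X n.+1 t).
    by apply/funext => t; rewrite addSnnS [RHS]addrC addrA subrK.
  apply: (le_trans (PVD p _ _ S p00 S0' (PVfinB p _ _ p00 (aX _).1 (aX _).1)
    (PVfinB p _ _ p00 (aX _).1 (aX _).1))).
  (* The tail bound reproduces itself: one step plus the next tail, multiplied by b, gives exactly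
     the same form. *)
  have -> : 2 * b * (A * rho ^+ n) = b * (A * rho ^+ n + 2 * b * rho * (A * rho ^+ n)).
    by rewrite brho; ring.
  apply: ler_wpM2l; first exact: powR_ge0.
  apply: lerD; first exact: DX.
  apply: (le_trans (IH n.+1)); rewrite exprS le_eqVlt; apply/orP; left; apply/eqP; ring.
have value n m t i : (n <= m)%N -> 0 <= t -> t <= S -> `|X m t i 0 - X n t i 0| <= G n `^ p^-1.
  move=> nm t0 tS; apply: (PV_diff_value p (X m) (X n) S _ t i p0 (aX _).1 (aX _).1) => //.
    by rewrite !X0.
  by apply: le_trans (G1 n); rewrite -(subnK nm); exact: cauchy.
have lims (ti : R * 'I_d) : exists v, 0 <= ti.1 -> ti.1 <= S ->
    forall n, `|X n ti.1 ti.2 0 - v| <= G n `^ p^-1.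
  have [t0|t0] := boolP ((0 <= ti.1) && (ti.1 <= S)); last first.
    by exists 0 => h1 h2; rewrite h1 h2 in t0.
  have /andP[h1 h2] := t0.
  have [v Hv] := seq_limit (fun n => X n ti.1 ti.2 0) (fun n => G n `^ p^-1)
     (fun n m nm => value n m ti.1 ti.2 nm h1 h2).
  by exists v.
have [F HF] := choice lims.
(* Limits exist on [0,S] only; stopping at S defines the path for all times. *)
pose raw t : 'cV[R]_d := \col_i F (t, i); pose x := stop S raw.
have close n t i : 0 <= t -> t <= S -> `|X n t i 0 - x t i 0| <= G n `^ p^-1.
  by move=> t0 tS; rewrite /x stopE // mxE; exact: (HF (t, i)).
have cvg i t e : 0 <= t -> t <= S -> 0 < e ->
    exists K, forall k, (K <= k)%N -> `|X k t i 0 - x t i 0| < e.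
  move=> t0 tS e0; have [K HK] := bsmall e e0; exists K => k Kk.
  exact: le_lt_trans (close k t i t0 tS) (HK k Kk).
have pvx i : pvb p (coord x i) 0 S r0.
  apply: (pvb_lim p (fun k => coord (X k) i)) => //.
    move=> k; apply: (pvb_mono _ _ 0 S 0 S (pv p (coord (X k) i) 0 S)) => //.
      by apply: pvfin_pvb => //; exact: (aX k).1.
    by apply: le_trans (pv_PV p (X k) i 0 S) (VX k).
  by move=> t t0 tS e e0; exact: cvg.
have xS t : S <= t -> x t = raw S by move=> St; rewrite /x stop_after.
have ax : adm p x.
  split=> i.
    move=> T; exists r0.
    apply: pvb_stop => //; apply: pvb_ext (pvx i) => t t0 tS.
    by rewrite /coord /x stopE.
  move=> s s0 e e0; have [sS|Ss] := ltP s S; last first.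
    exists 1 => // u su _; rewrite /coord !xS ?subrr ?normr0 //.
    exact: le_trans (ltW su).
  (* The convergence is uniform on [0,S], so right continuity passes to the limit. *)
  have e30 : 0 < e / 3 by rewrite divr_gt0.
  have [n Hn] := bsmall _ e30; have {}Hn := Hn n (leqnn n).
  have [r r_0 Hr] := (aX n).2 i s s0 _ e30.
  exists (Num.min r (S - s)) => [|u su ur]; first by rewrite lt_min r_0 subr_gt0.
  have u0 : 0 <= u by exact: le_trans (ltW su).
  have [ur' uS] := lt_add_min _ _ _ _ ur; rewrite addrC subrK in uS; move/ltW in uS.
  have h1 : `|coord (X n) i u - coord (X n) i s| < e / 3 by exact: Hr.
  have h2 := close n u i u0 uS; have h3 := close n s i s0 (ltW sS).
  have -> : coord x i u - coord x i s = (coord (X n) i u - coord (X n) i s) -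
     (X n u i 0 - x u i 0) + (X n s i 0 - x s i 0) by rewrite /coord; ring.
  apply: (le_lt_trans (ler_normD _ _)).
  apply: (le_lt_trans (lerD (ler_normB _ _) (lexx _))).
  by move: h1 h2 h3 Hn; clear; lra.
exists x; split => //.
- exact: PV_sum_le.
- move=> n; apply: le_trans (Gd n); apply: PV_sum_le => // i.
  apply: (pvb_lim p (fun k => coord (fun t => X (k + n)%N t - X n t) i)) => //.
    move=> k; have fD := PVfinB p _ _ p00 (aX (k + n)%N).1 (aX n).1.
    apply: (pvb_mono _ _ 0 S 0 S _ _ (pvfin_pvb _ _ 0 S (fD i) (lexx _))) => //.
    exact: le_trans (pv_PV p _ i 0 S) (cauchy k n).
  move=> t t0 tS e e0; have [K HK] := cvg i t e t0 tS e0; exists K => k Kk.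
  rewrite !coordB /coord opprB addrA subrK; apply: HK.
  exact: leq_trans (leq_addr _ _).
- by move=> e e0; have [n Hn] := bsmall e e0; exists n; rewrite !Hn.
Qed.

End Picard.

(** * Fixed points: uniqueness, continuation and global existence *)

Section Solutions.
Context {R : realType} {d : nat}.
Context {p al C1 gam L : R} {f : 'cV[R]_d -> 'cV[R]_d} {g : 'cV[R]_d -> 'M[R]_d}
  {a : R -> R} {z l : R -> 'cV[R]_d} {x0 : 'cV[R]_d}.
Implicit Types (x y : R -> 'cV[R]_d).
Hypothesis H : setting p al C1 gam L f g a z.
Hypothesis hl : barrier l x0.

Let Y x := Yop f g a z x0 x.
Let c := ctl p a z.

Definition Phi x := Psi l (Yop f g a z x0 x).

Let p0 : 0 < p := st_p0 H.
Let p1 : 1 <= p := st_p H.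
Let p00 : 0 <= p := ltW p0.
Let cc : control c := ctl_control H.

Lemma ctl_right_small : right_small (ctl p a z).
Proof.
have [ra fa] := st_a H; have [fz rz] := st_z H.
apply: right_smallD; last by apply: right_small_sum => j; exact: pv_right_small0.
move=> s s0 e e0; have [r r0 Hr] := powR_small p e p0 e0.
have r20 : 0 < r / 2 by rewrite divr_gt0.
have [r' r'0 Hr'] := pv_right_small0 1 a ltr01 fa ra s s0 _ r20; exists r' => // t st td.
apply/ltW/Hr; first exact: pv_ge0.
by apply: (le_lt_trans (Hr' t st td)); rewrite ltr_pdivrMr // mulr_natr mulr2n ltrDl.
Qed.

Lemma adm_Yop x : adm p x -> x 0 = x0 -> adm p (Yop f g a z x0 x).
Proof.
move=> ax xx0; have [Q Q0 HQ] := Yop_growth x0 H.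
have A0 T : 0 <= Q * (1 + PV p x 0 T `^ p^-1) by rewrite mulr_ge0 // addr_ge0 ?powR_ge0.
split=> i.
  move=> T; eexists; apply: (controlled_pvb p _ c _ 0 T p0 cc (A0 T) (lexx _)).
  by move=> s t s0 st tT; exact: HQ.
apply: (controlled_rcont p _ c p0 cc ctl_right_small) => T T0.
by eexists; [exact: A0|exact: HQ].
Qed.

Lemma adm_Phi x : adm p x -> x 0 = x0 -> adm p (Phi x).
Proof. by move=> ax xx0; exact: (adm_Psi p l x0 _ p1 hl (adm_Yop x ax xx0)). Qed.

Lemma Phi0 x : adm p x -> x 0 = x0 -> Phi x 0 = x0.
Proof.
by move=> ax xx0; exact: (Psi0 p l x0 _ p0 hl (adm_Yop x ax xx0) (Yop0 x0 x H ax)).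
Qed.

Lemma Phi_ext x x' T : adm p x -> adm p x' -> 0 <= T ->
  (forall t, 0 <= t -> t < T -> x t = x' t) -> Phi x T = Phi x' T.
Proof.
move=> ax ax' T0 xx; apply: Psi_ext => // s s0 sT.
by apply: (Yop_ext _ _ _ _ H) => // r r0 rs; apply: xx => //; exact: lt_le_trans sT.
Qed.

Let Psi_le y y' S M : 0 <= S -> adm p y -> adm p y' -> y 0 = x0 -> y' 0 = x0 ->
  (forall i, pvb p (fun t => coord y i t - coord y' i t) 0 S M) ->
  PV p (fun t => Psi l y t - Psi l y' t) 0 S <= d%:R * (2 `^ p * (M + M)).
Proof.
move=> S0 ay ay' y0 y0' HM; apply: PV_sum_le => // i; rewrite coordB.
exact: (Psi_lipschitz p l x0).
Qed.

(** Paths that agree up to sg have images that agree up to sg, so only the mass of the control on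
    [sg,S] multiplies their distance. *)
Lemma Phi_contraction (r0 : R) : 0 <= r0 -> exists2 K, 0 <= K &
  forall x x' sg S N, adm p x -> adm p x' -> x 0 = x0 -> x' 0 = x0 -> 0 < N ->
  0 <= sg -> sg <= S ->
  PV p x 0 S <= r0 -> PV p x' 0 S <= r0 -> PV p (fun t => x t - x' t) 0 S <= N `^ p ->
  (forall t, 0 <= t -> t <= sg -> x t = x' t) ->
  PV p (fun t => Phi x t - Phi x' t) 0 S <= K * c sg S * N `^ p.
Proof.
move=> r00; have [Q Q0 HQ] := Yop_contraction x0 r0 H r00.
exists (d%:R * (2 `^ p * (Q `^ p + Q `^ p))).
  by rewrite mulr_ge0 // mulr_ge0 ?powR_ge0 // addr_ge0 ?powR_ge0.
move=> x x' sg S N ax ax' xx0 xx0' N0 sg0 sgS Vx Vx' VD agree.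
have S0 := le_trans sg0 sgS.
have QN0 : 0 <= Q * N by rewrite mulr_ge0 // ltW.
have := Psi_le (Y x) (Y x') S ((Q * N) `^ p * c sg S) S0 (adm_Yop x ax xx0) (adm_Yop x' ax' xx0')
  (Yop0 x0 x H ax) (Yop0 x0 x' H ax').
have -> : d%:R * (2 `^ p * ((Q * N) `^ p * c sg S + (Q * N) `^ p * c sg S)) =
  d%:R * (2 `^ p * (Q `^ p + Q `^ p)) * c sg S * N `^ p by rewrite powRM ?(ltW N0) //; ring.
apply=> i; apply: controlled_pvb_zero => //.
  move=> s t sgs st tS.
  by apply: (HQ x x' ax ax' xx0 xx0' S N N0 Vx Vx' VD i) => //; exact: le_trans sgs.
move=> t t0 tsg; rewrite /coord /Y (Yop_ext x0 x x' t H ax ax' t0) ?subrr // => r r_0 rt.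
by apply: agree => //; exact: le_trans (ltW rt) tsg.
Qed.

(** The image is compared with the reflection of its input stopped at sg. The stopped part depends
    only on x up to sg; the rest carries the factor [c sg S], small on short intervals, and is
    linear in the variation of x. *)
Lemma Phi_growth : exists2 K, 0 <= K & forall x sg S T, adm p x -> x 0 = x0 ->
  0 <= sg -> sg <= S -> S <= T ->
  PV p (Phi x) 0 S <= 2 `^ p * PV p (Psi l (stop sg (Yop f g a z x0 x))) 0 T +
    K * c sg S * (1 + PV p x 0 S).
Proof.
have [Q Q0 HQ] := Yop_growth x0 H.
pose B := Q `^ p * 2 `^ p; have B0 : 0 <= B by rewrite mulr_ge0 ?powR_ge0.
exists (2 `^ p * (d%:R * (2 `^ p * (B + B)))).
  by rewrite !mulr_ge0 ?powR_ge0 // addr_ge0.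
move=> x sg S T ax xx0 sg0 sgS ST.
have S0 := le_trans sg0 sgS.
set V := PV p x 0 S; have V0 : 0 <= V by exact: PV_ge0.
set y := Yop f g a z x0 x; have ay : adm p y := adm_Yop x ax xx0.
have as_ := adm_stop p y sg sg0 ay.
have y0 : y 0 = x0 := Yop0 x0 x H ax.
have ys0 : stop sg y 0 = x0 by rewrite stopE.
pose A := Q * (1 + V `^ p^-1).
have A0 : 0 <= A by rewrite mulr_ge0 // addr_ge0 ?powR_ge0.
have cS0 : 0 <= c sg S by exact: cc.1.
have Ap : A `^ p <= B * (1 + V).
  rewrite /A powRM ?addr_ge0 ?powR_ge0 // /B -mulrA; apply: ler_wpM2l; first exact: powR_ge0.
  have := powR_sum_le p 1 (V `^ p^-1) p00 ler01 (powR_ge0 _ _).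
  by rewrite powRK // powR1.
have diff := Psi_le y (stop sg y) S (A `^ p * c sg S) S0 ay as_ y0 ys0.
have {}diff : PV p (fun t => Psi l y t - Psi l (stop sg y) t) 0 S <=
   d%:R * (2 `^ p * (A `^ p * c sg S + A `^ p * c sg S)).
  apply: diff => i; apply: controlled_pvb_zero => //.
    move=> s t sgs st tS; rewrite /coord !(stop_after sg y) //; last exact: le_trans st.
    have -> : y t i 0 - y sg i 0 - (y s i 0 - y sg i 0) = coord y i t - coord y i s.
      by rewrite /coord; ring.
    by apply: HQ => //; exact: le_trans sgs.
  by move=> t t0 tsg; rewrite /coord stopE // subrr.
have aPsi := adm_Psi p l x0 y p1 hl ay; have aPsi' := adm_Psi p l x0 (stop sg y) p1 hl as_.
have fD := PVfinB p _ _ p00 aPsi.1 aPsi'.1.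
have -> : Phi x = fun t => Psi l (stop sg y) t + (Psi l y t - Psi l (stop sg y) t).
  by apply/funext => t; rewrite addrC subrK.
apply: (le_trans (PVD p _ _ S p00 S0 aPsi'.1 fD)).
rewrite mulrDr; apply: lerD.
  apply: ler_wpM2l; first exact: powR_ge0.
  exact: (control_mono _ 0 0 S T (PV_control p _ aPsi'.1)).
rewrite -!mulrA; apply: ler_wpM2l; first exact: powR_ge0.
apply: (le_trans diff); apply: ler_wpM2l; first exact: ler0n.
apply: ler_wpM2l; first exact: powR_ge0.
have -> : (B + B) * (c sg S * (1 + V)) = B * (1 + V) * c sg S + B * (1 + V) * c sg S by ring.
by apply: lerD; apply: ler_wpM2r.
Qed.

Definition sol S x := [/\ adm p x, x 0 = x0 & forall t, 0 <= t -> t <= S -> x t = Phi x t].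

Lemma sol_le S S' x : S' <= S -> sol S x -> sol S' x.
Proof.
by move=> SS [ax xx0 Hx]; split => // t t0 tS; apply: Hx => //; exact: le_trans SS.
Qed.

Lemma sol_unique S x x' : sol S x -> sol S x' -> forall t, 0 <= t -> t <= S -> x t = x' t.
Proof.
move=> [ax xx0 Hx] [ax' xx0' Hx'].
have [S0|S0] := ltP 0 S; last first.
  move=> t t0 tS; have -> : t = 0 by apply/eqP; rewrite eq_le t0 (le_trans tS S0).
  by rewrite xx0 xx0'.
pose r0 := Num.max (PV p x 0 S) (PV p x' 0 S).
have r00 : 0 <= r0 by rewrite le_max PV_ge0.
have [K K0 HK] := Phi_contraction r0 r00.
have K10 : 0 < 2^-1 / (K + 1) :> R by apply: divr_gt0; [rewrite invr_gt0|exact: ltr_wpDl K0 ltr01].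
pose agree v := forall t, 0 <= t -> t <= v -> x t = x' t.
have step s v : 0 <= s -> s <= v -> v <= S -> c s v <= 2^-1 / (K + 1) -> agree s -> agree v.
  move=> s0 sv vS csv As; have v0 := le_trans s0 sv.
  have Vle y : adm p y -> PV p y 0 v <= PV p y 0 S.
    by move=> ay; exact: (control_mono _ 0 0 v S (PV_control p y ay.1)).
  set D := fun t => x t - x' t.
  have fD : PVfin p D by exact: PVfinB ax.1 ax'.1.
  have VD : PV p D 0 v = 0.
    apply/eqP; rewrite eq_le PV_ge0 andbT leNgt; apply/negP => Vp.
    (* N^p is the variation V of the difference itself, so that the contraction reads V <= V/2. *)
    have N0 : 0 < PV p D 0 v `^ p^-1 by exact: powR_gt0.
    have VN : PV p D 0 v <= (PV p D 0 v `^ p^-1) `^ p by rewrite powRK // PV_ge0.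
    have h1 : PV p x 0 v <= r0 by apply: (le_trans (Vle x ax)); rewrite le_max lexx.
    have h2 : PV p x' 0 v <= r0 by apply: (le_trans (Vle x' ax')); rewrite le_max lexx orbT.
    have := HK x x' s v _ ax ax' xx0 xx0' N0 s0 sv h1 h2 VN As.
    rewrite powRK ?PV_ge0 // => h3.
    have fD' := PVfinB p _ _ p00 (adm_Phi x ax xx0).1 (adm_Phi x' ax' xx0').1.
    have h4 : PV p D 0 v <= PV p (fun t => Phi x t - Phi x' t) 0 v.
      apply: PV_ext => // r r_0 rv; rewrite /D.
      by rewrite (Hx r r_0 (le_trans rv vS)) (Hx' r r_0 (le_trans rv vS)).
    have h5 : K * c s v * PV p D 0 v <= 2^-1 * PV p D 0 v.
      by apply: ler_wpM2r; [exact: PV_ge0|apply: (small_factor K); rewrite ?invr_ge0 //; exact: cc.1].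
    by have := le_half _ (le_trans h4 (le_trans h3 h5)); rewrite leNgt Vp.
  have D0 : D 0 = 0 by rewrite /D xx0 xx0' subrr.
  move=> t t0 tv; apply/eqP; rewrite -subr_eq0; apply/eqP.
  exact: (PV_zero p D v p0 fD D0 VD t t0 tv).
suff : S <= S -> agree 0 -> agree S.
  by apply => // t t0 t0'; have -> : t = 0; [apply/eqP; rewrite eq_le t0 t0'|rewrite xx0 xx0'].
apply: (interval_induction (fun s t => t <= S -> agree s -> agree t)) => //.
- move=> r s t r_0 rs st Prs Pst tS Ar; apply: Pst => //; apply: Prs => //.
  exact: le_trans (ltW st) tS.
- move=> s s0; have [e e0 He] := ctl_right_small s s0 _ K10; exists e => // t st te tS As.
  by apply: (step s t s0 (ltW st) tS (He t (ltW st) te) As).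
(* The control is small on intervals that stop before t but may jump at t. The contraction gives
   agreement before t, and the equation itself at t. *)
- move=> t t0; have [e e0 He] := control_left_small _ t _ cc t0 K10; exists e => // s s0 ts st tS As.
  have A' v : 0 <= v -> v < t -> x v = x' v.
    move=> v0 vt; have [vs|sv] := leP v s; first exact: As.
    have vS : v <= S by exact: le_trans (ltW vt) tS.
    exact: (step s v s0 (ltW sv) vS (ltW (He s v s0 ts (ltW sv) vt)) As v v0 (lexx _)).
  move=> v v0; rewrite le_eqVlt => /orP[/eqP ->|vt]; last exact: A'.
  by rewrite (Hx t (ltW t0) tS) (Hx' t (ltW t0) tS); exact: (Phi_ext x x' t ax ax' (ltW t0) A').
Qed.

Lemma PV_stop x S : 0 <= S -> adm p x -> forall T, 0 <= T -> PV p (stop S x) 0 T <= PV p x 0 S.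
Proof.
move=> S0 ax T T0; apply: ler_sum => i _; apply: pv_le => //.
by apply: pvb_stop => //; apply: pvfin_pvb => //; exact: ax.1.
Qed.

(** Picard iteration started from x stopped at sg; all iterates agree with x up to sg, and right
    smallness of the control at sg makes the map contract. *)
Lemma sol_extend sg x : 0 <= sg -> sol sg x -> exists2 e, 0 < e &
  forall S, sg < S -> S < sg + e -> exists x', sol S x'.
Proof.
move=> sg0 [ax xx0 Hx].
have [Kg Kg0 HKg] := Phi_growth.
pose b : R := 2 `^ p; pose rho := (2 * b)^-1.
have b1 : 1 <= b by rewrite /b -[leLHS](powRr0 2) ler_powR // ler1n.
have b0 : 0 < 2 * b by apply: mulr_gt0 => //; exact: lt_le_trans b1.
have rho0 : 0 < rho by rewrite invr_gt0.
have rho1 : rho <= 1 by rewrite invf_le1 // (le_trans b1) // ler_peMl ?ler1n // (le_trans _ b1).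
pose c0 := b * PV p (Psi l (stop sg (Yop f g a z x0 x))) 0 (sg + 1).
pose r0 := Num.max (PV p x 0 sg) (2 * c0 + 1).
have r00 : 0 <= r0 by rewrite le_max PV_ge0.
(* The iterates stay in the ball of radius r0, their limit in that of radius d r0; r1 covers
   both. *)
pose r1 := r0 + d%:R * r0.
have dr0 : 0 <= d%:R * r0 by rewrite mulr_ge0.
have r01 : r0 <= r1 by rewrite lerDl.
have dr01 : d%:R * r0 <= r1 by rewrite lerDr.
have [K K0 HK] := Phi_contraction r1 (le_trans r00 r01).
(* Two smallness conditions: the first keeps the iterates in the ball, the second brings the
   contraction factor down to rho. *)
have [e1 e10 He1] := ctl_right_small sg sg0 (2^-1 / (Kg + 1))
  (divr_gt0 (ltac:(by rewrite invr_gt0) : 0 < 2^-1 :> R) (ltr_wpDl Kg0 ltr01)).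
have [e2 e20 He2] := ctl_right_small sg sg0 (rho / (K + 1))
  (divr_gt0 rho0 (ltr_wpDl K0 ltr01)).
exists (Num.min 1 (Num.min e1 e2)) => [|S sgS Se]; first by rewrite !lt_min ltr01 e10 e20.
have sgS' := ltW sgS; have S0 := le_lt_trans sg0 sgS; have S0' := ltW S0.
have [/ltW S1 /lt_add_min[Se1 Se2]] := lt_add_min _ _ _ _ Se.
have cS0 : 0 <= c sg S by exact: cc.1.
have Kgc : Kg * c sg S <= 2^-1.
  have h2 : 0 <= 2^-1 :> R by rewrite invr_ge0.
  apply: (small_factor _ _ _ Kg0 h2 cS0).
  exact: He1.
have Kc : K * c sg S <= rho.
  apply: (small_factor _ _ _ K0 (ltW rho0) cS0).
  exact: He2.
pose X := fix X n := if n is m.+1 then stop S (Phi (X m)) else stop sg x.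
have inv n : [/\ adm p (X n), X n 0 = x0, (forall t, 0 <= t -> t <= sg -> X n t = x t) &
   PV p (X n) 0 S <= r0].
  elim: n => [|n [an n0 nx nV]].
    split; [exact: adm_stop|by rewrite /= stopE|by move=> t t0 ts; rewrite /= stopE|].
    by apply: (le_trans (PV_stop x sg sg0 ax S S0')); rewrite le_max lexx.
  have aF := adm_Phi (X n) an n0.
  split=> /=.
  - exact: adm_stop.
  - by rewrite stopE //; exact: (Phi0 (X n) an n0).
  - move=> t t0 ts; rewrite stopE ?(le_trans ts sgS') // (Hx t t0 ts).
    by apply: (Phi_ext (X n) x t an ax t0) => r r_0 rt; apply: nx => //; exact: le_trans (ltW rt) ts.
  - apply: (le_trans (PV_stop _ S S0' aF S S0')).
    apply: (le_trans (HKg (X n) sg S (sg + 1) an n0 sg0 sgS' S1)).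
    (* The constant c0 was computed from x; it serves all iterates, which agree with x up to sg. *)
    have -> : stop sg (Yop f g a z x0 (X n)) = stop sg (Yop f g a z x0 x).
      apply: stop_ext => // t t0 ts; apply: (Yop_ext x0 (X n) x t H an ax t0) => r r_0 rt.
      by apply: nx => //; exact: le_trans (ltW rt) ts.
    apply: (@le_trans _ _ (c0 + Kg * c sg S * (1 + r0))).
      rewrite lerD2l; apply: ler_wpM2l; first by rewrite mulr_ge0.
      by rewrite lerD2l.
    by apply: growth_closed => //; rewrite le_max lexx orbT.
have aX n : adm p (X n) by case: (inv n).
have X0 n : X n 0 = x0 by case: (inv n).
have VX n : PV p (X n) 0 S <= r0 by case: (inv n).
have Xx n t : 0 <= t -> t <= sg -> X n t = x t by case: (inv n) => _ _ h _; exact: h.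
have XS n t : 0 <= t -> t <= S -> X n.+1 t = Phi (X n) t by move=> t0 tS; rewrite /= stopE.
pose A := PV p (fun t => X 1%N t - X 0%N t) 0 S + 1.
have A0 : 0 < A by rewrite ltr_wpDl ?PV_ge0.
have An n : 0 < A * rho ^+ n by apply: mulr_gt0 => //; exact: exprn_gt0.
have contract y y' M : adm p y -> adm p y' -> y 0 = x0 -> y' 0 = x0 -> 0 < M ->
   PV p y 0 S <= r1 -> PV p y' 0 S <= r1 -> PV p (fun t => y t - y' t) 0 S <= M ->
   (forall t, 0 <= t -> t <= sg -> y t = y' t) ->
   PV p (fun t => Phi y t - Phi y' t) 0 S <= rho * M.
  move=> ay ay' y0 y0' M0 Vy Vy' VD yy.
  have N0 : 0 < M `^ p^-1 by exact: powR_gt0.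
  have VN : PV p (fun t => y t - y' t) 0 S <= (M `^ p^-1) `^ p by rewrite powRK // ltW.
  apply: (le_trans (HK y y' sg S _ ay ay' y0 y0' N0 sg0 sgS' Vy Vy' VN yy)).
  by rewrite powRK ?(ltW M0) //; apply: ler_wpM2r => //; exact: ltW.
have DX n : PV p (fun t => X n.+1 t - X n t) 0 S <= A * rho ^+ n.
  elim: n => [|n IH]; first by rewrite expr0 mulr1 lerDl.
  have fD := PVfinB p _ _ p00 (adm_Phi _ (aX n.+1) (X0 n.+1)).1 (adm_Phi _ (aX n) (X0 n)).1.
  apply: (le_trans (PV_ext p _ _ 0 S _ S0' fD (lexx _))).
    by move=> t t0 tS; rewrite (XS n.+1 t t0 tS) (XS n t t0 tS).
  have -> : A * rho ^+ n.+1 = rho * (A * rho ^+ n) by rewrite exprS; ring.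
  apply: (contract (X n.+1) (X n) _ (aX _) (aX _) (X0 _) (X0 _) (An n)
    (le_trans (VX _) r01) (le_trans (VX _) r01) IH) => t t0 ts.
  by rewrite !Xx.
have [w [aw Vw Dw cw smallG]] := picard_limit p X S A r0 p0 S0 A0 aX
  (fun n => etrans (X0 n) (esym (X0 0%N))) VX DX.
have eqw (v : 'cV[R]_d) t : 0 <= t -> t <= S -> (forall n, X n t = v) -> w t = v.
  move=> t0 tS Hv; apply/colP => i; apply/eqP; rewrite eq_sym -subr_eq0 -normr_le0.
  apply/ler_addgt0Pl => e e0; have [n [Hn _]] := smallG e e0.
  by rewrite addr0 -(Hv n); apply: (le_trans (cw n t i t0 tS)); exact: ltW.
have w0 : w 0 = x0 by apply: eqw => //; exact: ltW.
have wx t : 0 <= t -> t <= sg -> w t = x t.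
  by move=> t0 ts; apply: eqw => //; [exact: le_trans ts sgS'|move=> n; exact: Xx].
(* The limit is a fixed point: at time t both w and Phi w are close to X(n+1) = Phi(X n). *)
exists w; split => // t t0 tS; apply/colP => i.
apply/eqP; rewrite eq_sym -subr_eq0 -normr_le0; apply/ler_addgt0Pl => e e0.
have eh0 : 0 < e / 2 by rewrite divr_gt0.
have [n [Hn Hn1]] := smallG _ eh0; set G := (_ * _) in Hn.
have G0 : 0 < G.
  apply: mulr_gt0; first by rewrite ltr_wpDl.
  by apply: mulr_gt0 => //; exact: mulr_gt0.
have VF := contract w (X n) G aw (aX n) w0 (X0 n) G0 (le_trans Vw dr01) (le_trans (VX n) r01) (Dw n)
  (fun t t0 ts => etrans (wx t t0 ts) (esym (Xx n t t0 ts))).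
have {}VF : PV p (fun t => Phi w t - Phi (X n) t) 0 S <= G.
  by apply: (le_trans VF); rewrite ler_piMl // ltW.
have F0 : Phi w 0 = Phi (X n) 0 by rewrite (Phi0 w aw w0) (Phi0 _ (aX n) (X0 n)).
have h1 := PV_diff_value p (Phi w) (Phi (X n)) S G t i p0 (adm_Phi w aw w0).1
  (adm_Phi _ (aX n) (X0 n)).1 F0 VF t0 tS.
have h2 := cw n.+1 t i t0 tS; rewrite (XS n t t0 tS) in h2.
have -> : Phi w t i 0 - w t i 0 = (Phi w t i 0 - Phi (X n) t i 0) + (Phi (X n) t i 0 - w t i 0).
  by rewrite addrA subrK.
rewrite addr0; apply: (le_trans (ler_normD _ _)).
by rewrite (splitr e); apply: lerD; [exact: le_trans h1 (ltW Hn)|exact: le_trans h2 (ltW Hn1)].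
Qed.

(** The solutions on [0,s] for s < t fit together by uniqueness. The linear growth bounds their
    variation uniformly up to t, so the glued path is admissible whatever its value at t, and one
    application of [Phi] supplies the correct value there. *)
Lemma sol_left t : 0 < t -> (forall s, 0 <= s -> s < t -> exists x, sol s x) ->
  exists x, sol t x.
Proof.
move=> t0 ex; have t0' := ltW t0.
have /choice[X HX] : forall s, exists x, 0 <= s -> s < t -> sol s x.
  move=> s; have [/andP[s0 st]|h] := boolP ((0 <= s) && (s < t)).
    by have [x Hx] := ex s s0 st; exists x.
  by exists (fun=> 0) => s0 st; rewrite s0 st in h.
pose xh u : 'cV[R]_d := if u < t then X u u else 0.
have xhE s u : 0 <= u -> u <= s -> s < t -> xh u = X s u.
  move=> u0 us st; rewrite /xh (le_lt_trans us st).
  have Su := HX u u0 (le_lt_trans us st).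
  have Ss := sol_le s u (X s) us (HX s (le_trans u0 us) st).
  exact: (sol_unique u _ _ Su Ss u u0 (lexx _)).
have [Kg Kg0 HKg] := Phi_growth.
have e0 : 0 < 2^-1 / (Kg + 1) :> R.
  by apply: divr_gt0; [rewrite invr_gt0|exact: ltr_wpDl Kg0 ltr01].
have [e e_0 He] := control_left_small c t _ cc t0 e0.
(* From sg on, up to but excluding t, the control is small enough for the growth bound. *)
pose sg := Num.max 0 (t - e / 2).
have sg0 : 0 <= sg by rewrite le_max lexx.
have sgt : sg < t by rewrite gt_max t0 gtrBl divr_gt0.
have tsg : t - e < sg.
  by rewrite lt_max ltrD2l ltrN2 ltr_pdivrMr // ltr_pMr // ltr1n orbT.
pose c0 := 2 `^ p * PV p (Psi l (stop sg (Yop f g a z x0 (X sg)))) 0 t.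
have bound v : sg <= v -> v < t -> PV p (X v) 0 v <= 2 * c0 + 1.
  move=> sv vt; have v0 := le_trans sg0 sv.
  have [av v_0 Hv] := HX v v0 vt.
  have [as_ s_0 Hs] := HX sg sg0 sgt.
  have cS0 : 0 <= c sg v by exact: cc.1.
  apply: (growth_bound c0 (Kg * c sg v)); [|exact: PV_ge0|].
    have h2 : 0 <= 2^-1 :> R by rewrite invr_ge0.
    apply: (small_factor _ _ _ Kg0 h2 cS0).
    exact/ltW/He.
  have fF := (adm_Phi (X v) av v_0).1.
  apply: (le_trans (PV_ext p _ _ 0 v _ v0 fF (lexx _))).
    by move=> r r0 rv; rewrite (Hv r r0 rv).
  apply: (le_trans (HKg (X v) sg v t av v_0 sg0 sv (ltW vt))).
  (* The bound does not depend on v, because all solutions coincide up to sg. *)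
  have -> : stop sg (Yop f g a z x0 (X v)) = stop sg (Yop f g a z x0 (X sg)); last exact: lexx.
  apply: stop_ext => // r r0 rs; apply: (Yop_ext x0 (X v) (X sg) r H av as_ r0) => u u0 ur.
  have us := le_trans (ltW ur) rs.
  by rewrite -(xhE v u u0 (le_trans us sv) vt) -(xhE sg u u0 us sgt).
have xh_after u : t <= u -> xh u = 0 by move=> tu; rewrite /xh ltNge tu.
have axh : adm p xh.
  split=> i.
    apply: (pvb_jump p _ t (2 * c0 + 1) 0 t0 p0); last first.
      by move=> u tu; rewrite /coord xh_after // mxE.
    move=> v v0 vt.
    have key s : sg <= s -> s < t -> pvb p (coord xh i) 0 s (2 * c0 + 1).
      move=> ss st; have s0 := le_trans sg0 ss.
      have [as_ _ _] := HX s s0 st.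
      apply: (pvb_ext _ (coord (X s) i)).
        by move=> r r0 rs; rewrite /coord (xhE s r r0 rs st).
      apply: (pvb_mono _ _ 0 s 0 s _ _ (pvfin_pvb _ _ 0 s (as_.1 i) (lexx _))) => //.
      exact: le_trans (pv_PV p _ i 0 s) (bound s ss st).
    have [vs|sv] := leP v sg; last by apply: key => //; exact: ltW.
    exact: (pvb_mono _ _ 0 sg 0 v _ _ (key sg (lexx _) sgt)).
  apply: rcont_local => s s0; have [st|ts] := ltP s t; last first.
    exists (s + 1), (fun=> 0); split; [by rewrite ltrDl|exact: rcont_cst|].
    by move=> u su _; rewrite /coord xh_after ?mxE // (le_trans ts).
  pose v := (s + t) / 2.
  have [sv vt] : (s < v) * (v < t) := midf_lt st.
  have [av _ _] := HX v (le_trans s0 (ltW sv)) vt.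
  exists v, (coord (X v) i); split => //; first exact: av.2.
  by move=> u su uv; rewrite /coord (xhE v u (le_trans s0 su) uv vt).
have xh0 : xh 0 = x0.
  by rewrite (xhE 0 0 (lexx _) (lexx _) t0); have [_ -> _] := HX 0 (lexx _) t0.
have aF := adm_Phi xh axh xh0.
have ax' := adm_stop p _ t t0' aF.
have Fxh u : 0 <= u -> u < t -> Phi xh u = xh u.
  move=> u0 ut; have [au _ Hu] := HX u u0 ut.
  rewrite (xhE u u u0 (lexx _) ut) (Hu u u0 (lexx _)).
  by apply: (Phi_ext xh (X u) u axh au u0) => r r0 ru; exact: xhE (ltW ru) ut.
(* Before t this path is [xh]; at t it takes the value that the equation prescribes from the
   past. *)
exists (stop t (Phi xh)); split; first exact: ax'.
  by rewrite (stopE _ _ _ (lexx 0) t0'); exact: (Phi0 xh axh xh0).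
move=> u u0 ut; rewrite (stopE _ _ _ u0 ut).
apply: (Phi_ext xh _ u axh ax' u0) => r r0 ru.
have rt := lt_le_trans ru ut.
by rewrite (stopE _ _ _ r0 (ltW rt)); exact: esym (Fxh r r0 rt).
Qed.

Lemma sol_exists T : 0 <= T -> exists x, sol T x.
Proof.
have ex0 : exists x, sol 0 x.
  have ax : adm p (fun=> x0).
    split=> i; last by move=> s s0 e e0; exists 1 => // u _ _; rewrite subrr normr0.
    move=> S; exists 0 => n u _ _ _; rewrite /pvsum big1 // => j _.
    by rewrite /coord subrr normr0 powR0 // gt_eqF.
  exists (fun=> x0); split; [exact: ax|by []|] => t t0 t0'; have -> : t = 0 by apply/eqP; rewrite eq_le t0 t0'.
  by rewrite (Phi0).
move=> T0; have [->//|Tn] := eqVneq T 0.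
have T1 : 0 < T by rewrite lt_neqAle eq_sym Tn.
(* The property propagated is an implication, solvability up to s yields solvability up to t, which
   concatenates trivially. *)
apply: (interval_induction (fun s t => (exists x, sol s x) -> exists x, sol t x)) ex0 => //.
- by move=> r s t _ _ _ h1 h2 /h1.
- move=> s s0; have [[x Hx]|nex] := pselect (exists x, sol s x); last by exists 1.
  by have [e e0 He] := sol_extend s x s0 Hx; exists e => // t st te _; exact: He.
- move=> t t0; have [all_|/existsNP[s]] := pselect (forall s, 0 <= s -> s < t -> exists x, sol s x).
    by exists 1 => // s _ _ _ _; exact: sol_left.
  (* Some s < t admits no solution on [0,s]; then no r between s and t does either, and the
     implication holds vacuously there. *)
  move=> /not_implyP[s0 /not_implyP[st nex]].
  exists (t - s) => [|r r0 tr rt [x Hx]]; first by rewrite subr_gt0.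
  case: nex; exists x; apply: (sol_le r) => //.
  by move: tr; rewrite opprB addrCA subrr addr0 => /ltW.
Qed.

(** By uniqueness the solutions on different intervals agree, so their diagonal solves the equation
    for all times. *)
Lemma global_solution : exists x, [/\ adm p x, x 0 = x0 & forall t, 0 <= t -> x t = Phi x t].
Proof.
have /choice[X HX] : forall S, exists x, 0 <= S -> sol S x.
  move=> S; have [S0|S0] := leP 0 S; last by exists (fun=> 0).
  by have [x Hx] := sol_exists S S0; exists x.
pose x t := X t t.
have xE T t : 0 <= t -> t <= T -> x t = X T t.
  move=> t0 tT; have ST := sol_le T t (X T) tT (HX T (le_trans t0 tT)).
  exact: (sol_unique t _ _ (HX t t0) ST t t0 (lexx _)).
have ax : adm p x.
  apply: adm_local => T T0; exists (X T); split; first by case: (HX T T0).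
  by move=> t t0 tT; exact: xE.
exists x; split; [exact: ax|by have [_ h _] := HX 0 (lexx _)|].
move=> t t0; have [at_ _ Ht] := HX t t0; rewrite {1}/x (Ht t t0 (lexx _)).
by apply: (Phi_ext (X t) x t at_ ax t0) => r r0 rt; rewrite (xE t r r0 (ltW rt)).
Qed.

Lemma global_unique x x' : adm p x -> adm p x' -> x 0 = x0 -> x' 0 = x0 ->
  (forall t, 0 <= t -> x t = Phi x t) -> (forall t, 0 <= t -> x' t = Phi x' t) ->
  forall t, 0 <= t -> x t = x' t.
Proof.
move=> ax ax' xx0 xx0' Hx Hx' t t0; apply: (sol_unique t x x') => //.
  by split => // r r0 _; exact: Hx.
by split => // r r0 _; exact: Hx'.
Qed.

End Solutions.

(** * From vector-valued notions to coordinates *)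

Section VectorPaths.
Context {R : realType} {d : nat}.
Implicit Types (x k : R -> 'cV[R]_d).

Lemma col_norm_ge (v : 'cV[R]_d) i : `|v i 0| <= `|v|.
Proof.
have -> : `|v| = mx_norm v by [].
rewrite mx_normrE.
exact: (le_bigmax_cond 0 (j := (i, 0)) (P := predT) (fun ij : 'I_d * 'I_1 => `|v ij.1 ij.2|) isT).
Qed.

Lemma col_norm_lt (v : 'cV[R]_d) e : 0 < e -> (forall i, `|v i 0| < e) -> `|v| < e.
Proof.
move=> e0 H; have -> : `|v| = mx_norm v by [].
by rewrite mx_normrE; apply: bigmax_lt => // -[i j] _ /=; rewrite (ord1 j).
Qed.

Lemma finite_delta (I : finType) (P : I -> R -> Prop) :
  (forall i (e e' : R), P i e -> e' <= e -> P i e') ->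
  (forall i, exists2 e, 0 < e & P i e) -> exists2 e, 0 < e & forall i, P i e.
Proof.
move=> Pm Pe.
suff [e e0 He] : exists2 e, 0 < e & forall i, i \in index_enum I -> P i e.
  by exists e => // i; apply: He; rewrite mem_index_enum.
elim: (index_enum I) => [|j s [e e0 He]]; first by exists 1.
have [e' e'0 He'] := Pe j; exists (Num.min e e'); first by rewrite lt_min e0.
move=> i; rewrite inE => /orP[/eqP ->|/He h].
  by apply: Pm He' _; rewrite ge_min lexx orbT.
by apply: Pm h _; rewrite ge_min lexx.
Qed.

Lemma cvg_coord (F : set_system R) {FF : Filter F} x (v : 'cV[R]_d) :
  x @ F --> v <-> forall i, coord x i @ F --> v i 0.
Proof.
split=> [H i|H]; apply/cvgrPdist_lt => e e0; near=> t.
  have h : `|v - x t| < e by near: t; exact: (cvgrPdist_lt _ _).1 H e e0.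
  by apply: le_lt_trans h; have := col_norm_ge (v - x t) i; rewrite !mxE.
apply: col_norm_lt => // i; rewrite !mxE; move: i; near: t.
by apply: filter_forall => i; exact: (cvgrPdist_lt _ _).1 (H i) e e0.
Unshelve. all: by end_near. Qed.

Lemma cadlag_coord x : cadlag x <-> forall i, cadlag (coord x i).
Proof.
split=> [[Hr Hl] i|H]; split=> t t0.
- exact: (cvg_coord _ _ _).1 (Hr t t0) i.
- by have [v Hv] := Hl t t0; exists (v i 0); exact: (cvg_coord _ _ _).1 Hv i.
- by apply/cvg_coord => i; exact: (H i).1.
- have /choice[v Hv] : forall i, exists v : R, coord x i @ t^'- --> v by move=> i; exact: (H i).2 t t0.
  exists (\col_i v i); apply/cvg_coord => i; rewrite mxE; exact: Hv.
Qed.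

Lemma lleft_lpath x : cadlag x -> lleft x = lpath x.
Proof.
move=> cx; apply/funext => t; apply/colP => i; rewrite mxE /lleft.
case: ifPn => // t0; rewrite -ltNge in t0.
have [v Hv] := cx.2 t t0.
rewrite (cvg_lim (@norm_hausdorff _ _) Hv); apply/esym/cvg_lim; first exact: norm_hausdorff.
exact: (cvg_coord _ _ _).1 Hv i.
Qed.

Lemma cadlagB (u v : R -> R) : cadlag u -> cadlag v -> cadlag (fun t => u t - v t).
Proof.
move=> [ur ul] [vr vl]; split=> t t0; first by apply: cvgB; [exact: ur|exact: vr].
have [a Ha] := ul t t0; have [b Hb] := vl t t0; exists (a - b); exact: cvgB.
Qed.

Lemma RS_col (U : Type) (W : zmodType) (tag : R -> R -> R) (m : U -> W -> 'cV[R]_d)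
  (h : R -> U) (y : R -> W) T (I : 'cV[R]_d) :
  (forall i, is_RS tag (fun u w => m u w i 0) h y T (I i 0)) -> is_RS tag m h y T I.
Proof.
move=> H e e0.
pose P (i : 'I_d) (del : R) := forall (n : nat) (t : nat -> R), t 0%N = 0 -> t n = T ->
  (forall i, (i < n)%N -> t i <= t i.+1 /\ t i.+1 - t i < del) ->
  `|\sum_(k < n) m (h (tag (t k) (t k.+1))) (y (t k.+1) - y (t k)) i 0 - I i 0| < e.
have [del del0 Hdel] : exists2 del, 0 < del & forall i, P i del.
  apply: finite_delta => [i r r' Hr rr n t t0 tn tm|i]; last first.
    by have [r r0 Hr] := H i e e0; exists r.
  by apply: Hr => // k kn; have [h1 h2] := tm k kn; split => //; exact: lt_le_trans rr.
exists del => // n t t0 tn tm; apply: col_norm_lt => // i.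
by have := Hdel i n t t0 tn tm; rewrite !mxE summxE.
Qed.

Lemma RS_dot (A : R -> 'M[R]_d) (z : R -> 'cV[R]_d) T i (I : 'I_d -> R) :
  (forall j, lRS (fun s => A s i j) (coord z j) T (I j)) ->
  is_RS (@left_tag R) (fun (M : 'M[R]_d) (v : 'cV[R]_d) => (M *m v) i 0) A z T (\sum_j I j).
Proof.
move=> H e e0; have d1 : 0 < d%:R + 1 :> R by rewrite ltr_wpDl.
pose e' := e / (d%:R + 1); have e'0 : 0 < e' by exact: divr_gt0.
pose P (j : 'I_d) (del : R) := forall (n : nat) (t : nat -> R), t 0%N = 0 -> t n = T ->
  (forall i, (i < n)%N -> t i <= t i.+1 /\ t i.+1 - t i < del) ->
  `|\sum_(k < n) A (left_tag (t k) (t k.+1)) i j * (coord z j (t k.+1) - coord z j (t k)) - I j| < e'.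
have [del del0 Hdel] : exists2 del, 0 < del & forall j, P j del.
  apply: finite_delta => [j r r' Hr rr n t t0 tn tm|j]; last first.
    by have [r r0 Hr] := H j e' e'0; exists r.
  by apply: Hr => // k kn; have [h1 h2] := tm k kn; split => //; exact: lt_le_trans rr.
exists del => // n t t0 tn tm.
have -> : \sum_(k < n) (A (left_tag (t k) (t k.+1)) *m (z (t k.+1) - z (t k))) i 0 - \sum_j I j =
  \sum_j (\sum_(k < n) A (left_tag (t k) (t k.+1)) i j * (coord z j (t k.+1) - coord z j (t k)) - I j).
  rewrite sumrB exchange_big /=; congr (_ - _); apply: eq_bigr => k _.
  by rewrite mxE; apply: eq_bigr => j _; rewrite /coord !mxE.
apply: (le_lt_trans (ler_norm_sum _ _ _)).
apply: (@le_lt_trans _ _ (\sum_(j < d) e')).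
  by apply: ler_sum => j _; apply/ltW; exact: Hdel.
rewrite sumr_const card_ord -mulr_natl /e' mulrCA gtr_pMr //.
by rewrite ltr_pdivrMr // mul1r ltrDl.
Qed.

Lemma pvar_fin_pvfin (W : zmodType) (N : W -> R) (p : R) (X : R -> W) (xi : R -> R) : 0 <= p ->
  (forall s t, `|xi t - xi s| <= N (X t - X s)) ->
  (forall T, 0 <= T -> pvar_fin N p X T) -> pvfin p xi.
Proof.
move=> p0 HN H T; have [T0|T0] := leP 0 T; last first.
  exists 0 => n u ndu u0 uT; exfalso.
  by have := lt_le_trans (le_lt_trans uT T0) u0; rewrite ltNge ndu.
have [M HM] := H T T0; exists M => n u ndu u0 uT.
(* [pvar_fin] speaks of partitions from 0 to T exactly, so 0 is prepended and T is repeated after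
   the last node; the two extra terms are nonnegative. *)
pose v i := if i is j.+1 then (if (j <= n)%N then u j else T) else 0.
have vS i : (i < n.+2)%N -> v i <= v i.+1.
  case: i => [|i] /=; first by move=> _; exact: u0.
  rewrite ltnS => i_n; rewrite -(ltnS i n) i_n; case: ifP => _; first exact: ndu.
  by apply: le_trans uT; exact: ndu.
have := HM n.+2 v erefl; rewrite {1}/v /= ltnn => /(_ erefl vS).
apply: le_trans; rewrite big_ord_recl big_ord_recr /=.
rewrite -[leLHS]add0r; apply: lerD; first exact: powR_ge0.
rewrite -[leLHS]addr0; apply: lerD; last exact: powR_ge0.
apply: ler_sum => i _; rewrite /bump /= !add1n (ltnW (ltn_ord i)) (ltn_ord i).
by apply: powR_le => //; exact: HN.
Qed.

Lemma adm_pvar_fin (p : R) x T : 0 < p -> adm p x -> 0 <= T -> pvar_fin (@enorm R d) p x T.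
Proof.
move=> p0 ax T0; exists (d%:R `^ p * PV p x 0 T) => n t t0 tn tm.
have cw := PV_control p x ax.1.
have key (m : nat) : (m <= n)%N -> 0 <= t m /\
   \sum_(i < m) enorm (x (t i.+1) - x (t i)) `^ p <= d%:R `^ p * PV p x 0 (t m).
  elim: m => [_|k IH kn].
    by rewrite t0 big_ord0 mulr_ge0 ?powR_ge0 ?PV_ge0.
  have [tk0 Hk] := IH (ltnW kn); have tt := tm k kn.
  split; first exact: le_trans tt.
  rewrite big_ord_recr /=; apply: (@le_trans _ _ (d%:R `^ p * (PV p x 0 (t k) + PV p x (t k) (t k.+1)))).
    rewrite mulrDr; apply: lerD => //.
    rewrite -[X in _ <= _ * X](powRK p) ?PV_ge0 // -powRM ?ler0n ?powR_ge0 //.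
    apply: powR_le; [exact: ltW|exact: enorm_ge0|].
    by apply: (le_trans (enorm_le _)); exact: PV_incr ax.1 tk0 tt.
  by apply: ler_wpM2l; [exact: powR_ge0|exact: cw.2].
by have [_] := key n (leqnn n); rewrite tn.
Qed.

End VectorPaths.

(** * Solutions of the equation as fixed points *)

Section SolutionEquivalence.
Context {R : realType} {d : nat}.
Context {p al C1 gam L : R} {f : 'cV[R]_d -> 'cV[R]_d} {g : 'cV[R]_d -> 'M[R]_d}
  {a : R -> R} {z l : R -> 'cV[R]_d} {x0 : 'cV[R]_d}.
Implicit Types (x k : R -> 'cV[R]_d).
Hypothesis H : setting p al C1 gam L f g a z.

Lemma RS_drift x t : adm p x -> 0 <= t ->
  is_RS (@left_tag R) (fun (u : 'cV[R]_d) (r : R) => r *: u) (fun s => f (lpath x s)) a t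
    (\col_i RSint (fun s => f (lpath x s) i 0) a t).
Proof.
move=> ax t0; apply: RS_col => i; rewrite mxE.
have HI := RSintP _ _ _ (RS_f x i t H ax t0).
move=> e e0; have [r r0 Hr] := HI e e0; exists r => // n u u0 un um.
have := Hr n u u0 un um.
by under eq_bigr do rewrite mulrC; under [X in _ -> is_true (`|X - _| < _)]eq_bigr do rewrite mxE.
Qed.

Lemma RS_diffusion x t : adm p x -> 0 <= t ->
  is_RS (@left_tag R) (fun (M : 'M[R]_d) (v : 'cV[R]_d) => M *m v) (fun s => g (lpath x s)) z t
    (\col_i \sum_j RSint (fun s => g (lpath x s) i j) (coord z j) t).
Proof.
move=> ax t0; apply: RS_col => i; rewrite mxE.
by apply: RS_dot => j; exact: RSintP (RS_g x i j t H ax t0).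
Qed.

(** The integrals are unique, so y is the integral operator applied to x; the complementarity
    condition then forces k to be the running maximum. *)
Lemma solution_fixpoint x k : barrier l x0 -> solution p f g a z l x0 x k ->
  [/\ adm p x, x 0 = x0, (forall t, 0 <= t -> x t = @Phi R d f g a z l x0 x t) &
    forall t, 0 <= t -> x t = Yop f g a z x0 x t + k t].
Proof.
move=> hl [cx [_ [vx [y [_ [Hy [SP1 [k0 [mk Hk]]]]]]]]].
have p0 := st_p0 H.
have ax : adm p x.
  split=> i; last by apply: cadlag_rcont; exact: (cadlag_coord x).1.
  apply: (pvar_fin_pvfin _ (@enorm R d) p x _ (ltW p0) _ vx) => s t.
  exact: enormB_ge.
have yE t : 0 <= t -> y t = Yop f g a z x0 x t.
  move=> t0; have [I1 [I2 [R1 [R2 ->]]]] := Hy t t0.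
  rewrite (lleft_lpath x cx) in R1 R2.
  rewrite (RS_unique _ _ _ _ _ _ _ _ _ _ t0 R1 (RS_drift x t ax t0)).
  rewrite (RS_unique _ _ _ _ _ _ _ _ _ _ t0 R2 (RS_diffusion x t ax t0)).
  by apply/colP => i; rewrite !mxE.
have xE t : 0 <= t -> x t = Yop f g a z x0 x t + k t.
  by move=> t0; have [-> _] := SP1 t t0; rewrite yE.
have xx0 : x 0 = x0 by rewrite xE // k0 addr0; exact: (Yop0 x0 x H ax).
split => // t t0; rewrite {1}(xE t t0); apply/colP => i; rewrite !mxE.
(* This v equals l - y on R^+; written through k and x, it makes k - v equal to x - l at every time,
   negative ones included. *)
congr (_ + _); pose v s := k s i 0 - (x s i 0 - l s i 0).
have -> : k t i 0 = rmax v t.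
  apply: (reflection_rmax v (fun s => k s i 0) t) => //.
  - by move=> s s0; rewrite /v gerBl subr_ge0; have [_ h] := SP1 s s0; exact: h.
  - by rewrite k0 mxE.
  - by move=> r s r0 rs; exact: mk.
  have := Hk i t t0; congr (is_RS _ _ _ _ _ _); apply/funext => s; rewrite /v; ring.
by apply: rmax_ext => s s0 st; rewrite /v (xE s s0) /coord !mxE; ring.
Qed.

Lemma fixpoint_solution x : barrier l x0 -> (forall i, cadlag (coord l i)) -> adm p x -> x 0 = x0 ->
  (forall t, 0 <= t -> x t = @Phi R d f g a z l x0 x t) ->
  exists x' k, solution p f g a z l x0 x' k.
Proof.
move=> hl cl ax xx0 Hx; have p0 := st_p0 H.
(* The image [x1] is used instead of x: it agrees with x on R^+, and its decomposition as y + k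
   holds at all times by definition. *)
pose y := Yop f g a z x0 x; pose x1 := @Phi R d f g a z l x0 x.
pose v i s := coord l i s - coord y i s.
pose k t : 'cV[R]_d := \col_i rmax (v i) t.
have x1E t : x1 t = y t + k t by [].
have ay : adm p y := adm_Yop H x ax xx0.
have ax1 : adm p x1 := adm_Phi H hl x ax xx0.
have cy i : cadlag (coord y i) by exact: adm_cadlag ay.
have cv i : cadlag (v i) by exact: cadlagB.
have bv i : bounded_on (v i) by exact: cadlag_bounded.
have kE i : coord k i = rmax (v i) by apply/funext => t; rewrite /coord mxE.
have xiE i t : x1 t i 0 = coord y i t + rmax (v i) t := congr1 (@^~ t) (coord_Psi l y i).
have cx1 : cadlag x1 by apply/cadlag_coord => i; exact: adm_cadlag ax1.
exists x1, k; split => //; split.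
  by apply/cadlag_coord => i; rewrite kE; apply: rmax_cadlag => //; exact: cadlag_rcont.
split; first by move=> T T0; exact: adm_pvar_fin.
exists y; split; first exact/cadlag_coord.
split.
  move=> t t0; exists (\col_i RSint (fun s => f (lpath x1 s) i 0) a t).
  exists (\col_i \sum_j RSint (fun s => g (lpath x1 s) i j) (coord z j) t).
  rewrite (lleft_lpath x1 cx1); split; first exact: RS_drift.
  split; first exact: RS_diffusion.
  have -> : y t = Yop f g a z x0 x1 t.
    by apply: (Yop_ext x0 x x1 t H ax ax1 t0) => s s0 _; exact: Hx.
  by apply/colP => i; rewrite !mxE.
have y0 : y 0 = x0 := Yop0 x0 x H ax.
split.
  move=> t t0; split; first exact: x1E.
  by move=> i; rewrite xiE -lerBlDl; exact: (rmax_ge (v i) (bv i) t t t0 (lexx _)).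
split.
  apply/matrixP => i j; rewrite !mxE; apply: rmax0 => //.
  by rewrite /v /coord y0 subr_le0; have [] := hl i.
split.
  by move=> i s t s0 st; rewrite !mxE; exact: rmax_mono.
move=> i t t0; have := rmax_flat (v i) t (cv i) t0.
congr (is_RS _ _ _ _ _ _); apply/funext => s; last by rewrite mxE.
by rewrite xiE /v /coord; ring.
Qed.

End SolutionEquivalence.

Theorem theorem4 (R : realType) (d : nat) (p : R)
  (f : 'cV[R]_d -> 'cV[R]_d) (g : 'cV[R]_d -> 'M[R]_d)
  (a : R -> R) (z l : R -> 'cV[R]_d) (x0 : 'cV[R]_d) :
  1 <= p ->
  (* (H1) *)
  continuous f ->
  (exists L : R, 0 < L /\ forall x, enorm (f x) <= L * (1 + enorm x)) ->
  (exists alpha C : R, p - 1 < alpha <= 1 /\ 0 < C /\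
     forall x y, opnorm (g x - g y) <= C * enorm (x - y) `^ alpha) ->
  (* (H2) *)
  (forall k : nat, exists Lk : R, 0 < Lk /\
     forall x y, enorm x <= k%:R -> enorm y <= k%:R ->
       enorm (f x - f y) <= Lk * enorm (x - y)) ->
  (forall (i j : 'I_d) (x : 'cV[R]_d), differentiable (fun v => g v i j) x) ->
  (exists gamma : R, p - 1 < gamma <= 1 /\
     forall k : nat, exists C : R, 0 < C /\
       forall (i j : 'I_d) x y, enorm x <= k%:R -> enorm y <= k%:R ->
         enorm (grad (fun v => g v i j) x - grad (fun v => g v i j) y)
           <= C * enorm (x - y) `^ gamma) ->
  (* data *)
  cadlag a -> cadlag z -> cadlag l ->
  (forall T, 0 <= T -> pvar_fin (fun r : R => `|r|) 1 a T) ->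
  (forall T, 0 <= T -> pvar_fin (@enorm R d) p z T) ->
  (forall i, l 0 i 0 <= x0 i 0) ->
  (exists x k, solution p f g a z l x0 x k) /\
  (forall x k x' k', solution p f g a z l x0 x k ->
     solution p f g a z l x0 x' k' ->
     forall t, 0 <= t -> x t = x' t /\ k t = k' t).
Proof.
move=> p1 _ hfg hga hfl hgd hgg ca cz cl va vz l0.
have p0 : 0 < p by exact: lt_le_trans p1.
have [L L0 HL] := growth_coord f hfg.
have [al [C1 [al0 al1 C10 HC1]]] := holder_coord g p p1 hga.
have [gam [gam0 gam1 Hgam]] := four_points_coord g p p1 hgd hgg.
have st : setting p al C1 gam L f g a z.
  apply: Setting => //.
  - by rewrite al0.
  - by rewrite gam0.
  - exact: lipschitz_coord.
  - split; first exact: cadlag_rcont.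
    by apply: (pvar_fin_pvfin _ (fun r : R => `|r|) 1 a) => // s t.
  - split=> i; last by apply: cadlag_rcont; exact: (cadlag_coord z).1.
    by apply: (pvar_fin_pvfin _ (@enorm R d) p z) => // [|s t]; [exact: ltW|exact: enormB_ge].
have cl' i : cadlag (coord l i) by exact: (cadlag_coord l).1.
have hl : barrier l x0.
  by move=> i; split; [exact: cadlag_rcont|exact: cadlag_bounded|exact: l0].
split.
  have [x [ax xx0 Hx]] := global_solution st hl.
  exact: (fixpoint_solution st x hl cl' ax xx0 Hx).
move=> x k x' k' sx sx' t t0.
have [ax xx0 Hx xE] := solution_fixpoint st x k hl sx.
have [ax' xx0' Hx' xE'] := solution_fixpoint st x' k' hl sx'.
have xx' := global_unique st hl x x' ax ax' xx0 xx0' Hx Hx'.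
have xt := xx' t t0; split => //.
(* Equal paths have equal integral parts, so the reflection terms are recovered by cancellation. *)
move: xt; rewrite (xE t t0) (xE' t t0).
have -> : Yop f g a z x0 x t = Yop f g a z x0 x' t.
  by apply: (Yop_ext x0 x x' t st ax ax' t0) => s s0 _; exact: xx'.
exact: addrI.
Qed.
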